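(* Let $\nu(u,v)$ and $\mu(u,v)$ be smooth functions on a domain $\mathcal D\subset\mathbb R^2$ satisfying $$\mu>0,\quad \nu\neq0,\quad \mu^2\neq\nu^2,\quad |\mu^2-\nu^2|_v\,|\mu^2-\nu^2|_u\neq0,$$ $$\tfrac14\sqrt{|\mu^2-\nu^2|}\,\Delta\ln|\mu^2-\nu^2|+\nu^2+\mu^2=0,\qquad \tfrac12\sqrt{|\mu^2-\nu^2|}\,\Delta\ln\Big|\frac{\mu+\nu}{\mu-\nu}\Big|+2\nu\mu=0,$$ where $\Delta=\partial_u^2+\partial_v^2$. Then there exists a unique up to a rigid motion of $\mathbb R^4$ strongly regular minimal surface of general type $M^2: z=z(u,v)$, $(u,v)\in\mathcal D_0$ for some subdomain $\mathcal D_0\subset\mathcal D$, whose invariants are $\nu(u,v)$ and $\mu(u,v)$; furthermore $(u,v)$ are canonical parameters of $M^2$.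
   Context: $\mathbb R^4$ carries the standard metric $g=\langle\cdot,\cdot\rangle$ and flat connection $\nabla'$; everything is smooth and local. For a regular surface $M^2: z=z(u,v)$ let $E,F,G$ be the first fundamental form coefficients, $\sigma$ the second fundamental form, $K$ the Gauss curvature, and $\varkappa$ the curvature of the normal connection, $\varkappa=g(R^\perp(x,y)n_2,n_1)$ for a positively oriented orthonormal frame $(x,y,n_1,n_2)$ with $x,y$ tangent. Minimal means $\sigma(x,x)+\sigma(y,y)=0$ for orthonormal tangent $x,y$. A minimal surface is of general type if $K^2-\varkappa^2>0$ and $\varkappa\neq0$ everywhere. The ellipse of curvature at $p$ is $\{\sigma(v,v): v\in T_pM^2,\ |v|=1\}$; a tangent line is canonical if it is collinear with an axis of this ellipse. The geometric frame is a positively oriented orthonormal frame $\{x,y,n_1,n_2\}$ with $x,y$ canonical tangent fields and $n_1,n_2$ normal, satisfying $\nabla'_xx=\gamma_1y+\nu n_1$, $\nabla'_xy=-\gamma_1x+\mu n_2$, $\nabla'_yx=-\gamma_2y+\mu n_2$, $\nabla'_yy=\gamma_2x-\nu n_1$, $\nabla'_xn_1=-\nu x+\beta_1n_2$, $\nabla'_yn_1=\nu y+\beta_2n_2$, $\nabla'_xn_2=-\mu y-\beta_1n_1$, $\nabla'_yn_2=-\mu x-\beta_2n_1$, with $\mu>0$, $\nu\ne0$, $\mu^2\ne\nu^2$; the functions $\nu,\mu,\gamma_1,\gamma_2,\beta_1,\beta_2$ are the invariants of $M^2$. Parameters $(u,v)$ are semi-canonical if the parametric lines are integral curves of the canonical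 tangents, with $F=0$, $x=z_u/\sqrt E$, $y=z_v/\sqrt G$; then $\gamma_1=-y(\ln\sqrt E)$, $\gamma_2=-x(\ln\sqrt G)$. A minimal surface of general type is strongly regular if $\gamma_1\gamma_2\neq0$ everywhere. Semi-canonical parameters on a strongly regular minimal surface of general type are canonical if $E\sqrt{|\mu^2-\nu^2|}=G\sqrt{|\mu^2-\nu^2|}=1$. *)

(* Defs.v *)
From Stdlib Require Import Reals ClassicalEpsilon.
Open Scope R_scope.

Record V4 := mkV4 { c0 : R; c1 : R; c2 : R; c3 : R }.

Definition vadd (a b : V4) : V4 :=
  mkV4 (c0 a + c0 b) (c1 a + c1 b) (c2 a + c2 b) (c3 a + c3 b).
Definition vscale (k : R) (a : V4) : V4 :=
  mkV4 (k * c0 a) (k * c1 a) (k * c2 a) (k * c3 a).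
Definition vsub (a b : V4) : V4 := vadd a (vscale (-1) b).
Definition vdot (a b : V4) : R :=
  c0 a * c0 b + c1 a * c1 b + c2 a * c2 b + c3 a * c3 b.

Definition det3 (a1 a2 a3 b1 b2 b3 d1 d2 d3 : R) : R :=
  a1 * (b2 * d3 - b3 * d2) - b1 * (a2 * d3 - a3 * d2) + d1 * (a2 * b3 - a3 * b2).

Definition det4 (a b c d : V4) : R :=
    c0 a * det3 (c1 b) (c2 b) (c3 b) (c1 c) (c2 c) (c3 c) (c1 d) (c2 d) (c3 d)
  - c0 b * det3 (c1 a) (c2 a) (c3 a) (c1 c) (c2 c) (c3 c) (c1 d) (c2 d) (c3 d)
  + c0 c * det3 (c1 a) (c2 a) (c3 a) (c1 b) (c2 b) (c3 b) (c1 d) (c2 d) (c3 d)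
  - c0 d * det3 (c1 a) (c2 a) (c3 a) (c1 b) (c2 b) (c3 b) (c1 c) (c2 c) (c3 c).

Definition open2 (D : R -> R -> Prop) : Prop :=
  forall u v, D u v -> exists r, r > 0 /\
    forall a b, Rabs (a - u) < r -> Rabs (b - v) < r -> D a b.

Definition path_connected2 (D : R -> R -> Prop) : Prop :=
  forall u1 v1 u2 v2, D u1 v1 -> D u2 v2 ->
    exists g h : R -> R,
      (forall t, continuity_pt g t) /\ (forall t, continuity_pt h t) /\
      g 0 = u1 /\ h 0 = v1 /\ g 1 = u2 /\ h 1 = v2 /\
      (forall t, 0 <= t <= 1 -> D (g t) (h t)).

Definition domain2 (D : R -> R -> Prop) : Prop :=
  open2 D /\ (exists u v, D u v) /\ path_connected2 D.

Definition subdomain (D0 D : R -> R -> Prop) : Prop :=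
  domain2 D0 /\ (forall u v, D0 u v -> D u v).

(* the partial derivative (the value is the true derivative whenever it exists) *)
Definition pu (f : R -> R -> R) (u v : R) : R :=
  epsilon (inhabits 0) (fun l => derivable_pt_lim (fun s => f s v) u l).
Definition pv (f : R -> R -> R) (u v : R) : R :=
  epsilon (inhabits 0) (fun l => derivable_pt_lim (fun s => f u s) v l).

Definition lap (f : R -> R -> R) (u v : R) : R := pu (pu f) u v + pv (pv f) u v.

Definition cont_on (D : R -> R -> Prop) (f : R -> R -> R) : Prop :=
  forall u v, D u v -> forall eps, eps > 0 -> exists delta, delta > 0 /\
    forall a b, Rabs (a - u) < delta -> Rabs (b - v) < delta ->
      Rabs (f a b - f u v) < eps.

CoInductive smooth_on (D : R -> R -> Prop) (f : R -> R -> R) : Prop :=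
  smooth_on_intro :
    cont_on D f ->
    (forall u v, D u v -> derivable_pt_lim (fun s => f s v) u (pu f u v)) ->
    (forall u v, D u v -> derivable_pt_lim (fun s => f u s) v (pv f u v)) ->
    smooth_on D (pu f) -> smooth_on D (pv f) -> smooth_on D f.

Definition VF := R -> R -> V4.

Definition vsmooth_on (D : R -> R -> Prop) (X : VF) : Prop :=
  smooth_on D (fun u v => c0 (X u v)) /\ smooth_on D (fun u v => c1 (X u v)) /\
  smooth_on D (fun u v => c2 (X u v)) /\ smooth_on D (fun u v => c3 (X u v)).

Definition Pu (X : VF) : VF := fun u v =>
  mkV4 (pu (fun a b => c0 (X a b)) u v) (pu (fun a b => c1 (X a b)) u v)
       (pu (fun a b => c2 (X a b)) u v) (pu (fun a b => c3 (X a b)) u v).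
Definition Pv (X : VF) : VF := fun u v =>
  mkV4 (pv (fun a b => c0 (X a b)) u v) (pv (fun a b => c1 (X a b)) u v)
       (pv (fun a b => c2 (X a b)) u v) (pv (fun a b => c3 (X a b)) u v).

Definition fadd (X Y : VF) : VF := fun u v => vadd (X u v) (Y u v).
Definition fsub (X Y : VF) : VF := fun u v => vsub (X u v) (Y u v).
Definition fscale (k : R -> R -> R) (X : VF) : VF := fun u v => vscale (k u v) (X u v).

Section Surface.
Variable z : VF.

Definition zu : VF := Pu z.
Definition zv : VF := Pv z.
Definition E_ (u v : R) : R := vdot (zu u v) (zu u v).
Definition F_ (u v : R) : R := vdot (zu u v) (zv u v).
Definition G_ (u v : R) : R := vdot (zv u v) (zv u v).
Definition detg (u v : R) : R := E_ u v * G_ u v - F_ u v ^ 2.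

(* coordinates (w.r.t. z_u, z_v) of the tangent projection of a vector W at (u,v) *)
Definition tca (W : V4) (u v : R) : R :=
  (G_ u v * vdot W (zu u v) - F_ u v * vdot W (zv u v)) / detg u v.
Definition tcb (W : V4) (u v : R) : R :=
  (E_ u v * vdot W (zv u v) - F_ u v * vdot W (zu u v)) / detg u v.
Definition tanv (W : V4) (u v : R) : V4 :=
  vadd (vscale (tca W u v) (zu u v)) (vscale (tcb W u v) (zv u v)).
Definition norv (W : V4) (u v : R) : V4 := vsub W (tanv W u v).
Definition tanf (W : VF) : VF := fun u v => tanv (W u v) u v.
Definition norf (W : VF) : VF := fun u v => norv (W u v) u v.

(* flat connection nabla'_X W for a tangent field X = a z_u + b z_v *)
Definition dirD (X W : VF) : VF := fun u v =>
  vadd (vscale (tca (X u v) u v) (Pu W u v)) (vscale (tcb (X u v) u v) (Pv W u v)).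

Definition brk (X Y : VF) : VF := fsub (dirD X Y) (dirD Y X).

Definition lc (X Y : VF) : VF := tanf (dirD X Y).
Definition Rcurv (X Y W : VF) : VF :=
  fsub (fsub (lc X (lc Y W)) (lc Y (lc X W))) (lc (brk X Y) W).
Definition gaussK (u v : R) : R :=
  vdot (Rcurv zu zv zv u v) (zu u v) / detg u v.

Definition nc (X xi : VF) : VF := norf (dirD X xi).
Definition Rperp (X Y xi : VF) : VF :=
  fsub (fsub (nc X (nc Y xi)) (nc Y (nc X xi))) (nc (brk X Y) xi).
Definition varkappa (x y n1 n2 : VF) (u v : R) : R :=
  vdot (Rperp x y n2 u v) (n1 u v).

(* second fundamental form at (u,v) on tangent vectors a z_u + b z_v, c z_u + d z_v *)
Definition sigma_pt (u v a b c d : R) : V4 :=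
  vadd (vscale (a * c) (norv (Pu (Pu z) u v) u v))
  (vadd (vscale (a * d + b * c) (norv (Pv (Pu z) u v) u v))
        (vscale (b * d) (norv (Pv (Pv z) u v) u v))).

Definition tvec (u v a b : R) : V4 := vadd (vscale a (zu u v)) (vscale b (zv u v)).

(* mean curvature vector H = (1/2) trace_g sigma : centre of the ellipse of curvature *)
Definition Hvec (u v : R) : V4 :=
  vscale (/ (2 * detg u v))
   (vadd (vscale (G_ u v) (sigma_pt u v 1 0 1 0))
   (vadd (vscale (-2 * F_ u v) (sigma_pt u v 1 0 0 1))
         (vscale (E_ u v) (sigma_pt u v 0 1 0 1)))).

(* the unit tangent direction (a,b) is canonical: sigma(w,w) is a vertex of the
   ellipse of curvature, i.e. it lies on an axis of the ellipse *)
Definition canonical_dir (u v a b : R) : Prop :=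
  vdot (tvec u v a b) (tvec u v a b) = 1 /\
  let dist a' b' := vdot (vsub (sigma_pt u v a' b' a' b') (Hvec u v))
                         (vsub (sigma_pt u v a' b' a' b') (Hvec u v)) in
  ((forall c d, vdot (tvec u v c d) (tvec u v c d) = 1 -> dist a b <= dist c d) \/
   (forall c d, vdot (tvec u v c d) (tvec u v c d) = 1 -> dist c d <= dist a b)).

Variable D0 : R -> R -> Prop.

Definition regular_surface : Prop :=
  vsmooth_on D0 z /\ forall u v, D0 u v -> detg u v > 0.

Definition minimal : Prop :=
  forall u v, D0 u v -> forall a b c d,
    vdot (tvec u v a b) (tvec u v a b) = 1 ->
    vdot (tvec u v c d) (tvec u v c d) = 1 ->
    vdot (tvec u v a b) (tvec u v c d) = 0 ->
    vadd (sigma_pt u v a b a b) (sigma_pt u v c d c d) = mkV4 0 0 0 0.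

Definition is_tangent (X : VF) (u v : R) : Prop :=
  exists a b, X u v = tvec u v a b.
Definition is_normal (X : VF) (u v : R) : Prop :=
  vdot (X u v) (zu u v) = 0 /\ vdot (X u v) (zv u v) = 0.

Definition adapted_frame_at (x y n1 n2 : VF) (u v : R) : Prop :=
  vdot (x u v) (x u v) = 1 /\ vdot (y u v) (y u v) = 1 /\
  vdot (n1 u v) (n1 u v) = 1 /\ vdot (n2 u v) (n2 u v) = 1 /\
  vdot (x u v) (y u v) = 0 /\ vdot (x u v) (n1 u v) = 0 /\
  vdot (x u v) (n2 u v) = 0 /\ vdot (y u v) (n1 u v) = 0 /\
  vdot (y u v) (n2 u v) = 0 /\ vdot (n1 u v) (n2 u v) = 0 /\
  det4 (x u v) (y u v) (n1 u v) (n2 u v) > 0 /\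
  is_tangent x u v /\ is_tangent y u v.

Definition general_type : Prop :=
  forall x y n1 n2 : VF,
    vsmooth_on D0 x -> vsmooth_on D0 y -> vsmooth_on D0 n1 -> vsmooth_on D0 n2 ->
    (forall u v, D0 u v -> adapted_frame_at x y n1 n2 u v) ->
    forall u v, D0 u v ->
      gaussK u v ^ 2 - varkappa x y n1 n2 u v ^ 2 > 0 /\ varkappa x y n1 n2 u v <> 0.

Definition geometric_frame (x y n1 n2 : VF) (nu mu g1 g2 b1 b2 : R -> R -> R) : Prop :=
  vsmooth_on D0 x /\ vsmooth_on D0 y /\ vsmooth_on D0 n1 /\ vsmooth_on D0 n2 /\
  forall u v, D0 u v ->
    adapted_frame_at x y n1 n2 u v /\
    (exists a b, x u v = tvec u v a b /\ canonical_dir u v a b) /\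
    (exists a b, y u v = tvec u v a b /\ canonical_dir u v a b) /\
    mu u v > 0 /\ nu u v <> 0 /\ mu u v ^ 2 <> nu u v ^ 2 /\
    dirD x x u v = vadd (vscale (g1 u v) (y u v)) (vscale (nu u v) (n1 u v)) /\
    dirD x y u v = vadd (vscale (- g1 u v) (x u v)) (vscale (mu u v) (n2 u v)) /\
    dirD y x u v = vadd (vscale (- g2 u v) (y u v)) (vscale (mu u v) (n2 u v)) /\
    dirD y y u v = vadd (vscale (g2 u v) (x u v)) (vscale (- nu u v) (n1 u v)) /\
    dirD x n1 u v = vadd (vscale (- nu u v) (x u v)) (vscale (b1 u v) (n2 u v)) /\
    dirD y n1 u v = vadd (vscale (nu u v) (y u v)) (vscale (b2 u v) (n2 u v)) /\
    dirD x n2 u v = vadd (vscale (- mu u v) (y u v)) (vscale (- b1 u v) (n1 u v)) /\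
    dirD y n2 u v = vadd (vscale (- mu u v) (x u v)) (vscale (- b2 u v) (n1 u v)).

Definition canonical_SRMGT (nu mu : R -> R -> R) : Prop :=
  regular_surface /\ minimal /\ general_type /\
  exists (x y n1 n2 : VF) (g1 g2 b1 b2 : R -> R -> R),
    geometric_frame x y n1 n2 nu mu g1 g2 b1 b2 /\
    forall u v, D0 u v ->
      (* semi-canonical parameters *)
      F_ u v = 0 /\
      x u v = vscale (/ sqrt (E_ u v)) (zu u v) /\
      y u v = vscale (/ sqrt (G_ u v)) (zv u v) /\
      (* strongly regular *)
      g1 u v * g2 u v <> 0 /\
      (* canonical *)
      E_ u v * sqrt (Rabs (mu u v ^ 2 - nu u v ^ 2)) = 1 /\
      G_ u v * sqrt (Rabs (mu u v ^ 2 - nu u v ^ 2)) = 1.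

End Surface.

Record motion := mkMotion { q0 : V4; q1 : V4; q2 : V4; q3 : V4; tr : V4 }.

Definition is_rigid_motion (m : motion) : Prop :=
  vdot (q0 m) (q0 m) = 1 /\ vdot (q1 m) (q1 m) = 1 /\
  vdot (q2 m) (q2 m) = 1 /\ vdot (q3 m) (q3 m) = 1 /\
  vdot (q0 m) (q1 m) = 0 /\ vdot (q0 m) (q2 m) = 0 /\ vdot (q0 m) (q3 m) = 0 /\
  vdot (q1 m) (q2 m) = 0 /\ vdot (q1 m) (q3 m) = 0 /\ vdot (q2 m) (q3 m) = 0 /\
  det4 (q0 m) (q1 m) (q2 m) (q3 m) = 1.

Definition apply_motion (m : motion) (p : V4) : V4 :=
  vadd (vadd (vadd (vscale (c0 p) (q0 m)) (vscale (c1 p) (q1 m)))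
             (vadd (vscale (c2 p) (q2 m)) (vscale (c3 p) (q3 m)))) (tr m).

(* Main.v *)
(* Writing E = G = s^2, the frame equations of a surface in canonical parameters form a linear system
   for the frame and the position vector with coefficients s, s nu, s mu, the derivatives of ln s,
   and A = s beta_1, B = s beta_2. The Codazzi equations determine A and B in terms of nu and mu, so
   the rotation carrying the frame of one surface with the given invariants to that of another one
   has zero derivative, which is uniqueness. Conversely, with s^2 sqrt|mu^2 - nu^2| = 1 the Codazzi
   equations become identities, while the Gauss and Ricci equations are the two given partial
   differential equations. They make the linear system flat, hence solvable on a small square; the
   solution stays orthonormal since the matrices of the frame part are skew-symmetric. *)

From Stdlib Require Import Reals Lra Lia Psatz ClassicalEpsilon PSeries_reg.
From Coquelicot Require Import Coquelicot.
Require Import Defs.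
Open Scope R_scope.

(** * Calculus of partial derivatives *)

(** With p = s nu and q = s mu the four Codazzi equations decouple in p + q and p - q. Along v the
    logarithmic derivatives of p + q and p - q are -(ln s)_v - A and -(ln s)_v + A; along u they are
    -(ln s)_u + B and -(ln s)_u - B. The sums say that s^4 |mu^2 - nu^2| is constant, which is the
    normalization of canonical parameters. The differences give A = -h_v / 2 and B = h_u / 2 for h =
    ln |(mu + nu) / (mu - nu)|. This is why the Gauss and Ricci equations become Laplace equations
    for ln |mu^2 - nu^2| and h. Two obstacles shape the proof. Solving a flat system first along an
    axis and then across it gives no regularity in the first variable, so differentiability there
    has to come from quantitative estimates. And general type is a condition on every smooth adapted
    frame, so the normal curvature is needed for arbitrary tangent fields with their Lie bracket,
    not only for the coordinate fields. *)

Lemma pu_val f u v l : derivable_pt_lim (fun s => f s v) u l -> pu f u v = l.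
Proof.
  intros H. unfold pu.
  apply (uniqueness_limite (fun s => f s v) u); [| exact H].
  apply epsilon_spec. now exists l.
Qed.

Lemma pv_val f u v l : derivable_pt_lim (fun s => f u s) v l -> pv f u v = l.
Proof.
  intros H. unfold pv.
  apply (uniqueness_limite (fun s => f u s) v); [| exact H].
  apply epsilon_spec. now exists l.
Qed.

Lemma derivable_pt_lim_local f g t l r : 0 < r ->
  (forall s, Rabs (s - t) < r -> f s = g s) ->
  derivable_pt_lim f t l -> derivable_pt_lim g t l.
Proof.
  intros Hr He H. apply is_derive_Reals. apply is_derive_Reals in H.
  apply (is_derive_ext_loc f); [| exact H].
  exists (mkposreal r Hr). intros s Hs. apply He, Hs.
Qed.

Lemma cont_on_ext D f g : open2 D -> (forall u v, D u v -> f u v = g u v) ->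
  cont_on D f -> cont_on D g.
Proof.
  intros HD He H u v Huv eps Heps.
  destruct (HD u v Huv) as [r [Hr Hin]].
  destruct (H u v Huv eps Heps) as [d [Hd Hc]].
  exists (Rmin r d). split; [now apply Rmin_pos |].
  intros a b Ha Hb. rewrite <- !He; trivial.
  - apply Hc; eapply Rlt_le_trans; eauto; apply Rmin_r.
  - apply Hin; eapply Rlt_le_trans; eauto; apply Rmin_l.
Qed.

(** Openness lets an equality on [D] be differentiated: the slice through (u, v) stays in [D] near
    the point. *)
Lemma deriv_u_ext D f g u v l : open2 D -> (forall a b, D a b -> f a b = g a b) -> D u v ->
  derivable_pt_lim (fun s => f s v) u l -> derivable_pt_lim (fun s => g s v) u l.
Proof.
  intros HD He Huv. destruct (HD u v Huv) as [r [Hr Hin]].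
  apply (derivable_pt_lim_local _ _ _ _ r Hr).
  intros s Hs. apply He, Hin; [exact Hs |]. now rewrite Rminus_diag, Rabs_R0.
Qed.

Lemma deriv_v_ext D f g u v l : open2 D -> (forall a b, D a b -> f a b = g a b) -> D u v ->
  derivable_pt_lim (fun s => f u s) v l -> derivable_pt_lim (fun s => g u s) v l.
Proof.
  intros HD He Huv. destruct (HD u v Huv) as [r [Hr Hin]].
  apply (derivable_pt_lim_local _ _ _ _ r Hr).
  intros s Hs. apply He, Hin; [| exact Hs]. now rewrite Rminus_diag, Rabs_R0.
Qed.

Lemma smooth_cont D f : smooth_on D f -> cont_on D f.
Proof. now intros []. Qed.
Lemma smooth_pu D f : smooth_on D f -> smooth_on D (pu f).
Proof. now intros []. Qed.
Lemma smooth_pv D f : smooth_on D f -> smooth_on D (pv f).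
Proof. now intros []. Qed.
Lemma smooth_du D f u v : smooth_on D f -> D u v ->
  derivable_pt_lim (fun s => f s v) u (pu f u v).
Proof. intros [] ?; auto. Qed.
Lemma smooth_dv D f u v : smooth_on D f -> D u v ->
  derivable_pt_lim (fun s => f u s) v (pv f u v).
Proof. intros [] ?; auto. Qed.

Lemma pu_ext D f g u v : open2 D -> (forall a b, D a b -> f a b = g a b) ->
  smooth_on D f -> D u v -> pu g u v = pu f u v.
Proof.
  intros HD He Hf Huv. apply pu_val, (deriv_u_ext D f g u v _ HD He Huv).
  now apply (smooth_du D).
Qed.
Lemma pv_ext D f g u v : open2 D -> (forall a b, D a b -> f a b = g a b) ->
  smooth_on D f -> D u v -> pv g u v = pv f u v.
Proof.
  intros HD He Hf Huv. apply pv_val, (deriv_v_ext D f g u v _ HD He Huv).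
  now apply (smooth_dv D).
Qed.

Lemma smooth_sub D D' f : (forall u v, D' u v -> D u v) -> smooth_on D f -> smooth_on D' f.
Proof.
  revert f. cofix IH. intros f Hs []. constructor; auto.
  intros u v Huv. apply (H u v (Hs u v Huv)).
Qed.

(* Finite-order differentiability: unlike the coinductive [smooth_on], it lends itself to
   induction on the order. *)
Fixpoint Ck (D : R -> R -> Prop) (n : nat) (f : R -> R -> R) : Prop :=
  cont_on D f /\
  match n with
  | O => True
  | S m => (forall u v, D u v -> derivable_pt_lim (fun s => f s v) u (pu f u v)) /\
           (forall u v, D u v -> derivable_pt_lim (fun s => f u s) v (pv f u v)) /\
           Ck D m (pu f) /\ Ck D m (pv f)
  end.

Lemma Ck_smooth D f : (forall n, Ck D n f) -> smooth_on D f.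
Proof.
  revert f. cofix IH. intros f H. constructor.
  - apply (H 0%nat).
  - apply (H 1%nat).
  - apply (H 1%nat).
  - apply IH. intro n. apply (H (S n)).
  - apply IH. intro n. apply (H (S n)).
Qed.

Lemma smooth_Ck D n f : smooth_on D f -> Ck D n f.
Proof.
  revert f. induction n as [| n IH]; intros f []; repeat split; auto.
Qed.

(** The product and chain rules reuse the functions themselves, besides their derivatives, at the
    lower order. *)
Lemma Ck_pred D n f : Ck D (S n) f -> Ck D n f.
Proof.
  revert f. induction n as [| n IH]; intros f [H0 [H1 [H2 [H3 H4]]]].
  - now split.
  - split; [exact H0 |]. repeat split; auto.
Qed.

Lemma Ck_ext D n f g : open2 D -> (forall u v, D u v -> f u v = g u v) ->
  Ck D n f -> Ck D n g.
Proof.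
  intros HD. revert f g. induction n as [| n IH]; intros f g He H.
  - split; [| exact I]. apply (cont_on_ext D f); trivial. apply H.
  - destruct H as [H0 [H1 [H2 [H3 H4]]]].
    assert (Eu : forall u v, D u v -> pu f u v = pu g u v).
    { intros u v Huv. symmetry. apply pu_val, (deriv_u_ext D f g u v _ HD He Huv); auto. }
    assert (Ev : forall u v, D u v -> pv f u v = pv g u v).
    { intros u v Huv. symmetry. apply pv_val, (deriv_v_ext D f g u v _ HD He Huv); auto. }
    repeat split.
    + now apply (cont_on_ext D f).
    + intros u v Huv. rewrite <- Eu by trivial. apply (deriv_u_ext D f g u v _ HD He Huv); auto.
    + intros u v Huv. rewrite <- Ev by trivial. apply (deriv_v_ext D f g u v _ HD He Huv); auto.
    + now apply (IH (pu f)).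
    + now apply (IH (pv f)).
Qed.

(** Explicit candidates [fu] and [fv] replace the choice-defined [pu f] and [pv f]; the closure
    properties below are inductions through this lemma. *)
Lemma Ck_intro D n f fu fv : open2 D -> cont_on D f ->
  (forall u v, D u v -> derivable_pt_lim (fun s => f s v) u (fu u v)) ->
  (forall u v, D u v -> derivable_pt_lim (fun s => f u s) v (fv u v)) ->
  Ck D n fu -> Ck D n fv -> Ck D (S n) f.
Proof.
  intros HD Hc Hu Hv Hfu Hfv.
  assert (Eu : forall u v, D u v -> fu u v = pu f u v).
  { intros. symmetry. apply pu_val; auto. }
  assert (Ev : forall u v, D u v -> fv u v = pv f u v).
  { intros. symmetry. apply pv_val; auto. }
  repeat split.
  - trivial.
  - intros. rewrite <- Eu; auto.
  - intros. rewrite <- Ev; auto.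
  - now apply (Ck_ext D n fu).
  - now apply (Ck_ext D n fv).
Qed.

Lemma cont_on_2d D f : open2 D ->
  (cont_on D f <-> forall u v, D u v -> continuity_2d_pt f u v).
Proof.
  intros HD. split; intros H u v Huv.
  - intros [e He]. destruct (H u v Huv e He) as [d [Hd Hc]].
    exists (mkposreal d Hd). intros a b. apply Hc.
  - intros eps He. destruct (H u v Huv (mkposreal eps He)) as [[d Hd] Hc].
    exists d. split; [exact Hd |]. intros a b. apply Hc.
Qed.

Lemma cont_on_plus D f g : open2 D -> cont_on D f -> cont_on D g ->
  cont_on D (fun u v => f u v + g u v).
Proof.
  intros HD. rewrite !cont_on_2d by trivial. intros Hf Hg u v Huv.
  apply continuity_2d_pt_plus; auto.
Qed.

Lemma cont_on_mult D f g : open2 D -> cont_on D f -> cont_on D g ->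
  cont_on D (fun u v => f u v * g u v).
Proof.
  intros HD. rewrite !cont_on_2d by trivial. intros Hf Hg u v Huv.
  apply continuity_2d_pt_mult; auto.
Qed.

Lemma cont_on_comp D f h : open2 D -> cont_on D f ->
  (forall u v, D u v -> continuity_pt h (f u v)) -> cont_on D (fun u v => h (f u v)).
Proof.
  intros HD. rewrite !cont_on_2d by trivial. intros Hf Hh u v Huv.
  apply continuity_1d_2d_pt_comp; auto.
Qed.

Lemma cont_on_const D k : cont_on D (fun _ _ => k).
Proof.
  intros u v _ eps He. exists 1. split; [lra |]. intros. now rewrite Rminus_diag, Rabs_R0.
Qed.

Lemma Ck_const D n k : open2 D -> Ck D n (fun _ _ => k).
Proof.
  intros HD. revert k. induction n as [| n IH]; intros k.
  - split; [apply cont_on_const | exact I].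
  - apply (Ck_intro D n _ (fun _ _ => 0) (fun _ _ => 0)); auto using cont_on_const;
      intros; apply derivable_pt_lim_const.
Qed.

Lemma Ck_plus D n f g : open2 D -> Ck D n f -> Ck D n g -> Ck D n (fun u v => f u v + g u v).
Proof.
  intros HD. revert f g. induction n as [| n IH]; intros f g.
  - intros [Hf _] [Hg _]. split; [now apply cont_on_plus | exact I].
  - intros [F0 [F1 [F2 [F3 F4]]]] [G0 [G1 [G2 [G3 G4]]]].
    apply (Ck_intro D n _ (fun u v => pu f u v + pu g u v) (fun u v => pv f u v + pv g u v));
      auto using cont_on_plus.
    + intros u v Huv. apply (derivable_pt_lim_plus (fun s => f s v) (fun s => g s v)); auto.
    + intros u v Huv. apply (derivable_pt_lim_plus (fun s => f u s) (fun s => g u s)); auto.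
Qed.

Lemma Ck_mult D n f g : open2 D -> Ck D n f -> Ck D n g -> Ck D n (fun u v => f u v * g u v).
Proof.
  intros HD. revert f g. induction n as [| n IH]; intros f g.
  - intros [Hf _] [Hg _]. split; [now apply cont_on_mult | exact I].
  - intros Cf Cg. pose proof (Ck_pred _ _ _ Cf) as Cf'. pose proof (Ck_pred _ _ _ Cg) as Cg'.
    destruct Cf as [F0 [F1 [F2 [F3 F4]]]]. destruct Cg as [G0 [G1 [G2 [G3 G4]]]].
    apply (Ck_intro D n _ (fun u v => pu f u v * g u v + f u v * pu g u v)
       (fun u v => pv f u v * g u v + f u v * pv g u v)); auto using cont_on_mult, Ck_plus.
    + intros u v Huv. apply (derivable_pt_lim_mult (fun s => f s v) (fun s => g s v)); auto.
    + intros u v Huv. apply (derivable_pt_lim_mult (fun s => f u s) (fun s => g u s)); auto.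
Qed.

(* [h' o f] is assumed to be as regular as [h o f] and [f] are, which closes the induction. *)
Lemma Ck_comp D n f h h' : open2 D ->
  (forall u v, D u v -> derivable_pt_lim h (f u v) (h' (f u v))) ->
  (forall m, Ck D m (fun u v => h (f u v)) -> Ck D m f -> Ck D m (fun u v => h' (f u v))) ->
  Ck D n f -> Ck D n (fun u v => h (f u v)).
Proof.
  intros HD Hh Hrec. induction n as [| n IH]; intros Hf.
  - split; [| exact I]. apply cont_on_comp; [trivial | apply Hf |].
    intros u v Huv. apply derivable_continuous_pt. exists (h' (f u v)). now apply Hh.
  - pose proof (Ck_pred _ _ _ Hf) as Hf'. pose proof (Hrec n (IH Hf') Hf') as Hh'.
    destruct Hf as [F0 [F1 [F2 [F3 F4]]]].
    apply (Ck_intro D n _ (fun u v => h' (f u v) * pu f u v) (fun u v => h' (f u v) * pv f u v));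
      auto using Ck_mult.
    + apply cont_on_comp; trivial.
      intros u v Huv. apply derivable_continuous_pt. exists (h' (f u v)). now apply Hh.
    + intros u v Huv. apply (derivable_pt_lim_comp (fun s => f s v) h); auto.
    + intros u v Huv. apply (derivable_pt_lim_comp (fun s => f u s) h); auto.
Qed.

Lemma smooth_ext D f g : open2 D -> (forall u v, D u v -> f u v = g u v) ->
  smooth_on D f -> smooth_on D g.
Proof.
  intros HD He H. apply Ck_smooth. intro n. apply (Ck_ext D n f); trivial. now apply smooth_Ck.
Qed.

Lemma smooth_const D k : open2 D -> smooth_on D (fun _ _ => k).
Proof. intros HD. apply Ck_smooth. intro n. now apply Ck_const. Qed.

Lemma smooth_plus D f g : open2 D -> smooth_on D f -> smooth_on D g ->
  smooth_on D (fun u v => f u v + g u v).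
Proof. intros HD Hf Hg. apply Ck_smooth. intro n. apply Ck_plus; auto using smooth_Ck. Qed.

Lemma smooth_mult D f g : open2 D -> smooth_on D f -> smooth_on D g ->
  smooth_on D (fun u v => f u v * g u v).
Proof. intros HD Hf Hg. apply Ck_smooth. intro n. apply Ck_mult; auto using smooth_Ck. Qed.

Lemma smooth_opp D f : open2 D -> smooth_on D f -> smooth_on D (fun u v => - f u v).
Proof.
  intros HD Hf. apply (smooth_ext D (fun u v => (-1) * f u v)); trivial.
  - intros; ring.
  - apply smooth_mult; auto using smooth_const.
Qed.

Lemma smooth_minus D f g : open2 D -> smooth_on D f -> smooth_on D g ->
  smooth_on D (fun u v => f u v - g u v).
Proof.
  intros HD Hf Hg. apply (smooth_plus D f (fun u v => - g u v)); auto using smooth_opp.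
Qed.

Lemma smooth_sq D f : open2 D -> smooth_on D f -> smooth_on D (fun u v => f u v ^ 2).
Proof.
  intros HD Hf. apply (smooth_ext D (fun u v => f u v * f u v)); trivial.
  - intros; ring.
  - now apply smooth_mult.
Qed.

(** The derivative is written as a product of copies of [/ x], so that in [smooth_inv] its
    regularity follows from that of [/ f], as [Ck_comp] demands. *)
Lemma derivable_pt_lim_Rinv x : x <> 0 -> derivable_pt_lim Rinv x ((- (1)) * (/ x * / x)).
Proof.
  intros Hx. apply is_derive_Reals. auto_derive; trivial. field; trivial.
Qed.

Lemma smooth_inv D f : open2 D -> (forall u v, D u v -> f u v <> 0) -> smooth_on D f ->
  smooth_on D (fun u v => / f u v).
Proof.
  intros HD Hf0 Hf. apply Ck_smooth. intro n.
  apply (Ck_comp D n f Rinv (fun x => (- (1)) * (/ x * / x))); trivial.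
  - intros u v Huv. apply derivable_pt_lim_Rinv. auto.
  - intros m Hm _. repeat apply Ck_mult; auto using Ck_const.
  - now apply smooth_Ck.
Qed.

Lemma smooth_exp D f : open2 D -> smooth_on D f -> smooth_on D (fun u v => exp (f u v)).
Proof.
  intros HD Hf. apply Ck_smooth. intro n. apply (Ck_comp D n f exp exp); auto.
  - intros. apply derivable_pt_lim_exp.
  - now apply smooth_Ck.
Qed.

Lemma derivable_pt_lim_ln_Rabs x : x <> 0 -> derivable_pt_lim (fun y => ln (Rabs y)) x (/ x).
Proof.
  intros Hx. apply is_derive_Reals. auto_derive.
  - split; [trivial | split; [now apply Rabs_pos_lt | exact I]].
  - destruct (Rdichotomy _ _ Hx) as [H | H].
    + rewrite sign_eq_m1, Rabs_left by trivial. field. lra.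
    + rewrite sign_eq_1, Rabs_right by lra. field. lra.
Qed.

Lemma smooth_ln_Rabs D f : open2 D -> (forall u v, D u v -> f u v <> 0) -> smooth_on D f ->
  smooth_on D (fun u v => ln (Rabs (f u v))).
Proof.
  intros HD Hf0 Hf. apply Ck_smooth. intro n.
  apply (Ck_comp D n f (fun y => ln (Rabs y)) Rinv); trivial.
  - intros u v Huv. apply derivable_pt_lim_ln_Rabs; auto.
  - intros m _ _. apply smooth_Ck. now apply smooth_inv.
  - now apply smooth_Ck.
Qed.

(** [Schwarz] speaks of iterated [Derive], which is known to agree with [pu] and [pv] only on [D];
    openness carries the second derivatives over. *)
Lemma smooth_mixed D f u v : open2 D -> smooth_on D f -> D u v ->
  pu (pv f) u v = pv (pu f) u v.
Proof.
  intros HD Hf Huv.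
  assert (HDu : forall g a b, smooth_on D g -> D a b -> is_derive (fun s => g s b) a (pu g a b)).
  { intros. apply is_derive_Reals. now apply (smooth_du D). }
  assert (HDv : forall g a b, smooth_on D g -> D a b -> is_derive (fun s => g a s) b (pv g a b)).
  { intros. apply is_derive_Reals. now apply (smooth_dv D). }
  pose proof (smooth_pu _ _ Hf) as Hfu. pose proof (smooth_pv _ _ Hf) as Hfv.
  assert (Lu : forall a b, D a b ->
      is_derive (fun s => Derive (fun t => f s t) b) a (pu (pv f) a b)).
  { intros a b Hab. destruct (HD a b Hab) as [r [Hr Hin]].
    apply (is_derive_ext_loc (fun s => pv f s b)); [| now apply HDu].
    exists (mkposreal r Hr). intros s Hs. symmetry. apply is_derive_unique, HDv; trivial.
    apply Hin; [exact Hs |]. now rewrite Rminus_diag, Rabs_R0. }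
  assert (Lv : forall a b, D a b ->
      is_derive (fun s => Derive (fun t => f t s) a) b (pv (pu f) a b)).
  { intros a b Hab. destruct (HD a b Hab) as [r [Hr Hin]].
    apply (is_derive_ext_loc (fun s => pu f a s)); [| now apply HDv].
    exists (mkposreal r Hr). intros s Hs. symmetry.
    apply (is_derive_unique (fun t => f t s)), HDu; trivial.
    apply Hin; [| exact Hs]. now rewrite Rminus_diag, Rabs_R0. }
  rewrite <- (is_derive_unique _ _ _ (Lu u v Huv)), <- (is_derive_unique _ _ _ (Lv u v Huv)).
  destruct (HD u v Huv) as [r [Hr Hin]].
  assert (Hc : forall g h, smooth_on D g -> (forall a b, D a b -> h a b = g a b) ->
      continuity_2d_pt h u v).
  { intros g h Hg He. apply (proj1 (cont_on_2d D h HD)); trivial.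
    apply (cont_on_ext D g); trivial; [now intros; rewrite He | now apply smooth_cont]. }
  apply (Schwarz f u v).
  - exists (mkposreal r Hr). intros a b Ha Hb. specialize (Hin a b Ha Hb).
    repeat split; eexists; [now apply HDu | now apply HDv | now apply Lu | now apply Lv].
  - apply (Hc (pu (pv f))); [now apply smooth_pu |].
    intros a b Hab. now apply is_derive_unique, Lu.
  - apply (Hc (pv (pu f))); [now apply smooth_pv |].
    intros a b Hab. now apply is_derive_unique, Lv.
Qed.

(** * Linear differential systems *)

Lemma mean_bound f f' x y B :
  (forall t, Rmin x y <= t <= Rmax x y -> derivable_pt_lim f t (f' t) /\ Rabs (f' t) <= B) ->
  Rabs (f y - f x) <= B * Rabs (y - x).
Proof.
  intros H. destruct (MVT_gen f x y f') as [c [Hc E]].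
  - intros t Ht. apply is_derive_Reals, H. lra.
  - intros t Ht. apply derivable_continuous_pt. exists (f' t). now apply H.
  - rewrite E, Rabs_mult. apply Rmult_le_compat_r; [apply Rabs_pos | now apply H].
Qed.

Lemma segment_ball t0 r x y t : Rabs (x - t0) < r -> Rabs (y - t0) < r ->
  Rmin x y <= t <= Rmax x y -> Rabs (t - t0) < r.
Proof.
  unfold Rmin, Rmax. destruct (Rle_dec x y); intros Hx Hy Ht;
  apply Rabs_def2 in Hx; apply Rabs_def2 in Hy; apply Rabs_def1; lra.
Qed.

Lemma segment_dist x y t : Rmin x y <= t <= Rmax x y -> Rabs (t - x) <= Rabs (y - x).
Proof.
  unfold Rmin, Rmax. destruct (Rle_dec x y); intros Ht; unfold Rabs;
  destruct (Rcase_abs (t - x)), (Rcase_abs (y - x)); lra.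
Qed.

Lemma sum_term_le N (f : nat -> R) i : (forall j, 0 <= f j) -> (i <= N)%nat ->
  f i <= sum_f_R0 f N.
Proof.
  intros Hf. induction N as [| N IH]; intros Hi; simpl.
  - replace i with 0%nat by lia. lra.
  - destruct (Nat.eq_dec i (S N)) as [-> | Hne].
    + pose proof (cond_pos_sum f N Hf). lra.
    + assert (Hi' : (i <= N)%nat) by lia. specialize (IH Hi'). specialize (Hf (S N)). lra.
Qed.

Lemma sum_le_cst N (f : nat -> R) B : (forall j, (j <= N)%nat -> f j <= B) ->
  sum_f_R0 f N <= INR (S N) * B.
Proof.
  intros H. rewrite Rmult_comm, <- sum_cte. now apply sum_Rle.
Qed.

Lemma sum_prod_bound N (b f : nat -> R) C : (forall j, (j <= N)%nat -> Rabs (b j) <= C) ->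
  Rabs (sum_f_R0 (fun j => b j * f j) N) <= C * sum_f_R0 (fun j => Rabs (f j)) N.
Proof.
  intros H. eapply Rle_trans; [apply Rsum_abs |]. rewrite scal_sum. apply sum_Rle.
  intros j Hj. rewrite Rabs_mult, Rmult_comm. apply Rmult_le_compat_l; [apply Rabs_pos | auto].
Qed.

Lemma derivable_pt_lim_sum N (f f' : nat -> R -> R) t :
  (forall j, (j <= N)%nat -> derivable_pt_lim (f j) t (f' j t)) ->
  derivable_pt_lim (fun s => sum_f_R0 (fun j => f j s) N) t (sum_f_R0 (fun j => f' j t) N).
Proof.
  induction N as [| N IH]; intros H; simpl; [now apply H |].
  apply (derivable_pt_lim_plus (fun s => sum_f_R0 (fun j => f j s) N) (f (S N))); auto.
Qed.

Lemma continuity_pt_sum N (f : nat -> R -> R) t :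
  (forall j, (j <= N)%nat -> continuity_pt (f j) t) ->
  continuity_pt (fun s => sum_f_R0 (fun j => f j s) N) t.
Proof.
  induction N as [| N IH]; intros H; simpl; [now apply H |].
  apply (continuity_pt_plus (fun s => sum_f_R0 (fun j => f j s) N) (f (S N))); auto.
Qed.

Lemma RInt_derivable g t0 r : (forall t, Rabs (t - t0) < r -> continuity_pt g t) ->
  forall t, Rabs (t - t0) < r -> derivable_pt_lim (fun t => RInt g t0 t) t (g t).
Proof.
  intros Hg t Ht. apply is_derive_Reals.
  assert (H0 : Rabs (t0 - t0) < r).
  { rewrite Rminus_diag, Rabs_R0. pose proof (Rabs_pos (t - t0)). lra. }
  apply is_derive_RInt with t0.
  - assert (Hd : 0 < r - Rabs (t - t0)) by lra.
    exists (mkposreal _ Hd). intros b Hb. apply (RInt_correct (V := R_CompleteNormedModule) g), (ex_RInt_continuous g).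
    assert (Hb' : Rabs (b - t0) < r).
    { replace (b - t0) with ((b - t) + (t - t0)) by ring.
      eapply Rle_lt_trans; [apply Rabs_triang |]. change (Rabs (b - t) < r - Rabs (t - t0)) in Hb.
      lra. }
    intros s Hs. apply continuity_pt_filterlim, Hg.
    apply (segment_ball t0 r t0 b); auto.
  - apply continuity_pt_filterlim. auto.
Qed.

(** * Picard iteration and a Gronwall estimate on a short interval *)

Section Picard.
Variables (N : nat) (A : nat -> nat -> R -> R) (t0 r C : R) (c : nat -> R).

Fixpoint picard (n i : nat) (t : R) : R :=
  match n with
  | O => c i
  | S m => c i + RInt (fun s => sum_f_R0 (fun j => A i j s * picard m j s) N) t0 t
  end.

Hypothesis Hr : 0 < r.
Hypothesis HA : forall i j t, (i <= N)%nat -> (j <= N)%nat -> Rabs (t - t0) < r ->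
  continuity_pt (A i j) t.
Hypothesis HC : forall i j t, (i <= N)%nat -> (j <= N)%nat -> Rabs (t - t0) < r ->
  Rabs (A i j t) <= C.
Hypothesis HCr : INR (S N) * C * r <= / 2.

Lemma picard_init n i : picard n i t0 = c i.
Proof. destruct n; simpl; [trivial |]. rewrite RInt_point. apply Rplus_0_r. Qed.

Lemma picard_deriv n i t : (i <= N)%nat -> Rabs (t - t0) < r ->
  derivable_pt_lim (picard (S n) i) t (sum_f_R0 (fun j => A i j t * picard n j t) N).
Proof.
  assert (H : forall g : nat -> R -> R,
    (forall j s, (j <= N)%nat -> Rabs (s - t0) < r -> continuity_pt (g j) s) ->
    forall i t, (i <= N)%nat -> Rabs (t - t0) < r ->
    derivable_pt_lim (fun t => c i + RInt (fun s => sum_f_R0 (fun j => A i j s * g j s) N) t0 t) t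
      (sum_f_R0 (fun j => A i j t * g j t) N)).
  { clear i t. intros g Hg i t Hi Ht. rewrite <- (Rplus_0_l (sum_f_R0 _ N)).
    apply (derivable_pt_lim_plus (fun _ => c i)); [apply derivable_pt_lim_const |].
    apply (RInt_derivable (fun s => sum_f_R0 (fun j => A i j s * g j s) N) t0 r); trivial.
    intros s Hs. apply continuity_pt_sum. intros j Hj.
    apply (continuity_pt_mult (A i j) (g j)); auto. }
  revert i t. induction n as [| n IH]; intros i t Hi Ht.
  - apply (H (picard 0)); trivial. intros j s _ _. apply continuity_pt_const. now intros ? ?.
  - apply (H (picard (S n))); trivial. intros j s Hj Hs.
    apply derivable_continuous_pt. eexists. now apply IH.
Qed.

(** By [HCr] the iteration contracts by 1/2 in the sup norm, so consecutive iterates approach each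
    other geometrically. The l1 norm of the initial vector serves as [K]. *)
Lemma picard_step : exists K, 0 <= K /\ forall n i t, (i <= N)%nat -> Rabs (t - t0) < r ->
  Rabs (picard (S n) i t - picard n i t) <= K * (/ 2) ^ n.
Proof.
  assert (H0 : Rabs (t0 - t0) < r) by now rewrite Rminus_diag, Rabs_R0.
  assert (HC0 : 0 <= C).
  { eapply Rle_trans; [apply Rabs_pos | apply (HC 0 0 t0); auto; lia]. }
  set (K := sum_f_R0 (fun j => Rabs (c j)) N).
  assert (HK : 0 <= K) by (apply cond_pos_sum; intro; apply Rabs_pos).
  (* Integrating a derivative bounded by (N + 1) C M over a length below r halves M. *)
  assert (Key : forall (f f' : R -> R) M t, 0 <= M -> f t0 = 0 -> Rabs (t - t0) < r ->
     (forall s, Rabs (s - t0) < r -> derivable_pt_lim f s (f' s) /\ Rabs (f' s) <= INR (S N) * C * M) ->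
     Rabs (f t) <= M * / 2).
  { intros f f' M t HM Hf Ht H.
    replace (f t) with (f t - f t0) by (rewrite Hf; ring).
    eapply Rle_trans.
    - apply mean_bound with (f' := f'). intros s Hs. apply H, (segment_ball t0 r t0 t); auto.
    - assert (0 <= INR (S N) * C) by (apply Rmult_le_pos; auto; apply pos_INR).
      replace (INR (S N) * C * M * Rabs (t - t0)) with (M * (INR (S N) * C * Rabs (t - t0))) by ring.
      apply Rmult_le_compat_l; trivial. eapply Rle_trans; [| apply HCr].
      apply Rmult_le_compat_l; lra. }
  exists K. split; [trivial |]. induction n as [| n IH]; intros i t Hi Ht.
  - rewrite pow_O, Rmult_1_r. apply Rle_trans with (K * / 2); [| lra].
    apply (Key (fun s => picard 1 i s - picard 0 i s)
      (fun s => sum_f_R0 (fun j => A i j s * c j) N)); trivial.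
    + rewrite !picard_init. ring.
    + intros s Hs. split.
      * rewrite <- (Rminus_0_r (sum_f_R0 _ N)).
        apply (derivable_pt_lim_minus (picard 1 i) (fun _ => c i)).
        -- now apply (picard_deriv 0).
        -- apply derivable_pt_lim_const.
      * eapply Rle_trans; [apply (sum_prod_bound N _ c C); auto |].
        assert (1 <= INR (S N)) by (rewrite S_INR; pose proof (pos_INR N); lra).
        fold K. assert (0 <= C * K) by now apply Rmult_le_pos. nra.
  - simpl pow. replace (K * (/ 2 * (/ 2) ^ n)) with (K * (/ 2) ^ n * / 2) by ring.
    assert (Hpow : 0 <= (/ 2) ^ n) by (apply pow_le; lra).
    apply (Key (fun s => picard (S (S n)) i s - picard (S n) i s)
      (fun s => sum_f_R0 (fun j => A i j s * (picard (S n) j s - picard n j s)) N)); trivial.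
    + now apply Rmult_le_pos.
    + rewrite !picard_init. ring.
    + intros s Hs. split.
      * replace (sum_f_R0 (fun j => A i j s * (picard (S n) j s - picard n j s)) N) with
          (sum_f_R0 (fun j => A i j s * picard (S n) j s) N -
           sum_f_R0 (fun j => A i j s * picard n j s) N).
        -- apply (derivable_pt_lim_minus (picard (S (S n)) i)); now apply picard_deriv.
        -- rewrite <- minus_sum. apply sum_eq. intros; ring.
      * eapply Rle_trans; [apply (sum_prod_bound N _ _ C); auto |].
        rewrite (Rmult_comm (INR _)), Rmult_assoc. apply Rmult_le_compat_l; trivial.
        apply sum_le_cst. intros j Hj. now apply IH.
Qed.

Lemma linear_ode : exists X : nat -> R -> R, (forall i, X i t0 = c i) /\
  forall i t, (i <= N)%nat -> Rabs (t - t0) < r ->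
    derivable_pt_lim (X i) t (sum_f_R0 (fun j => A i j t * X j t) N).
Proof.
  destruct picard_step as [K [HK Hstep]].
  assert (H0 : Rabs (t0 - t0) < r) by now rewrite Rminus_diag, Rabs_R0.
  assert (HC0 : 0 <= C).
  { eapply Rle_trans; [apply Rabs_pos | apply (HC 0 0 t0); auto; lia]. }
  (* The right-hand side is the exact sum of the geometric bounds for the k steps after n. *)
  assert (Htail : forall n k i t, (i <= N)%nat -> Rabs (t - t0) < r ->
    Rabs (picard (n + k) i t - picard n i t) <= 2 * K * (/ 2) ^ n * (1 - (/ 2) ^ k)).
  { intros n k i t Hi Ht. induction k as [| k IHk].
    - rewrite Nat.add_0_r, Rminus_diag, Rabs_R0, pow_O. lra.
    - rewrite Nat.add_succ_r.
      replace (picard (S (n + k)) i t - picard n i t) with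
        ((picard (S (n + k)) i t - picard (n + k) i t) + (picard (n + k) i t - picard n i t))
        by ring.
      eapply Rle_trans; [apply Rabs_triang |].
      eapply Rle_trans; [apply Rplus_le_compat; [now apply Hstep | apply IHk] |].
      rewrite pow_add. simpl pow. right. field. }
  assert (Hcau : forall n m i t, (i <= N)%nat -> Rabs (t - t0) < r -> (n <= m)%nat ->
    Rabs (picard m i t - picard n i t) <= 2 * K * (/ 2) ^ n).
  { intros n m i t Hi Ht Hnm. replace m with (n + (m - n))%nat by lia.
    eapply Rle_trans; [now apply Htail |].
    assert (0 <= (/ 2) ^ n) by (apply pow_le; lra).
    assert (0 <= (/ 2) ^ (m - n)) by (apply pow_le; lra).
    assert (0 <= 2 * K * (/ 2) ^ n) by (apply Rmult_le_pos; lra). nra. }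
  assert (Hsmall : forall B e, 0 <= B -> 0 < e -> exists n, forall m, (n <= m)%nat -> B * (/ 2) ^ m < e).
  { intros B e HB He. destruct (pow_lt_1_zero (/ 2)) with (y := e / (B + 1)) as [n Hn].
    - rewrite Rabs_right; lra.
    - apply Rdiv_lt_0_compat; lra.
    - exists n. intros m Hm. specialize (Hn m Hm).
      assert (Hp : 0 <= (/ 2) ^ m) by (apply pow_le; lra).
      rewrite Rabs_right in Hn by lra.
      apply (Rmult_lt_compat_l (B + 1)) in Hn; [| lra].
      replace ((B + 1) * (e / (B + 1))) with e in Hn by (field; lra). nra. }
  set (X := fun i t => real (Lim_seq (fun n => picard n i t))).
  assert (HX : forall i t, (i <= N)%nat -> Rabs (t - t0) < r ->
    is_lim_seq (fun n => picard n i t) (X i t)).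
  { intros i t Hi Ht. apply Lim_seq_correct'. apply ex_lim_seq_cauchy_corr.
    intros [e He]. destruct (Hsmall (2 * K) e) as [n Hn]; [lra | trivial |].
    exists n. intros p q Hp Hq. simpl.
    destruct (Nat.le_ge_cases p q) as [H | H].
    - rewrite Rabs_minus_sym. eapply Rle_lt_trans; [now apply Hcau | auto].
    - eapply Rle_lt_trans; [now apply Hcau | auto]. }
  assert (Hunif : forall n i t, (i <= N)%nat -> Rabs (t - t0) < r ->
    Rabs (X i t - picard n i t) <= 2 * K * (/ 2) ^ n).
  { intros n i t Hi Ht.
    apply (is_lim_seq_le_loc (fun m => Rabs (picard m i t - picard n i t))
             (fun _ => 2 * K * (/ 2) ^ n)
             (Finite (Rabs (X i t - picard n i t))) (Finite (2 * K * (/ 2) ^ n))).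
    - exists n. intros m Hm. now apply Hcau.
    - apply (is_lim_seq_abs _ (Finite (X i t - picard n i t))).
      apply is_lim_seq_minus'; [now apply HX | apply is_lim_seq_const].
    - apply is_lim_seq_const. }
  exists X. split.
  - intros i. unfold X. rewrite (Lim_seq_ext _ (fun _ => c i)).
    + now rewrite Lim_seq_const.
    + intro n. apply picard_init.
  - intros i t Hi Ht.
    (* The derivatives converge uniformly along with the iterates. The shift to [S n] is needed
       because the derivative of iterate n + 1 is expressed by iterate n. *)
    apply (CVU_derivable (fun n => picard (S n) i)
      (fun n s => sum_f_R0 (fun j => A i j s * picard n j s) N) (X i)
      (fun s => sum_f_R0 (fun j => A i j s * X j s) N) t0 (mkposreal r Hr)); trivial.
    + intros e He. destruct (Hsmall (C * (INR (S N) * (2 * K))) e) as [n Hn]; trivial.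
      { repeat apply Rmult_le_pos; trivial; [apply pos_INR | lra]. }
      exists n. intros m y Hm Hy. unfold Boule in Hy; simpl in Hy.
      eapply Rle_lt_trans; [| apply (Hn m Hm)].
      replace (sum_f_R0 (fun j => A i j y * X j y) N - sum_f_R0 (fun j => A i j y * picard m j y) N)
        with (sum_f_R0 (fun j => A i j y * (X j y - picard m j y)) N).
      * eapply Rle_trans; [apply (sum_prod_bound N _ _ C); auto |].
        rewrite Rmult_assoc. apply Rmult_le_compat_l; trivial.
        rewrite Rmult_assoc. apply sum_le_cst. intros j Hj. now apply Hunif.
      * rewrite <- minus_sum. apply sum_eq. intros; ring.
    + intros s Hs. apply is_lim_seq_Reals.
      apply (is_lim_seq_incr_1 (fun n => picard n i s)). now apply HX.
    + intros n s Hs. now apply picard_deriv.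
Qed.

Lemma gronwall (f : nat -> R -> R) (rho : nat -> R -> R) eps : 0 <= eps ->
  (forall i t, (i <= N)%nat -> Rabs (t - t0) < r ->
    derivable_pt_lim (f i) t (sum_f_R0 (fun j => A i j t * f j t) N + rho i t) /\
    Rabs (rho i t) <= eps) ->
  forall t, Rabs (t - t0) < r ->
    sum_f_R0 (fun i => Rabs (f i t)) N <=
    2 * sum_f_R0 (fun i => Rabs (f i t0)) N + 2 * (INR (S N) * (r * eps)).
Proof.
  intros He Hf t Ht. set (F := fun s => sum_f_R0 (fun i => Rabs (f i s)) N).
  assert (H0 : Rabs (t0 - t0) < r) by now rewrite Rminus_diag, Rabs_R0.
  assert (HC0 : 0 <= C).
  { eapply Rle_trans; [apply Rabs_pos | apply (HC 0 0 t0); auto; lia]. }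
  assert (HF : forall s, 0 <= F s) by (intro; apply cond_pos_sum; intro; apply Rabs_pos).
  (* The symmetric interval treats t on either side of t0 at once. *)
  destruct (continuity_ab_maj F (t0 - Rabs (t - t0)) (t0 + Rabs (t - t0))) as [m [Hm Hin]].
  - pose proof (Rabs_pos (t - t0)). lra.
  - intros s Hs. apply continuity_pt_sum. intros i Hi.
    apply (continuity_pt_comp (f i) Rabs); [| apply Rcontinuity_abs].
    apply derivable_continuous_pt. eexists. apply Hf; trivial.
    apply Rle_lt_trans with (Rabs (t - t0)); trivial. apply Rabs_le. lra.
  - assert (Hmt : Rabs (m - t0) <= Rabs (t - t0)) by (apply Rabs_le; lra).
    assert (Hmr : Rabs (m - t0) < r) by lra.
    change (F t <= 2 * F t0 + 2 * (INR (S N) * (r * eps))).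
    apply Rle_trans with (F m).
    { apply Hm. split; pose proof (Rle_abs (t - t0)); pose proof (Rle_abs (-(t - t0)));
      rewrite Rabs_Ropp in *; lra. }
    assert (Hi : forall i, (i <= N)%nat ->
       Rabs (f i m) <= Rabs (f i t0) + r * (C * F m + eps)).
    { intros i Hi. replace (f i m) with (f i t0 + (f i m - f i t0)) by ring.
      eapply Rle_trans; [apply Rabs_triang |]. apply Rplus_le_compat_l.
      eapply Rle_trans.
      - apply mean_bound with
          (f' := fun s => sum_f_R0 (fun j => A i j s * f j s) N + rho i s) (B := C * F m + eps).
        intros s Hs.
        assert (Hs' : Rabs (s - t0) <= Rabs (t - t0)).
        { eapply Rle_trans; [| exact Hmt]. now apply segment_dist. }
        assert (Hsr : Rabs (s - t0) < r) by lra.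
        split; [now apply Hf |].
        eapply Rle_trans; [apply Rabs_triang |]. apply Rplus_le_compat; [| now apply Hf].
        eapply Rle_trans; [apply (sum_prod_bound N _ _ C); auto |].
        apply Rmult_le_compat_l; trivial. apply Hm.
        pose proof (Rle_abs (s - t0)); pose proof (Rle_abs (-(s - t0)));
        rewrite Rabs_Ropp in *; lra.
      - rewrite Rmult_comm. apply Rmult_le_compat_r; [| lra].
        specialize (HF m). nra. }
    assert (Hsum : F m <= F t0 + INR (S N) * (r * (C * F m + eps))).
    { unfold F at 1. eapply Rle_trans; [apply sum_Rle; exact Hi |].
      rewrite sum_plus. apply Rplus_le_compat_l. now apply sum_le_cst. }
    specialize (HF m). nra.
Qed.
End Picard.

Lemma locally_bounded D (f : nat -> nat -> R -> R -> R) N u0 v0 : D u0 v0 ->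
  (forall i j, cont_on D (f i j)) ->
  exists r C, 0 < r /\ 0 < C /\ forall i j u v, (i <= N)%nat -> (j <= N)%nat ->
    Rabs (u - u0) < r -> Rabs (v - v0) < r -> Rabs (f i j u v) <= C.
Proof.
  intros HD Hf.
  assert (H1 : forall i M, exists r C, 0 < r /\ 0 < C /\ forall j u v, (j <= M)%nat ->
    Rabs (u - u0) < r -> Rabs (v - v0) < r -> Rabs (f i j u v) <= C).
  { assert (H0 : forall i j, exists r C, 0 < r /\ 0 < C /\ forall u v,
      Rabs (u - u0) < r -> Rabs (v - v0) < r -> Rabs (f i j u v) <= C).
    { intros i j. destruct (Hf i j u0 v0 HD 1 Rlt_0_1) as [d [Hd H]].
      exists d, (Rabs (f i j u0 v0) + 1). pose proof (Rabs_pos (f i j u0 v0)).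
      split; [trivial |]. split; [lra |]. intros u v Hu Hv.
      replace (f i j u v) with (f i j u0 v0 + (f i j u v - f i j u0 v0)) by ring.
      eapply Rle_trans; [apply Rabs_triang |]. specialize (H u v Hu Hv). lra. }
    intros i M. induction M as [| M [r [C [Hr [HC IH]]]]].
    - destruct (H0 i 0%nat) as [r [C [Hr [HC H]]]]. exists r, C. split; [trivial |].
      split; [trivial |]. intros j u v Hj. replace j with 0%nat by lia. apply H.
    - destruct (H0 i (S M)) as [r' [C' [Hr' [HC' H]]]].
      exists (Rmin r r'), (C + C'). split; [now apply Rmin_pos |]. split; [lra |].
      intros j u v Hj Hu Hv.
      pose proof (Rmin_l r r'). pose proof (Rmin_r r r').
      destruct (Nat.eq_dec j (S M)) as [-> | Hne].
      + apply Rle_trans with C'; [apply H; lra | lra].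
      + apply Rle_trans with C; [apply IH; lia || lra | lra]. }
  assert (H2 : forall M, exists r C, 0 < r /\ 0 < C /\ forall i j u v, (i <= M)%nat -> (j <= N)%nat ->
    Rabs (u - u0) < r -> Rabs (v - v0) < r -> Rabs (f i j u v) <= C); [| apply H2].
  induction M as [| M [r [C [Hr [HC IH]]]]].
  - destruct (H1 0%nat N) as [r [C [Hr [HC H]]]]. exists r, C. split; [trivial |].
    split; [trivial |]. intros i j u v Hi. replace i with 0%nat by lia. apply H.
  - destruct (H1 (S M) N) as [r' [C' [Hr' [HC' H]]]].
    exists (Rmin r r'), (C + C'). split; [now apply Rmin_pos |]. split; [lra |].
    intros i j u v Hi Hj Hu Hv.
    pose proof (Rmin_l r r'). pose proof (Rmin_r r r').
    destruct (Nat.eq_dec i (S M)) as [-> | Hne].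
    + apply Rle_trans with C'; [apply H; trivial; lra | lra].
    + apply Rle_trans with C; [apply IH; trivial; lia || lra | lra].
Qed.

(** * Flat linear systems in two variables *)

Definition square (u0 v0 r : R) (u v : R) : Prop := Rabs (u - u0) < r /\ Rabs (v - v0) < r.

Lemma derivable_pt_lim_quadratic f x l K r : 0 < r ->
  (forall s, Rabs (s - x) < r -> Rabs (f s - f x - (s - x) * l) <= K * Rabs (s - x) ^ 2) ->
  derivable_pt_lim f x l.
Proof.
  intros Hr H eps He.
  assert (HK : 0 < Rabs K + 1) by (pose proof (Rabs_pos K); lra).
  assert (Hd : 0 < Rmin r (eps / (Rabs K + 1))).
  { apply Rmin_pos; trivial. now apply Rdiv_lt_0_compat. }
  exists (mkposreal _ Hd). intros h Hh Hlt. simpl in Hlt.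
  assert (H1 : Rabs h < r) by (eapply Rlt_le_trans; [exact Hlt | apply Rmin_l]).
  assert (H2 : Rabs h < eps / (Rabs K + 1)) by (eapply Rlt_le_trans; [exact Hlt | apply Rmin_r]).
  specialize (H (x + h)). replace (x + h - x) with h in H by ring. specialize (H H1).
  replace ((f (x + h) - f x) / h - l) with ((f (x + h) - f x - h * l) / h) by (field; trivial).
  unfold Rdiv. rewrite Rabs_mult, Rabs_inv.
  pose proof (Rabs_pos_lt h Hh) as Hp.
  apply Rle_lt_trans with (Rabs K * Rabs h).
  - apply Rmult_le_reg_r with (Rabs h); trivial.
    rewrite Rmult_assoc, Rinv_l, Rmult_1_r by lra.
    eapply Rle_trans; [exact H |]. pose proof (Rle_abs K). nra.
  - apply (Rmult_lt_compat_r (Rabs K + 1)) in H2; trivial.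
    replace (eps / (Rabs K + 1) * (Rabs K + 1)) with eps in H2 by (field; lra). lra.
Qed.

(** The mean value bound applied to f minus its linear part; this gives the constant B instead of B
    / 2, which is good enough. *)
Lemma taylor_bound f f' x y B : 0 <= B ->
  (forall t, Rmin x y <= t <= Rmax x y ->
     derivable_pt_lim f t (f' t) /\ Rabs (f' t - f' x) <= B * Rabs (t - x)) ->
  Rabs (f y - f x - (y - x) * f' x) <= B * Rabs (y - x) ^ 2.
Proof.
  intros HB H.
  replace (f y - f x - (y - x) * f' x) with ((f y - f' x * y) - (f x - f' x * x)) by ring.
  replace (B * Rabs (y - x) ^ 2) with (B * Rabs (y - x) * Rabs (y - x)) by ring.
  apply (mean_bound (fun t => f t - f' x * t) (fun t => f' t - f' x)).
  intros t Ht. destruct (H t Ht) as [Hd Hb]. split.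
  - apply (derivable_pt_lim_minus f (fun t => f' x * t)); trivial.
    pose proof (derivable_pt_lim_scal id (f' x) t 1 (derivable_pt_lim_id t)) as E.
    rewrite Rmult_1_r in E. exact E.
  - eapply Rle_trans; [exact Hb |]. apply Rmult_le_compat_l; trivial. now apply segment_dist.
Qed.

(* Frobenius for linear systems. The solution is built by solving along the axis [v = v0] and then
   in the direction of [v] for each [u]. By flatness, for each increment [h] of [u] the defect
   [M(u+h) - M(u) - h a(u) M(u)] solves, in [v], the same system up to an error O(h^2). *)
Lemma frobenius D N (a b : nat -> nat -> R -> R -> R) u0 v0 : open2 D -> D u0 v0 ->
  (forall i j, smooth_on D (a i j)) -> (forall i j, smooth_on D (b i j)) ->
  (forall u v, D u v -> forall (m : nat -> R) i, (i <= N)%nat ->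
     sum_f_R0 (fun j => pv (a i j) u v * m j) N +
     sum_f_R0 (fun j => a i j u v * sum_f_R0 (fun k => b j k u v * m k) N) N =
     sum_f_R0 (fun j => pu (b i j) u v * m j) N +
     sum_f_R0 (fun j => b i j u v * sum_f_R0 (fun k => a j k u v * m k) N) N) ->
  exists r, 0 < r /\ (forall u v, square u0 v0 r u v -> D u v) /\
    forall c : nat -> R, exists M : nat -> R -> R -> R, (forall i, M i u0 v0 = c i) /\
      forall i, (i <= N)%nat -> cont_on (square u0 v0 r) (M i) /\
        forall u v, square u0 v0 r u v ->
          derivable_pt_lim (fun s => M i s v) u (sum_f_R0 (fun j => a i j u v * M j u v) N) /\
          derivable_pt_lim (fun s => M i u s) v (sum_f_R0 (fun j => b i j u v * M j u v) N).
Proof.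
  intros HD H0 Ha Hb Hflat.
  (* Since |x| <= x^2 + 1, a single local bound on [g] bounds all five coefficient functions by the
     same [C]. *)
  set (g := fun i j u v => (a i j u v) ^ 2 + (pu (a i j) u v) ^ 2 + (b i j u v) ^ 2 +
                         (pu (b i j) u v) ^ 2 + (pu (pu (b i j)) u v) ^ 2 + 1).
  destruct (locally_bounded D g N u0 v0 H0) as [r1 [C [Hr1 [HC Hg]]]].
  { intros i j. apply smooth_cont. unfold g.
    repeat apply smooth_plus; trivial; try apply smooth_sq; auto using smooth_const, smooth_pu. }
  destruct (HD u0 v0 H0) as [r2 [Hr2 Hin]].
  assert (HN : 0 < INR (S N)) by (apply lt_0_INR; lia).
  assert (HNC : 0 < INR (S N) * C) by now apply Rmult_lt_0_compat.
  assert (Hr3 : 0 < / 2 / (INR (S N) * C)) by (apply Rdiv_lt_0_compat; lra).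
  (* The last radius enforces the smallness (N + 1) C r <= 1/2 required by [linear_ode] and
     [gronwall]. *)
  set (r := Rmin (Rmin r1 r2) (/ 2 / (INR (S N) * C))).
  assert (Hr : 0 < r) by (repeat apply Rmin_pos; trivial).
  assert (HCr : INR (S N) * C * r <= / 2).
  { apply Rle_trans with (INR (S N) * C * (/ 2 / (INR (S N) * C))).
    - apply Rmult_le_compat_l; [lra | apply Rmin_r].
    - right. field. lra. }
  assert (Hrr : r <= r1 /\ r <= r2).
  { split; (eapply Rle_trans; [apply Rmin_l |]); [apply Rmin_l | apply Rmin_r]. }
  assert (HsD : forall u v, square u0 v0 r u v -> D u v).
  { intros u v [Hu Hv]. apply Hin; lra. }
  assert (Hc0 : forall t, Rabs (t - t) < r) by (intro; now rewrite Rminus_diag, Rabs_R0).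
  assert (Hbd : forall i j u v, (i <= N)%nat -> (j <= N)%nat -> square u0 v0 r u v ->
    Rabs (a i j u v) <= C /\ Rabs (pu (a i j) u v) <= C /\ Rabs (b i j u v) <= C /\
    Rabs (pu (b i j) u v) <= C /\ Rabs (pu (pu (b i j)) u v) <= C).
  { intros i j u v Hi Hj [Hu Hv].
    assert (Hgg : g i j u v <= C).
    { eapply Rle_trans; [apply Rle_abs |]. apply Hg; trivial; lra. }
    unfold g in Hgg.
    assert (Hsq : forall x, Rabs x <= x ^ 2 + 1).
    { intro x. rewrite <- (pow2_abs x). nra. }
    pose proof (Hsq (a i j u v)). pose proof (Hsq (pu (a i j) u v)).
    pose proof (Hsq (b i j u v)). pose proof (Hsq (pu (b i j) u v)).
    pose proof (Hsq (pu (pu (b i j)) u v)).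
    pose proof (pow2_ge_0 (a i j u v)). pose proof (pow2_ge_0 (pu (a i j) u v)).
    pose proof (pow2_ge_0 (b i j u v)). pose proof (pow2_ge_0 (pu (b i j) u v)).
    pose proof (pow2_ge_0 (pu (pu (b i j)) u v)). repeat split; lra. }
  exists r. split; [trivial |]. split; [trivial |]. intros c.
  assert (Hax : forall i j t, (i <= N)%nat -> (j <= N)%nat -> Rabs (t - u0) < r ->
     continuity_pt (fun u => a i j u v0) t).
  { intros i j t _ _ Ht. apply derivable_continuous_pt. eexists.
    apply (smooth_du D); auto. apply HsD. now split. }
  assert (HaC : forall i j t, (i <= N)%nat -> (j <= N)%nat -> Rabs (t - u0) < r ->
     Rabs (a i j t v0) <= C).
  { intros i j t Hi Hj Ht. apply Hbd; trivial. now split. }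
  destruct (linear_ode N (fun i j u => a i j u v0) u0 r C c Hr Hax HaC HCr) as [X [X0 HX]].
  assert (Hbx : forall u, Rabs (u - u0) < r -> forall i j t, (i <= N)%nat -> (j <= N)%nat ->
     Rabs (t - v0) < r -> continuity_pt (b i j u) t).
  { intros u Hu i j t _ _ Ht. apply derivable_continuous_pt. eexists.
    apply (smooth_dv D); auto. apply HsD. now split. }
  assert (HbC : forall u, Rabs (u - u0) < r -> forall i j t, (i <= N)%nat -> (j <= N)%nat ->
     Rabs (t - v0) < r -> Rabs (b i j u t) <= C).
  { intros u Hu i j t Hi Hj Ht. apply Hbd; trivial. now split. }
  assert (HY : forall u, exists Y : nat -> R -> R, Rabs (u - u0) < r ->
     (forall i, Y i v0 = X i u) /\ forall i t, (i <= N)%nat -> Rabs (t - v0) < r ->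
       derivable_pt_lim (Y i) t (sum_f_R0 (fun j => b i j u t * Y j t) N)).
  { intro u. destruct (Rlt_dec (Rabs (u - u0)) r) as [Hu | Hu].
    - destruct (linear_ode N (fun i j => b i j u) v0 r C (fun i => X i u) Hr (Hbx u Hu) (HbC u Hu) HCr)
        as [Y HY]. now exists Y.
    - now exists (fun _ _ => 0). }
  (* A solution in v is chosen for each u separately, so nothing is known yet about the dependence
     on u; [HM0] and [HMv] are all that is kept of the construction. *)
  set (M := fun i u v => proj1_sig (constructive_indefinite_description _ (HY u)) i v).
  assert (HM0 : forall i u, Rabs (u - u0) < r -> M i u v0 = X i u).
  { intros i u Hu. unfold M.
    destruct (constructive_indefinite_description _ (HY u)) as [Y HYu]. now apply HYu. }
  assert (HMv : forall i u v, (i <= N)%nat -> square u0 v0 r u v ->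
     derivable_pt_lim (M i u) v (sum_f_R0 (fun j => b i j u v * M j u v) N)).
  { intros i u v Hi [Hu Hv]. unfold M.
    destruct (constructive_indefinite_description _ (HY u)) as [Y HYu]. now apply HYu. }
  clearbody M. clear HY.
  (* 4 = 2 * 2: one Gronwall factor along the axis and one across it. *)
  set (Bd := 4 * sum_f_R0 (fun i => Rabs (c i)) N).
  assert (HBd : 0 <= Bd).
  { apply Rmult_le_pos; [lra |]. apply cond_pos_sum. intro. apply Rabs_pos. }
  assert (HXb : forall u, Rabs (u - u0) < r -> 2 * sum_f_R0 (fun i => Rabs (X i u)) N <= Bd).
  { intros u Hu.
    pose proof (gronwall N (fun i j u => a i j u v0) u0 r C Hr HaC HCr X (fun _ _ => 0) 0
      (Rle_refl 0)) as Hgr.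
    rewrite !Rmult_0_r, Rplus_0_r in Hgr.
    rewrite (sum_eq (fun i => Rabs (X i u0)) (fun i => Rabs (c i))) in Hgr
      by (intros; now rewrite X0).
    assert (sum_f_R0 (fun i => Rabs (X i u)) N <= 2 * sum_f_R0 (fun i => Rabs (c i)) N);
      [| unfold Bd; lra].
    apply Hgr; trivial. intros i t Hi Ht. rewrite Rplus_0_r, Rabs_R0. split; [auto | lra]. }
  assert (HMb : forall u v, square u0 v0 r u v -> sum_f_R0 (fun i => Rabs (M i u v)) N <= Bd).
  { intros u v [Hu Hv].
    pose proof (gronwall N (fun i j => b i j u) v0 r C Hr (HbC u Hu) HCr (fun i => M i u)
      (fun _ _ => 0) 0 (Rle_refl 0)) as Hgr.
    rewrite !Rmult_0_r, Rplus_0_r in Hgr.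
    rewrite (sum_eq (fun i => Rabs (M i u v0)) (fun i => Rabs (X i u))) in Hgr
      by (intros; now rewrite HM0).
    eapply Rle_trans; [apply Hgr; trivial | now apply HXb].
    intros i t Hi Ht. rewrite Rplus_0_r, Rabs_R0. split; [| lra]. apply HMv; now try split. }
  assert (HXl : forall u u' i, (i <= N)%nat -> Rabs (u - u0) < r -> Rabs (u' - u0) < r ->
     Rabs (X i u' - X i u) <= C * Bd * Rabs (u' - u)).
  { intros u u' i Hi Hu Hu'.
    apply mean_bound with (f' := fun t => sum_f_R0 (fun j => a i j t v0 * X j t) N).
    intros t Ht. assert (Ht' : Rabs (t - u0) < r) by now apply (segment_ball u0 r u u').
    split; [now apply HX |].
    eapply Rle_trans; [apply (sum_prod_bound N _ _ C); auto |].
    apply Rmult_le_compat_l; [lra |]. specialize (HXb t Ht').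
    assert (0 <= sum_f_R0 (fun i => Rabs (X i t)) N) by (apply cond_pos_sum; intro; apply Rabs_pos).
    lra. }
  assert (Hal : forall (f : nat -> nat -> R -> R -> R) i j u u' v,
     (forall i j, smooth_on D (f i j)) -> (forall u v, square u0 v0 r u v -> Rabs (pu (f i j) u v) <= C) ->
     Rabs (u - u0) < r -> Rabs (u' - u0) < r -> Rabs (v - v0) < r ->
     Rabs (f i j u' v - f i j u v) <= C * Rabs (u' - u)).
  { intros f i j u u' v Hf Hfb Hu Hu' Hv.
    apply (mean_bound (fun s => f i j s v) (fun s => pu (f i j) s v)). intros t Ht.
    assert (Hs : square u0 v0 r t v) by (split; [now apply (segment_ball u0 r u u') | trivial]).
    split; [apply (smooth_du D) | ]; auto. }
  assert (HX2 : exists K, 0 <= K /\ forall u u' i, (i <= N)%nat -> Rabs (u - u0) < r -> Rabs (u' - u0) < r ->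
     Rabs (X i u' - X i u - (u' - u) * sum_f_R0 (fun j => a i j u v0 * X j u) N)
       <= K * Rabs (u' - u) ^ 2).
  { exists (C * Bd + C * (INR (S N) * (C * Bd))).
    assert (HK : 0 <= C * Bd + C * (INR (S N) * (C * Bd))).
    { assert (0 <= C * Bd) by (apply Rmult_le_pos; lra).
      assert (0 <= INR (S N) * (C * Bd)) by (apply Rmult_le_pos; lra). nra. }
    split; [trivial |]. intros u u' i Hi Hu Hu'.
    apply (taylor_bound (X i) (fun t => sum_f_R0 (fun j => a i j t v0 * X j t) N)); trivial.
    intros t Ht. assert (Ht' : Rabs (t - u0) < r) by now apply (segment_ball u0 r u u').
    split; [now apply HX |].
    replace (sum_f_R0 (fun j => a i j t v0 * X j t) N - sum_f_R0 (fun j => a i j u v0 * X j u) N)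
      with (sum_f_R0 (fun j => (a i j t v0 - a i j u v0) * X j t) N +
            sum_f_R0 (fun j => a i j u v0 * (X j t - X j u)) N).
    2: { rewrite <- sum_plus, <- minus_sum. apply sum_eq. intros; ring. }
    eapply Rle_trans; [apply Rabs_triang |]. rewrite Rmult_plus_distr_r.
    apply Rplus_le_compat.
    - eapply Rle_trans; [apply (sum_prod_bound N _ _ (C * Rabs (t - u))) |].
      + intros j Hj. apply Hal; auto. intros. now apply Hbd.
      + specialize (HXb t Ht').
        assert (0 <= sum_f_R0 (fun i => Rabs (X i t)) N) by (apply cond_pos_sum; intro; apply Rabs_pos).
        assert (0 <= C * Rabs (t - u)) by (apply Rmult_le_pos; [lra | apply Rabs_pos]). nra.
    - eapply Rle_trans; [apply (sum_prod_bound N _ _ C); auto |]. rewrite Rmult_assoc.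
      apply Rmult_le_compat_l; [lra |]. rewrite Rmult_assoc.
      apply sum_le_cst. intros j Hj. now apply HXl. }
  destruct HX2 as [KX [HKX HX2]].
  (* The increment M(u') - M(u) solves the system at u with the error term (b(u') - b(u)) M(u'),
     which is O(u' - u). *)
  assert (HMl : exists K, 0 <= K /\ forall u u' v, Rabs (u - u0) < r -> Rabs (u' - u0) < r ->
     Rabs (v - v0) < r -> sum_f_R0 (fun i => Rabs (M i u' v - M i u v)) N <= K * Rabs (u' - u)).
  { exists (2 * (INR (S N) * (C * Bd)) + 2 * (INR (S N) * (r * (C * Bd)))).
    assert (HK : 0 <= C * Bd) by (apply Rmult_le_pos; lra). split.
    { assert (0 <= r * (C * Bd)) by (apply Rmult_le_pos; lra). nra. }
    intros u u' v Hu Hu' Hv.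
    assert (He : 0 <= C * Rabs (u' - u) * Bd).
    { apply Rmult_le_pos; trivial. apply Rmult_le_pos; [lra | apply Rabs_pos]. }
    eapply Rle_trans; [apply (gronwall N (fun i j => b i j u) v0 r C Hr (HbC u Hu) HCr
      (fun i v => M i u' v - M i u v)
      (fun i v => sum_f_R0 (fun j => (b i j u' v - b i j u v) * M j u' v) N) _ He); trivial |].
    - intros i t Hi Ht. split.
      + replace (sum_f_R0 (fun j => b i j u t * (M j u' t - M j u t)) N +
                 sum_f_R0 (fun j => (b i j u' t - b i j u t) * M j u' t) N) with
          (sum_f_R0 (fun j => b i j u' t * M j u' t) N - sum_f_R0 (fun j => b i j u t * M j u t) N).
        2: { rewrite <- sum_plus, <- minus_sum. apply sum_eq. intros; ring. }
        apply (derivable_pt_lim_minus (M i u') (M i u)); apply HMv; now try split.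
      + eapply Rle_trans; [apply (sum_prod_bound N _ _ (C * Rabs (u' - u))) |].
        * intros j Hj. apply Hal; auto. intros. now apply Hbd.
        * apply Rmult_le_compat_l; [apply Rmult_le_pos; [lra | apply Rabs_pos] |].
          apply HMb. now split.
    - rewrite Rmult_plus_distr_r. apply Rplus_le_compat; [| right; ring].
      rewrite !Rmult_assoc. apply Rmult_le_compat_l; [lra |]. apply sum_le_cst.
      intros i Hi. rewrite !HM0, <- Rmult_assoc by trivial. now apply HXl. }
  destruct HMl as [KL [HKL HMl]].
  assert (HM2 : exists K, 0 <= K /\ forall u u' v i, (i <= N)%nat -> Rabs (u - u0) < r ->
     Rabs (u' - u0) < r -> Rabs (v - v0) < r ->
     Rabs (M i u' v - M i u v - (u' - u) * sum_f_R0 (fun j => a i j u v * M j u v) N)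
       <= K * Rabs (u' - u) ^ 2).
  (* The first summand comes from the defect on the axis, bounded by [HX2]. The second comes from
     the error term: the Taylor remainder of b in u times M gives C Bd, and h times [pu b] times an
     increment of M gives C KL. *)
  { exists (2 * (INR (S N) * KX) + 2 * (INR (S N) * (r * (C * Bd + C * KL)))).
    assert (HK : 0 <= C * Bd + C * KL) by nra. split.
    { assert (0 <= r * (C * Bd + C * KL)) by (apply Rmult_le_pos; lra). nra. }
    intros u u' v i Hi Hu Hu' Hv. set (h := u' - u).
    assert (He : 0 <= (C * Bd + C * KL) * Rabs h ^ 2).
    { apply Rmult_le_pos; trivial. apply pow_le, Rabs_pos. }
    eapply Rle_trans; [apply (sum_term_le N (fun i => Rabs (M i u' v - M i u v -
      h * sum_f_R0 (fun j => a i j u v * M j u v) N))); [intro; apply Rabs_pos | exact Hi] |].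
    clear i Hi.
    eapply Rle_trans; [apply (gronwall N (fun i j => b i j u) v0 r C Hr (HbC u Hu) HCr
      (fun i v => M i u' v - M i u v - h * sum_f_R0 (fun j => a i j u v * M j u v) N)
      (fun i v => sum_f_R0 (fun j => (b i j u' v - b i j u v - h * pu (b i j) u v) * M j u' v) N +
                  h * sum_f_R0 (fun j => pu (b i j) u v * (M j u' v - M j u v)) N) _ He); trivial |].
    - intros i t Hi Ht.
      assert (Hsq : square u0 v0 r u t) by now split.
      assert (Hsq' : square u0 v0 r u' t) by now split. split.
      + assert (Hd : derivable_pt_lim
          (fun v => M i u' v - M i u v - h * sum_f_R0 (fun j => a i j u v * M j u v) N) t
          (sum_f_R0 (fun j => b i j u' t * M j u' t) N - sum_f_R0 (fun j => b i j u t * M j u t) N -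
           h * (sum_f_R0 (fun j => pv (a i j) u t * M j u t +
                  a i j u t * sum_f_R0 (fun k => b j k u t * M k u t) N) N))).
        { apply (derivable_pt_lim_minus (fun v => M i u' v - M i u v)
            (fun v => h * sum_f_R0 (fun j => a i j u v * M j u v) N)).
          - apply (derivable_pt_lim_minus (M i u') (M i u)); now apply HMv.
          - apply (derivable_pt_lim_scal (fun v => sum_f_R0 (fun j => a i j u v * M j u v) N)).
            apply (derivable_pt_lim_sum N (fun j v => a i j u v * M j u v)
              (fun j t => pv (a i j) u t * M j u t + a i j u t * sum_f_R0 (fun k => b j k u t * M k u t) N)).
            intros j Hj. apply (derivable_pt_lim_mult (a i j u) (M j u)).
            + apply (smooth_dv D); auto.
            + now apply HMv. }
        (* Flatness exchanges the derivative and product terms of a for [pu b] and the product b a.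
           The product completes b times the defect, and what remains is the error term. *)
        rewrite sum_plus, (Hflat u t (HsD _ _ Hsq) (fun j => M j u t) i Hi) in Hd.
        match type of Hd with derivable_pt_lim _ _ ?l =>
          match goal with |- derivable_pt_lim _ _ ?l' => replace l' with l; [exact Hd |] end end.
        rewrite <- sum_plus, !scal_sum, <- !sum_plus, <- !minus_sum.
        apply sum_eq. intros; ring.
      + eapply Rle_trans; [apply Rabs_triang |].
        rewrite Rmult_plus_distr_r. apply Rplus_le_compat.
        * eapply Rle_trans; [apply (sum_prod_bound N _ _ (C * Rabs h ^ 2)) |].
          -- intros j Hj.
             apply (taylor_bound (fun s => b i j s t) (fun s => pu (b i j) s t)); [lra |].
             intros s Hs. assert (Hss : Rabs (s - u0) < r) by now apply (segment_ball u0 r u u').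
             split.
             ++ apply (smooth_du D); auto. apply HsD. now split.
             ++ apply (Hal (fun i j => pu (b i j))); auto using smooth_pu.
                intros. now apply Hbd.
          -- replace (C * Bd * Rabs h ^ 2) with (C * Rabs h ^ 2 * Bd) by ring.
             apply Rmult_le_compat_l; [| now apply HMb].
             apply Rmult_le_pos; [lra | apply pow_le, Rabs_pos].
        * rewrite Rabs_mult.
          replace (C * KL * Rabs h ^ 2) with (Rabs h * (C * (KL * Rabs h))) by ring.
          apply Rmult_le_compat_l; [apply Rabs_pos |].
          eapply Rle_trans; [apply (sum_prod_bound N _ _ C) |].
          -- intros j Hj. now apply Hbd.
          -- apply Rmult_le_compat_l; [lra |]. now apply HMl.
    - rewrite (Rmult_plus_distr_r (2 * (INR (S N) * KX))). apply Rplus_le_compat; [| right; ring].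
      rewrite !Rmult_assoc. apply Rmult_le_compat_l; [lra |]. apply sum_le_cst.
      intros i Hi. rewrite !HM0 by trivial.
      rewrite (sum_eq (fun j => a i j u v0 * M j u v0) (fun j => a i j u v0 * X j u))
        by (intros; now rewrite HM0). now apply HX2. }
  destruct HM2 as [K2 [HK2 HM2]].
  exists M. split; [intro i; rewrite HM0; auto |]. intros i Hi. split.
  (* Joint continuity: M is Lipschitz in u uniformly in v by [HMl], and continuous in v for fixed
     u. *)
  - intros u v [Hu Hv] eps He.
    assert (Hcv : continuity_pt (M i u) v).
    { apply derivable_continuous_pt. eexists. apply HMv; trivial. now split. }
    destruct (Hcv (eps / 2)) as [d [Hd Hcd]]; [lra |].
    set (ru := r - Rabs (u - u0)). set (rv := r - Rabs (v - v0)).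
    assert (Hru : 0 < ru) by (unfold ru; lra). assert (Hrv : 0 < rv) by (unfold rv; lra).
    assert (HeK : 0 < eps / 2 / (KL + 1)) by (apply Rdiv_lt_0_compat; lra).
    exists (Rmin (Rmin ru rv) (Rmin d (eps / 2 / (KL + 1)))).
    split; [repeat apply Rmin_pos; trivial |]. intros p q Hp Hq.
    assert (Hp1 : Rabs (p - u) < ru) by (eapply Rlt_le_trans; [exact Hp |];
      eapply Rle_trans; [apply Rmin_l | apply Rmin_l]).
    assert (Hq1 : Rabs (q - v) < rv) by (eapply Rlt_le_trans; [exact Hq |];
      eapply Rle_trans; [apply Rmin_l | apply Rmin_r]).
    assert (Hp2 : Rabs (p - u) < eps / 2 / (KL + 1)) by (eapply Rlt_le_trans; [exact Hp |];
      eapply Rle_trans; [apply Rmin_r | apply Rmin_r]).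
    assert (Hq2 : Rabs (q - v) < d) by (eapply Rlt_le_trans; [exact Hq |];
      eapply Rle_trans; [apply Rmin_r | apply Rmin_l]).
    assert (Hp' : Rabs (p - u0) < r).
    { replace (p - u0) with ((p - u) + (u - u0)) by ring.
      eapply Rle_lt_trans; [apply Rabs_triang | unfold ru in Hp1; lra]. }
    assert (Hq' : Rabs (q - v0) < r).
    { replace (q - v0) with ((q - v) + (v - v0)) by ring.
      eapply Rle_lt_trans; [apply Rabs_triang | unfold rv in Hq1; lra]. }
    replace (M i p q - M i u v) with ((M i p q - M i u q) + (M i u q - M i u v)) by ring.
    eapply Rle_lt_trans; [apply Rabs_triang |].
    assert (E1 : Rabs (M i p q - M i u q) < eps / 2).
    { eapply Rle_lt_trans; [apply (sum_term_le N (fun i => Rabs (M i p q - M i u q)));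
        [intro; apply Rabs_pos | exact Hi] |].
      eapply Rle_lt_trans; [now apply HMl |].
      apply (Rmult_lt_compat_r (KL + 1)) in Hp2; [| lra].
      replace (eps / 2 / (KL + 1) * (KL + 1)) with (eps / 2) in Hp2 by (field; lra).
      pose proof (Rabs_pos (p - u)). nra. }
    assert (E2 : Rabs (M i u q - M i u v) < eps / 2).
    { destruct (Req_dec q v) as [-> | Hne].
      - rewrite Rminus_diag, Rabs_R0. lra.
      - apply Hcd. split; [split; [exact I | auto] | exact Hq2]. }
    lra.
  - intros u v [Hu Hv]. split; [| apply HMv; trivial; now split].
    apply (derivable_pt_lim_quadratic _ _ _ K2 (r - Rabs (u - u0))); [lra |].
    intros s Hs. apply HM2; trivial.
    replace (s - u0) with ((s - u) + (u - u0)) by ring.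
    eapply Rle_lt_trans; [apply Rabs_triang | lra].
Qed.

(** * Automation for smoothness and partial derivatives *)

Ltac smooth :=
  lazymatch goal with
  | |- open2 _ => assumption
  | |- smooth_on _ (fun u v => @?f u v - @?g u v) => apply (smooth_minus _ f g); smooth
  | |- smooth_on _ (fun u v => @?f u v + @?g u v) => apply (smooth_plus _ f g); smooth
  | |- smooth_on _ (fun u v => @?f u v * @?g u v) => apply (smooth_mult _ f g); smooth
  | |- smooth_on _ (fun u v => - @?f u v) => apply (smooth_opp _ f); smooth
  | |- smooth_on _ (fun u v => @?f u v ^ 2) => apply (smooth_sq _ f); smooth
  | |- smooth_on _ (pu _) => apply smooth_pu; smooth
  | |- smooth_on _ (pv _) => apply smooth_pv; smooth
  | |- smooth_on _ (fun u v => pu _ u v) => apply smooth_pu; smooth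
  | |- smooth_on _ (fun u v => pv _ u v) => apply smooth_pv; smooth
  | |- smooth_on _ (fun _ _ => ?k) => apply smooth_const; smooth
  | |- _ => assumption
  end.

(** Meant for goals whose derivative is still an existential variable, which the rules fill in from
    the shape of the function. The last case reads a coordinate [k] of a vector field [X] as a
    scalar field. *)
Ltac deriv_u D :=
  lazymatch goal with
  | |- derivable_pt_lim (fun s => @?f s - @?g s) _ _ =>
      eapply (derivable_pt_lim_minus f g); deriv_u D
  | |- derivable_pt_lim (fun s => @?f s + @?g s) _ _ =>
      eapply (derivable_pt_lim_plus f g); deriv_u D
  | |- derivable_pt_lim (fun s => @?f s * @?g s) _ _ =>
      eapply (derivable_pt_lim_mult f g); deriv_u D
  | |- derivable_pt_lim (fun s => - @?f s) _ _ => eapply (derivable_pt_lim_opp f); deriv_u D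
  | |- derivable_pt_lim (fun _ => ?k) _ _ => apply derivable_pt_lim_const
  | |- derivable_pt_lim (fun s => ?f s ?v) _ _ => apply (smooth_du D f); smooth
  | |- derivable_pt_lim (fun s => ?k (?X s ?v)) _ _ =>
      apply (smooth_du D (fun a b => k (X a b))); smooth
  end.

Ltac deriv_v D :=
  lazymatch goal with
  | |- derivable_pt_lim (fun s => @?f s - @?g s) _ _ =>
      eapply (derivable_pt_lim_minus f g); deriv_v D
  | |- derivable_pt_lim (fun s => @?f s + @?g s) _ _ =>
      eapply (derivable_pt_lim_plus f g); deriv_v D
  | |- derivable_pt_lim (fun s => @?f s * @?g s) _ _ =>
      eapply (derivable_pt_lim_mult f g); deriv_v D
  | |- derivable_pt_lim (fun s => - @?f s) _ _ => eapply (derivable_pt_lim_opp f); deriv_v D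
  | |- derivable_pt_lim (fun _ => ?k) _ _ => apply derivable_pt_lim_const
  | |- derivable_pt_lim (fun s => ?f ?u s) _ _ => apply (smooth_dv D f); smooth
  | |- derivable_pt_lim (fun s => ?k (?X ?u s)) _ _ =>
      apply (smooth_dv D (fun a b => k (X a b))); smooth
  end.

Ltac pu_eq D := erewrite pu_val; [| deriv_u D].
Ltac pv_eq D := erewrite pv_val; [| deriv_v D].

(** * Vector fields and orthonormal bases in R^4 *)

Lemma V4_ext a b : c0 a = c0 b -> c1 a = c1 b -> c2 a = c2 b -> c3 a = c3 b -> a = b.
Proof. destruct a, b; simpl. congruence. Qed.

Lemma vsmooth_pu D X : vsmooth_on D X -> vsmooth_on D (Pu X).
Proof. intros (?&?&?&?). refine (conj _ (conj _ (conj _ _))); now apply smooth_pu. Qed.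
Lemma vsmooth_pv D X : vsmooth_on D X -> vsmooth_on D (Pv X).
Proof. intros (?&?&?&?). refine (conj _ (conj _ (conj _ _))); now apply smooth_pv. Qed.

Lemma Pu_ext D X Y u v : open2 D -> (forall a b, D a b -> X a b = Y a b) ->
  vsmooth_on D X -> D u v -> Pu Y u v = Pu X u v.
Proof.
  intros HD He (H0&H1&H2&H3) Huv.
  unfold Pu. apply V4_ext; simpl; apply (pu_ext D); trivial; intros; now rewrite He.
Qed.
Lemma Pv_ext D X Y u v : open2 D -> (forall a b, D a b -> X a b = Y a b) ->
  vsmooth_on D X -> D u v -> Pv Y u v = Pv X u v.
Proof.
  intros HD He (H0&H1&H2&H3) Huv.
  unfold Pv. apply V4_ext; simpl; apply (pv_ext D); trivial; intros; now rewrite He.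
Qed.

Lemma smooth_vdot D X Y : open2 D -> vsmooth_on D X -> vsmooth_on D Y ->
  smooth_on D (fun u v => vdot (X u v) (Y u v)).
Proof. intros HD (?&?&?&?) (?&?&?&?). unfold vdot. smooth. Qed.

Lemma pu_vdot D X Y u v : open2 D -> vsmooth_on D X -> vsmooth_on D Y -> D u v ->
  pu (fun a b => vdot (X a b) (Y a b)) u v = vdot (Pu X u v) (Y u v) + vdot (X u v) (Pu Y u v).
Proof.
  intros HD (?&?&?&?) (?&?&?&?) Huv. apply pu_val. unfold vdot, Pu; simpl.
  (* The derivative is synthesized first and compared with the claimed value afterwards. *)
  evar (l : R). match goal with |- _ _ ?r => replace r with l; unfold l end.
  - deriv_u D.
  - simpl; ring.
Qed.
Lemma pv_vdot D X Y u v : open2 D -> vsmooth_on D X -> vsmooth_on D Y -> D u v ->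
  pv (fun a b => vdot (X a b) (Y a b)) u v = vdot (Pv X u v) (Y u v) + vdot (X u v) (Pv Y u v).
Proof.
  intros HD (?&?&?&?) (?&?&?&?) Huv. apply pv_val. unfold vdot, Pv; simpl.
  evar (l : R). match goal with |- _ _ ?r => replace r with l; unfold l end.
  - deriv_v D.
  - simpl; ring.
Qed.

Definition comb (e1 e2 e3 e4 : V4) (k1 k2 k3 k4 : R) : V4 :=
  vadd (vadd (vscale k1 e1) (vscale k2 e2)) (vadd (vscale k3 e3) (vscale k4 e4)).

(** Multiplicativity of the determinant, [l] being the linear map with columns e1, ..., e4. *)
Lemma det4_comb a b c d e1 e2 e3 e4 :
  let l w := comb e1 e2 e3 e4 (c0 w) (c1 w) (c2 w) (c3 w) in
  det4 (l a) (l b) (l c) (l d) = det4 a b c d * det4 e1 e2 e3 e4.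
Proof.
  destruct a, b, c, d, e1, e2, e3, e4.
  unfold comb, det4, det3, vadd, vscale; simpl. ring.
Qed.

Definition orthonormal (e1 e2 e3 e4 : V4) : Prop :=
  vdot e1 e1 = 1 /\ vdot e2 e2 = 1 /\ vdot e3 e3 = 1 /\ vdot e4 e4 = 1 /\
  vdot e1 e2 = 0 /\ vdot e1 e3 = 0 /\ vdot e1 e4 = 0 /\
  vdot e2 e3 = 0 /\ vdot e2 e4 = 0 /\ vdot e3 e4 = 0.

Lemma vdot_comb e1 e2 e3 e4 a1 a2 a3 a4 b1 b2 b3 b4 : orthonormal e1 e2 e3 e4 ->
  vdot (comb e1 e2 e3 e4 a1 a2 a3 a4) (comb e1 e2 e3 e4 b1 b2 b3 b4) =
  a1 * b1 + a2 * b2 + a3 * b3 + a4 * b4.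
Proof.
  intros (E11&E22&E33&E44&E12&E13&E14&E23&E24&E34).
  transitivity (a1 * b1 * vdot e1 e1 + a2 * b2 * vdot e2 e2 + a3 * b3 * vdot e3 e3 +
    a4 * b4 * vdot e4 e4 + (a1 * b2 + a2 * b1) * vdot e1 e2 + (a1 * b3 + a3 * b1) * vdot e1 e3 +
    (a1 * b4 + a4 * b1) * vdot e1 e4 + (a2 * b3 + a3 * b2) * vdot e2 e3 +
    (a2 * b4 + a4 * b2) * vdot e2 e4 + (a3 * b4 + a4 * b3) * vdot e3 e4).
  - unfold comb, vdot, vadd, vscale; simpl. ring.
  - rewrite E11, E22, E33, E44, E12, E13, E14, E23, E24, E34. ring.
Qed.

(** For k = [c0], ..., [c3] these are the columns of the matrix with rows e1, ..., e4. *)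
Definition transpose (k : V4 -> R) (e1 e2 e3 e4 : V4) : V4 := mkV4 (k e1) (k e2) (k e3) (k e4).

(* If [M^T M = I], the symmetric matrix [S = M M^T] satisfies [S^2 = S] and [tr S = 4], hence
   [|S - I|^2 = tr (S^2 - 2 S + I) = 0]. *)
Lemma orthonormal_transpose e1 e2 e3 e4 :
  orthonormal (transpose c0 e1 e2 e3 e4) (transpose c1 e1 e2 e3 e4)
              (transpose c2 e1 e2 e3 e4) (transpose c3 e1 e2 e3 e4) ->
  orthonormal e1 e2 e3 e4.
Proof.
  intros (E11&E22&E33&E44&E12&E13&E14&E23&E24&E34).
  assert (H : (vdot e1 e1 - 1) ^ 2 + (vdot e2 e2 - 1) ^ 2 + (vdot e3 e3 - 1) ^ 2 +
    (vdot e4 e4 - 1) ^ 2 + 2 * vdot e1 e2 ^ 2 + 2 * vdot e1 e3 ^ 2 + 2 * vdot e1 e4 ^ 2 +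
    2 * vdot e2 e3 ^ 2 + 2 * vdot e2 e4 ^ 2 + 2 * vdot e3 e4 ^ 2 = 0).
  { set (T i j := vdot (transpose i e1 e2 e3 e4) (transpose j e1 e2 e3 e4)).
    transitivity (T c0 c0 ^ 2 + T c1 c1 ^ 2 + T c2 c2 ^ 2 + T c3 c3 ^ 2 + 2 * T c0 c1 ^ 2 +
      2 * T c0 c2 ^ 2 + 2 * T c0 c3 ^ 2 + 2 * T c1 c2 ^ 2 + 2 * T c1 c3 ^ 2 + 2 * T c2 c3 ^ 2
      - 2 * (T c0 c0 + T c1 c1 + T c2 c2 + T c3 c3) + 4).
    - unfold T, transpose, vdot; simpl. ring.
    - unfold T. rewrite E11, E22, E33, E44, E12, E13, E14, E23, E24, E34. ring. }
  assert (Sq : forall x, x ^ 2 = 0 -> x = 0) by (intros x Hx; nra).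
  pose proof (pow2_ge_0 (vdot e1 e1 - 1)). pose proof (pow2_ge_0 (vdot e2 e2 - 1)).
  pose proof (pow2_ge_0 (vdot e3 e3 - 1)). pose proof (pow2_ge_0 (vdot e4 e4 - 1)).
  pose proof (pow2_ge_0 (vdot e1 e2)). pose proof (pow2_ge_0 (vdot e1 e3)).
  pose proof (pow2_ge_0 (vdot e1 e4)). pose proof (pow2_ge_0 (vdot e2 e3)).
  pose proof (pow2_ge_0 (vdot e2 e4)). pose proof (pow2_ge_0 (vdot e3 e4)).
  repeat split; try (apply Rminus_diag_uniq); apply Sq; lra.
Qed.

(** Four orthonormal vectors are complete because the columns of their matrix are orthonormal too:
    coordinate i of the right-hand side is the sum over j of w_j times the product of columns i and
    j. *)
Lemma orthonormal_expand e1 e2 e3 e4 w : orthonormal e1 e2 e3 e4 ->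
  w = comb e1 e2 e3 e4 (vdot w e1) (vdot w e2) (vdot w e3) (vdot w e4).
Proof.
  intros Ho.
  assert (Ht : orthonormal (transpose c0 e1 e2 e3 e4) (transpose c1 e1 e2 e3 e4)
              (transpose c2 e1 e2 e3 e4) (transpose c3 e1 e2 e3 e4)).
  (* Transposing twice returns the original vectors by computation once they are destructed. *)
  { apply orthonormal_transpose. destruct e1, e2, e3, e4. exact Ho. }
  destruct Ht as (E11&E22&E33&E44&E12&E13&E14&E23&E24&E34).
  apply V4_ext.
  - transitivity (c0 w * vdot (transpose c0 e1 e2 e3 e4) (transpose c0 e1 e2 e3 e4) +
      c1 w * vdot (transpose c0 e1 e2 e3 e4) (transpose c1 e1 e2 e3 e4) +
      c2 w * vdot (transpose c0 e1 e2 e3 e4) (transpose c2 e1 e2 e3 e4) +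
      c3 w * vdot (transpose c0 e1 e2 e3 e4) (transpose c3 e1 e2 e3 e4)).
    + rewrite E11, E12, E13, E14. ring.
    + unfold transpose, comb, vdot, vadd, vscale; simpl. ring.
  - transitivity (c0 w * vdot (transpose c0 e1 e2 e3 e4) (transpose c1 e1 e2 e3 e4) +
      c1 w * vdot (transpose c1 e1 e2 e3 e4) (transpose c1 e1 e2 e3 e4) +
      c2 w * vdot (transpose c1 e1 e2 e3 e4) (transpose c2 e1 e2 e3 e4) +
      c3 w * vdot (transpose c1 e1 e2 e3 e4) (transpose c3 e1 e2 e3 e4)).
    + rewrite E12, E22, E23, E24. ring.
    + unfold transpose, comb, vdot, vadd, vscale; simpl. ring.
  - transitivity (c0 w * vdot (transpose c0 e1 e2 e3 e4) (transpose c2 e1 e2 e3 e4) +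
      c1 w * vdot (transpose c1 e1 e2 e3 e4) (transpose c2 e1 e2 e3 e4) +
      c2 w * vdot (transpose c2 e1 e2 e3 e4) (transpose c2 e1 e2 e3 e4) +
      c3 w * vdot (transpose c2 e1 e2 e3 e4) (transpose c3 e1 e2 e3 e4)).
    + rewrite E13, E23, E33, E34. ring.
    + unfold transpose, comb, vdot, vadd, vscale; simpl. ring.
  - transitivity (c0 w * vdot (transpose c0 e1 e2 e3 e4) (transpose c3 e1 e2 e3 e4) +
      c1 w * vdot (transpose c1 e1 e2 e3 e4) (transpose c3 e1 e2 e3 e4) +
      c2 w * vdot (transpose c2 e1 e2 e3 e4) (transpose c3 e1 e2 e3 e4) +
      c3 w * vdot (transpose c3 e1 e2 e3 e4) (transpose c3 e1 e2 e3 e4)).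
    + rewrite E14, E24, E34, E44. ring.
    + unfold transpose, comb, vdot, vadd, vscale; simpl. ring.
Qed.

(** * Surfaces with an isothermal moving frame *)

Section MovingFrame.
Variables (D : R -> R -> Prop) (z x y n1 n2 : VF) (s p q wu wv A B : R -> R -> R).
Hypotheses (HD : open2 D) (Hx : vsmooth_on D x) (Hy : vsmooth_on D y)
  (Hn1 : vsmooth_on D n1) (Hn2 : vsmooth_on D n2)
  (Hs : smooth_on D s) (Hp : smooth_on D p) (Hq : smooth_on D q) (Hwu : smooth_on D wu)
  (Hwv : smooth_on D wv) (HA : smooth_on D A) (HB : smooth_on D B).

Definition frame_comb (k1 k2 k3 k4 : R -> R -> R) (u v : R) : V4 :=
  comb (x u v) (y u v) (n1 u v) (n2 u v) (k1 u v) (k2 u v) (k3 u v) (k4 u v).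

(** The formulas of the geometric frame multiplied by s = sqrt E: p = s nu, q = s mu, A = s beta_1,
    B = s beta_2, while wu and wv stand for the derivatives of ln s, so that gamma_1 = -wv / s and
    gamma_2 = -wu / s. These relations are imposed by hypotheses further down. *)
Definition frame_eqs : Prop := forall u v, D u v ->
  Pu z u v = vscale (s u v) (x u v) /\
  Pv z u v = vscale (s u v) (y u v) /\
  Pu x u v = vadd (vscale (- wv u v) (y u v)) (vscale (p u v) (n1 u v)) /\
  Pu y u v = vadd (vscale (wv u v) (x u v)) (vscale (q u v) (n2 u v)) /\
  Pu n1 u v = vadd (vscale (- p u v) (x u v)) (vscale (A u v) (n2 u v)) /\
  Pu n2 u v = vadd (vscale (- q u v) (y u v)) (vscale (- A u v) (n1 u v)) /\
  Pv x u v = vadd (vscale (wu u v) (y u v)) (vscale (q u v) (n2 u v)) /\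
  Pv y u v = vadd (vscale (- wu u v) (x u v)) (vscale (- p u v) (n1 u v)) /\
  Pv n1 u v = vadd (vscale (p u v) (y u v)) (vscale (B u v) (n2 u v)) /\
  Pv n2 u v = vadd (vscale (- q u v) (x u v)) (vscale (- B u v) (n1 u v)).

Hypothesis Hfr : frame_eqs.
Hypothesis Hon : forall u v, D u v -> orthonormal (x u v) (y u v) (n1 u v) (n2 u v).
Hypothesis Hspos : forall u v, D u v -> 0 < s u v.

Lemma vsmooth_frame k1 k2 k3 k4 : smooth_on D k1 -> smooth_on D k2 -> smooth_on D k3 ->
  smooth_on D k4 -> vsmooth_on D (frame_comb k1 k2 k3 k4).
Proof.
  intros H1 H2 H3 H4. destruct Hx as (?&?&?&?), Hy as (?&?&?&?), Hn1 as (?&?&?&?), Hn2 as (?&?&?&?).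
  refine (conj _ (conj _ (conj _ _))); unfold frame_comb, comb; simpl; smooth.
Qed.

(** Turns differentiation of vector fields into computation with coefficient functions. Agreement of
    [W] with the combination on [D] is enough, which fits the projected fields below: their
    expansions hold only there. *)
Lemma Pu_frame W k1 k2 k3 k4 u v : smooth_on D k1 -> smooth_on D k2 -> smooth_on D k3 ->
  smooth_on D k4 -> (forall a b, D a b -> W a b = frame_comb k1 k2 k3 k4 a b) -> D u v ->
  Pu W u v = frame_comb (fun u v => pu k1 u v + k2 u v * wv u v - k3 u v * p u v)
               (fun u v => pu k2 u v - k1 u v * wv u v - k4 u v * q u v)
               (fun u v => pu k3 u v + k1 u v * p u v - k4 u v * A u v)
               (fun u v => pu k4 u v + k2 u v * q u v + k3 u v * A u v) u v.
Proof.
  intros H1 H2 H3 H4 HW Huv.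
  rewrite (Pu_ext D (frame_comb k1 k2 k3 k4) W) by (auto using vsmooth_frame; intros; symmetry; auto).
  destruct (Hfr u v Huv) as (_&_&Ex&Ey&En1&En2&_).
  destruct Hx as (?&?&?&?), Hy as (?&?&?&?), Hn1 as (?&?&?&?), Hn2 as (?&?&?&?).
  injection Ex as X0 X1 X2 X3. injection Ey as Y0 Y1 Y2 Y3.
  injection En1 as N0 N1 N2 N3. injection En2 as M0 M1 M2 M3.
  unfold Pu, frame_comb, comb; apply V4_ext; simpl; pu_eq D.
  - rewrite X0, Y0, N0, M0. ring.
  - rewrite X1, Y1, N1, M1. ring.
  - rewrite X2, Y2, N2, M2. ring.
  - rewrite X3, Y3, N3, M3. ring.
Qed.

Lemma Pv_frame W k1 k2 k3 k4 u v : smooth_on D k1 -> smooth_on D k2 -> smooth_on D k3 ->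
  smooth_on D k4 -> (forall a b, D a b -> W a b = frame_comb k1 k2 k3 k4 a b) -> D u v ->
  Pv W u v = frame_comb (fun u v => pv k1 u v - k2 u v * wu u v - k4 u v * q u v)
               (fun u v => pv k2 u v + k1 u v * wu u v + k3 u v * p u v)
               (fun u v => pv k3 u v - k2 u v * p u v - k4 u v * B u v)
               (fun u v => pv k4 u v + k1 u v * q u v + k3 u v * B u v) u v.
Proof.
  intros H1 H2 H3 H4 HW Huv.
  rewrite (Pv_ext D (frame_comb k1 k2 k3 k4) W) by (auto using vsmooth_frame; intros; symmetry; auto).
  destruct (Hfr u v Huv) as (_&_&_&_&_&_&Ex&Ey&En1&En2).
  destruct Hx as (?&?&?&?), Hy as (?&?&?&?), Hn1 as (?&?&?&?), Hn2 as (?&?&?&?).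
  injection Ex as X0 X1 X2 X3. injection Ey as Y0 Y1 Y2 Y3.
  injection En1 as N0 N1 N2 N3. injection En2 as M0 M1 M2 M3.
  unfold Pv, frame_comb, comb; apply V4_ext; simpl; pv_eq D.
  - rewrite X0, Y0, N0, M0. ring.
  - rewrite X1, Y1, N1, M1. ring.
  - rewrite X2, Y2, N2, M2. ring.
  - rewrite X3, Y3, N3, M3. ring.
Qed.

Variables nu mu : R -> R -> R.
Hypotheses (Hpnu : forall u v, D u v -> p u v = s u v * nu u v)
  (Hqmu : forall u v, D u v -> q u v = s u v * mu u v)
  (Hsu : forall u v, D u v -> pu s u v = s u v * wu u v)
  (Hsv : forall u v, D u v -> pv s u v = s u v * wv u v)
  (Hgauss : forall u v, D u v -> pu wu u v + pv wv u v = p u v ^ 2 + q u v ^ 2)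
  (Hricci : forall u v, D u v -> pu B u v - pv A u v = - (2 * p u v * q u v)).

Definition zero (u v : R) : R := 0.

Lemma smooth_zero : smooth_on D zero.
Proof. exact (smooth_const D 0 HD). Qed.

Ltac vec := apply V4_ext; simpl; ring.
Ltac unfold_frame := unfold frame_comb, comb, vadd, vscale, zero.

Lemma frame_comb_ext k1 k2 k3 k4 l1 l2 l3 l4 u v : k1 u v = l1 u v -> k2 u v = l2 u v ->
  k3 u v = l3 u v -> k4 u v = l4 u v -> frame_comb k1 k2 k3 k4 u v = frame_comb l1 l2 l3 l4 u v.
Proof. intros E1 E2 E3 E4. unfold frame_comb. now rewrite E1, E2, E3, E4. Qed.

Lemma frame_comb_lin a b k1 k2 k3 k4 l1 l2 l3 l4 u v :
  vadd (vscale a (frame_comb k1 k2 k3 k4 u v)) (vscale b (frame_comb l1 l2 l3 l4 u v)) =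
  frame_comb (fun u v => a * k1 u v + b * l1 u v) (fun u v => a * k2 u v + b * l2 u v)
    (fun u v => a * k3 u v + b * l3 u v) (fun u v => a * k4 u v + b * l4 u v) u v.
Proof. unfold_frame. vec. Qed.

Lemma frame_comb_sub k1 k2 k3 k4 l1 l2 l3 l4 u v :
  vsub (frame_comb k1 k2 k3 k4 u v) (frame_comb l1 l2 l3 l4 u v) =
  frame_comb (fun u v => k1 u v - l1 u v) (fun u v => k2 u v - l2 u v)
    (fun u v => k3 u v - l3 u v) (fun u v => k4 u v - l4 u v) u v.
Proof. unfold vsub. unfold_frame. vec. Qed.

Lemma pu_zero u v : pu zero u v = 0.
Proof. apply pu_val, derivable_pt_lim_const. Qed.
Lemma pv_zero u v : pv zero u v = 0.
Proof. apply pv_val, derivable_pt_lim_const. Qed.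

Lemma zu_frame u v : D u v -> zu z u v = frame_comb s zero zero zero u v.
Proof. intros Huv. unfold zu. rewrite (proj1 (Hfr u v Huv)). unfold_frame. vec. Qed.
Lemma zv_frame u v : D u v -> zv z u v = frame_comb zero s zero zero u v.
Proof. intros Huv. unfold zv. rewrite (proj1 (proj2 (Hfr u v Huv))). unfold_frame. vec. Qed.

Lemma vdot_frame k1 k2 k3 k4 l1 l2 l3 l4 u v : D u v ->
  vdot (frame_comb k1 k2 k3 k4 u v) (frame_comb l1 l2 l3 l4 u v) =
  k1 u v * l1 u v + k2 u v * l2 u v + k3 u v * l3 u v + k4 u v * l4 u v.
Proof. intros Huv. apply vdot_comb. auto. Qed.

Lemma E_frame u v : D u v -> E_ z u v = s u v ^ 2.
Proof. intros Huv. unfold E_. rewrite zu_frame, vdot_frame by trivial. unfold zero. ring. Qed.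
Lemma F_frame u v : D u v -> F_ z u v = 0.
Proof. intros Huv. unfold F_. rewrite zu_frame, zv_frame, vdot_frame by trivial. unfold zero. ring. Qed.
Lemma G_frame u v : D u v -> G_ z u v = s u v ^ 2.
Proof. intros Huv. unfold G_. rewrite zv_frame, vdot_frame by trivial. unfold zero. ring. Qed.
Lemma detg_frame u v : D u v -> detg z u v = s u v ^ 4.
Proof. intros Huv. unfold detg. rewrite E_frame, F_frame, G_frame by trivial. ring. Qed.

Lemma tca_frame W k1 k2 k3 k4 u v : D u v -> W = frame_comb k1 k2 k3 k4 u v -> tca z W u v = k1 u v / s u v.
Proof.
  intros Huv ->. pose proof (Hspos u v Huv). unfold tca.
  rewrite detg_frame, F_frame, G_frame, zu_frame, zv_frame, !vdot_frame by trivial. unfold zero. field. lra.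
Qed.
Lemma tcb_frame W k1 k2 k3 k4 u v : D u v -> W = frame_comb k1 k2 k3 k4 u v -> tcb z W u v = k2 u v / s u v.
Proof.
  intros Huv ->. pose proof (Hspos u v Huv). unfold tcb.
  rewrite detg_frame, F_frame, E_frame, zu_frame, zv_frame, !vdot_frame by trivial. unfold zero. field. lra.
Qed.

Lemma tanv_frame W k1 k2 k3 k4 u v : D u v -> W = frame_comb k1 k2 k3 k4 u v ->
  tanv z W u v = frame_comb k1 k2 zero zero u v.
Proof.
  intros Huv E. pose proof (Hspos u v Huv). unfold tanv.
  rewrite (tca_frame _ _ _ _ _ _ _ Huv E), (tcb_frame _ _ _ _ _ _ _ Huv E), zu_frame, zv_frame by trivial.
  unfold_frame. apply V4_ext; simpl; field; lra.
Qed.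

Lemma norv_frame W k1 k2 k3 k4 u v : D u v -> W = frame_comb k1 k2 k3 k4 u v ->
  norv z W u v = frame_comb zero zero k3 k4 u v.
Proof.
  intros Huv E. unfold norv. rewrite (tanv_frame _ _ _ _ _ _ _ Huv E), E.
  unfold vsub. unfold_frame. vec.
Qed.

(** The factor [s] in the components of [X] makes a and b its coordinates with respect to z_u and
    z_v. *)
Lemma dirD_frame X W a b u v : D u v ->
  X u v = frame_comb (fun u v => s u v * a u v) (fun u v => s u v * b u v) zero zero u v ->
  dirD z X W u v = vadd (vscale (a u v) (Pu W u v)) (vscale (b u v) (Pv W u v)).
Proof.
  intros Huv E. pose proof (Hspos u v Huv). unfold dirD.
  rewrite (tca_frame _ _ _ _ _ _ _ Huv E), (tcb_frame _ _ _ _ _ _ _ Huv E).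
  f_equal; f_equal; field; lra.
Qed.

Lemma zuu_frame u v : D u v ->
  Pu (Pu z) u v = frame_comb (fun u v => s u v * wu u v) (fun u v => - (s u v * wv u v))
                    (fun u v => s u v * p u v) zero u v.
Proof.
  intros Huv. rewrite (Pu_frame (Pu z) s zero zero zero u v) by auto using smooth_zero, zu_frame.
  apply frame_comb_ext; rewrite ?pu_zero, ?Hsu by trivial; unfold zero; ring.
Qed.
Lemma zuv_frame u v : D u v ->
  Pv (Pu z) u v = frame_comb (fun u v => s u v * wv u v) (fun u v => s u v * wu u v)
                    zero (fun u v => s u v * q u v) u v.
Proof.
  intros Huv. rewrite (Pv_frame (Pu z) s zero zero zero u v) by auto using smooth_zero, zu_frame.
  apply frame_comb_ext; rewrite ?pv_zero, ?Hsv by trivial; unfold zero; ring.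
Qed.
Lemma zvu_frame u v : D u v ->
  Pu (Pv z) u v = frame_comb (fun u v => s u v * wv u v) (fun u v => s u v * wu u v)
                    zero (fun u v => s u v * q u v) u v.
Proof.
  intros Huv. rewrite (Pu_frame (Pv z) zero s zero zero u v) by auto using smooth_zero, zv_frame.
  apply frame_comb_ext; rewrite ?pu_zero, ?Hsu by trivial; unfold zero; ring.
Qed.
Lemma zvv_frame u v : D u v ->
  Pv (Pv z) u v = frame_comb (fun u v => - (s u v * wu u v)) (fun u v => s u v * wv u v)
                    (fun u v => - (s u v * p u v)) zero u v.
Proof.
  intros Huv. rewrite (Pv_frame (Pv z) zero s zero zero u v) by auto using smooth_zero, zv_frame.
  apply frame_comb_ext; rewrite ?pv_zero, ?Hsv by trivial; unfold zero; ring.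
Qed.

Lemma sigma_frame u v a b c d : D u v ->
  sigma_pt z u v a b c d = frame_comb zero zero (fun u v => s u v * p u v * (a * c - b * d))
                                       (fun u v => s u v * q u v * (a * d + b * c)) u v.
Proof.
  intros Huv. unfold sigma_pt.
  rewrite (norv_frame _ _ _ _ _ _ _ Huv (zuu_frame u v Huv)), (norv_frame _ _ _ _ _ _ _ Huv (zuv_frame u v Huv)),
    (norv_frame _ _ _ _ _ _ _ Huv (zvv_frame u v Huv)).
  unfold_frame. vec.
Qed.

Lemma tvec_frame u v a b : D u v ->
  tvec z u v a b = frame_comb (fun u v => s u v * a) (fun u v => s u v * b) zero zero u v.
Proof.
  intros Huv. unfold tvec. rewrite zu_frame, zv_frame by trivial. unfold_frame. vec.
Qed.

Lemma vdot_tvec u v a b c d : D u v ->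
  vdot (tvec z u v a b) (tvec z u v c d) = s u v ^ 2 * (a * c + b * d).
Proof. intros Huv. rewrite !tvec_frame, vdot_frame by trivial. unfold zero. ring. Qed.

(** By [sigma_frame] two identities are required of orthogonal (a, b) and (c, d) of equal length:
    a^2 - b^2 + c^2 - d^2 = 0 and a b + c d = 0. Both become polynomial consequences after
    multiplication by a^2 + b^2 > 0. *)
Lemma minimal_frame : minimal z D.
Proof.
  intros u v Huv a b c d. rewrite !vdot_tvec, !sigma_frame by trivial.
  intros Hab Hcd Hac. pose proof (Hspos u v Huv).
  assert (H1 : a * c + b * d = 0).
  { apply (Rmult_eq_reg_l (s u v ^ 2)); [lra |]. apply pow_nonzero. lra. }
  assert (Hs2 : 0 < s u v ^ 2) by (apply pow_lt; trivial).
  assert (Hk : 0 < a * a + b * b).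
  { apply (Rmult_lt_reg_l (s u v ^ 2)); lra. }
  assert (H2 : c * c + d * d = a * a + b * b).
  { apply (Rmult_eq_reg_l (s u v ^ 2)); lra. }
  assert (H3 : (a * a + b * b) * (a * a - b * b + (c * c - d * d)) = 0).
  { replace ((a * a + b * b) * (a * a - b * b + (c * c - d * d))) with
      ((a * a - b * b) * (a * a + b * b - (c * c + d * d)) + 2 * (a * c - b * d) * (a * c + b * d))
      by ring. rewrite H1, H2. ring. }
  assert (H4 : (a * a + b * b) * (a * b + c * d) = 0).
  { replace ((a * a + b * b) * (a * b + c * d)) with
      (a * b * (a * a + b * b - (c * c + d * d)) + (a * d + b * c) * (a * c + b * d)) by ring.
    rewrite H1, H2. ring. }
  apply Rmult_integral in H3. apply Rmult_integral in H4.
  destruct H3 as [H3 | H3]; [lra |]. destruct H4 as [H4 | H4]; [lra |].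
  unfold_frame.
  replace (a * b + b * a) with (2 * (a * b + c * d) - (c * d + d * c)) by ring. rewrite H4.
  replace (a * a - b * b) with (- (c * c - d * d)) by lra. vec.
Qed.

Lemma Hvec_frame u v : D u v -> Hvec z u v = mkV4 0 0 0 0.
Proof.
  intros Huv.
  assert (H : sigma_pt z u v 0 1 0 1 = vscale (-1) (sigma_pt z u v 1 0 1 0))
    by (rewrite !sigma_frame by trivial; unfold_frame; vec).
  unfold Hvec. rewrite H, E_frame, F_frame, G_frame by trivial.
  generalize (sigma_pt z u v 1 0 1 0), (sigma_pt z u v 1 0 0 1). intros. unfold vadd, vscale. vec.
Qed.

(* [|sigma(w,w)|^2] interpolates linearly between [nu^2] and [mu^2] as the unit vector [w] turns. *)
Lemma canonical_dir_frame u v a b : D u v -> s u v ^ 2 * (a * a + b * b) = 1 -> a * b = 0 ->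
  canonical_dir z u v a b.
Proof.
  intros Huv Hab Hab0. unfold canonical_dir. split; [now rewrite vdot_tvec |].
  pose proof (Hspos u v Huv) as Hs0.
  assert (Hdist : forall a b, s u v ^ 2 * (a * a + b * b) = 1 ->
    vdot (vsub (sigma_pt z u v a b a b) (Hvec z u v)) (vsub (sigma_pt z u v a b a b) (Hvec z u v))
    = nu u v ^ 2 + 4 * (s u v ^ 2 * (a * b)) ^ 2 * (mu u v ^ 2 - nu u v ^ 2)).
  { intros a' b' H'. rewrite Hvec_frame, sigma_frame by trivial.
    replace (vsub (frame_comb zero zero (fun u v => s u v * p u v * (a' * a' - b' * b'))
       (fun u v => s u v * q u v * (a' * b' + b' * a')) u v) (mkV4 0 0 0 0)) with
      (frame_comb zero zero (fun u v => s u v * p u v * (a' * a' - b' * b'))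
       (fun u v => s u v * q u v * (a' * b' + b' * a')) u v) by (unfold vsub; unfold_frame; vec).
    rewrite vdot_frame by trivial. unfold zero. rewrite Hpnu, Hqmu by trivial.
    transitivity (nu u v ^ 2 * (s u v ^ 2 * (a' * a' + b' * b')) ^ 2 +
      4 * (s u v ^ 2 * (a' * b')) ^ 2 * (mu u v ^ 2 - nu u v ^ 2)); [ring |].
    rewrite H'. ring. }
  destruct (Rle_dec (nu u v ^ 2) (mu u v ^ 2)) as [Hle | Hle]; [left | right];
    intros c d; rewrite vdot_tvec by trivial; intros Hcd;
    rewrite (Hdist a b Hab), (Hdist c d Hcd), Hab0;
    pose proof (pow2_ge_0 (s u v ^ 2 * (c * d))); nra.
Qed.

(** For the metric s^2 (du^2 + dv^2) the curvature is minus the Laplacian of ln s divided by s^2,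
    and [Hgauss] evaluates this Laplacian. The bracket term vanishes because z_u and z_v commute. *)
Lemma gaussK_frame u v : D u v -> gaussK z u v = - (nu u v ^ 2 + mu u v ^ 2).
Proof.
  intros Huv.
  assert (Hsw : smooth_on D (fun u v => - (s u v * wu u v))) by smooth.
  assert (Hsw' : smooth_on D (fun u v => s u v * wv u v)) by smooth.
  assert (Hsw'' : smooth_on D (fun u v => s u v * wu u v)) by smooth.
  assert (Du : forall W a b, D a b -> dirD z (zu z) W a b = Pu W a b).
  { intros W a b Hab. rewrite (dirD_frame _ W (fun _ _ => 1) zero a b Hab).
    - unfold zero. unfold vadd, vscale. apply V4_ext; simpl; ring.
    - rewrite zu_frame by trivial. unfold_frame. vec. }
  assert (Dv : forall W a b, D a b -> dirD z (zv z) W a b = Pv W a b).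
  { intros W a b Hab. rewrite (dirD_frame _ W zero (fun _ _ => 1) a b Hab).
    - unfold zero. unfold vadd, vscale. apply V4_ext; simpl; ring.
    - rewrite zv_frame by trivial. unfold_frame. vec. }
  assert (Lvv : forall a b, D a b -> lc z (zv z) (zv z) a b =
     frame_comb (fun u v => - (s u v * wu u v)) (fun u v => s u v * wv u v) zero zero a b).
  { intros a b Hab. unfold lc, tanf. eapply (tanv_frame _ _ _ _ _ _ _ Hab).
    rewrite Dv by trivial. now apply zvv_frame. }
  assert (Luv : forall a b, D a b -> lc z (zu z) (zv z) a b =
     frame_comb (fun u v => s u v * wv u v) (fun u v => s u v * wu u v) zero zero a b).
  { intros a b Hab. unfold lc, tanf. eapply (tanv_frame _ _ _ _ _ _ _ Hab).
    rewrite Du by trivial. now apply zvu_frame. }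
  assert (Hbrk : brk z (zu z) (zv z) u v = mkV4 0 0 0 0).
  { unfold brk, fsub. rewrite Du, Dv by trivial. unfold zu, zv.
    rewrite zvu_frame, zuv_frame by trivial. unfold vsub. unfold_frame. vec. }
  unfold gaussK, Rcurv, fsub.
  (* The holes are filled by [Pu_frame]; the projection keeps only the tangential coefficients. *)
  eassert (L1 : lc z (zu z) (lc z (zv z) (zv z)) u v = frame_comb _ _ zero zero u v).
  { unfold lc at 1, tanf. eapply (tanv_frame _ _ _ _ _ _ _ Huv). rewrite Du by trivial.
    apply (Pu_frame _ _ _ _ _ _ _ Hsw Hsw' smooth_zero smooth_zero Lvv Huv). }
  eassert (L2 : lc z (zv z) (lc z (zu z) (zv z)) u v = frame_comb _ _ zero zero u v).
  { unfold lc at 1, tanf. eapply (tanv_frame _ _ _ _ _ _ _ Huv). rewrite Dv by trivial.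
    apply (Pv_frame _ _ _ _ _ _ _ Hsw' Hsw'' smooth_zero smooth_zero Luv Huv). }
  assert (L3 : lc z (brk z (zu z) (zv z)) (zv z) u v = frame_comb zero zero zero zero u v).
  { unfold lc, tanf. eapply (tanv_frame _ _ _ zero zero _ _ Huv).
    rewrite (dirD_frame _ _ zero zero u v Huv).
    - unfold_frame. vec.
    - rewrite Hbrk. unfold_frame. vec. }
  rewrite L1, L2, L3, zu_frame, detg_frame by trivial.
  rewrite !frame_comb_sub.
  rewrite vdot_frame by trivial. unfold zero.
  assert (E1 : pu (fun u v => - (s u v * wu u v)) u v = - (s u v * wu u v * wu u v + s u v * pu wu u v)).
  { pu_eq D. rewrite Hsu by trivial. ring. }
  assert (E2 : pv (fun u v => s u v * wv u v) u v = s u v * wv u v * wv u v + s u v * pv wv u v).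
  { pv_eq D. rewrite Hsv by trivial. ring. }
  rewrite E1, E2. pose proof (Hspos u v Huv). pose proof (Hgauss u v Huv) as Hg.
  rewrite Hpnu, Hqmu in Hg by trivial.
  transitivity (- (pu wu u v + pv wv u v) / s u v ^ 2); [field; lra |].
  rewrite Hg. field. lra.
Qed.

(** In the frame n1, n2 the normal connection has the connection form A du + B dv, acting by
    infinitesimal rotation. *)
Lemma nc_frame X W a b k l u v : smooth_on D k -> smooth_on D l ->
  X u v = frame_comb (fun u v => s u v * a u v) (fun u v => s u v * b u v) zero zero u v ->
  (forall u v, D u v -> W u v = frame_comb zero zero k l u v) -> D u v ->
  nc z X W u v = frame_comb zero zero
    (fun u v => a u v * (pu k u v - l u v * A u v) + b u v * (pv k u v - l u v * B u v))
    (fun u v => a u v * (pu l u v + k u v * A u v) + b u v * (pv l u v + k u v * B u v)) u v.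
Proof.
  intros Hk Hl HX HW Huv. unfold nc, norf.
  rewrite (norv_frame _ (fun u v => - a u v * (k u v * p u v) - b u v * (l u v * q u v))
    (fun u v => - a u v * (l u v * q u v) + b u v * (k u v * p u v)) 
    (fun u v => a u v * (pu k u v - l u v * A u v) + b u v * (pv k u v - l u v * B u v))
    (fun u v => a u v * (pu l u v + k u v * A u v) + b u v * (pv l u v + k u v * B u v)) u v Huv);
    [reflexivity |].
  rewrite (dirD_frame _ _ _ _ _ _ Huv HX),
    (Pu_frame W zero zero k l u v), (Pv_frame W zero zero k l u v) by auto using smooth_zero.
  rewrite frame_comb_lin. apply frame_comb_ext; rewrite ?pu_zero, ?pv_zero; unfold zero; ring.
Qed.

(** The coordinate formula of the Lie bracket: Christoffel terms and normal components are symmetric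
    in X and Y and cancel. *)
Lemma brk_frame X Y a b c d u v : smooth_on D a -> smooth_on D b -> smooth_on D c -> smooth_on D d ->
  (forall u v, D u v -> X u v = frame_comb (fun u v => s u v * a u v) (fun u v => s u v * b u v) zero zero u v) ->
  (forall u v, D u v -> Y u v = frame_comb (fun u v => s u v * c u v) (fun u v => s u v * d u v) zero zero u v) ->
  D u v ->
  brk z X Y u v =
    frame_comb (fun u v => s u v * (a u v * pu c u v + b u v * pv c u v - c u v * pu a u v - d u v * pv a u v))
      (fun u v => s u v * (a u v * pu d u v + b u v * pv d u v - c u v * pu b u v - d u v * pv b u v))
      zero zero u v.
Proof.
  intros Ha Hb Hc Hd HX HY Huv. unfold brk, fsub.
  rewrite (dirD_frame X Y _ _ _ _ Huv (HX u v Huv)), (dirD_frame Y X _ _ _ _ Huv (HY u v Huv)).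
  rewrite (Pu_frame X (fun u v => s u v * a u v) (fun u v => s u v * b u v) zero zero u v),
    (Pv_frame X (fun u v => s u v * a u v) (fun u v => s u v * b u v) zero zero u v),
    (Pu_frame Y (fun u v => s u v * c u v) (fun u v => s u v * d u v) zero zero u v),
    (Pv_frame Y (fun u v => s u v * c u v) (fun u v => s u v * d u v) zero zero u v)
    by (auto using smooth_zero; smooth).
  assert (Eu : forall k, smooth_on D k ->
    pu (fun u v => s u v * k u v) u v = s u v * wu u v * k u v + s u v * pu k u v).
  { intros k Hk. pu_eq D. now rewrite Hsu. }
  assert (Ev : forall k, smooth_on D k ->
    pv (fun u v => s u v * k u v) u v = s u v * wv u v * k u v + s u v * pv k u v).
  { intros k Hk. pv_eq D. now rewrite Hsv. }
  rewrite !frame_comb_lin, frame_comb_sub. apply frame_comb_ext; rewrite ?Eu, ?Ev, ?pu_zero, ?pv_zero by trivial;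
    unfold zero; ring.
Qed.

(** The curvature form is the differential of A du + B dv, with coefficient B_u - A_v, which
    [Hricci] evaluates to -2 p q. Arbitrary tangent fields are allowed since [general_type] ranges
    over all adapted frames. *)
Lemma Rperp_frame X Y W a b c d k l u v : 
  smooth_on D a -> smooth_on D b -> smooth_on D c -> smooth_on D d -> 
  smooth_on D k -> smooth_on D l ->
  (forall u v, D u v -> X u v = frame_comb (fun u v => s u v * a u v) (fun u v => s u v * b u v) zero zero u v) ->
  (forall u v, D u v -> Y u v = frame_comb (fun u v => s u v * c u v) (fun u v => s u v * d u v) zero zero u v) ->
  (forall u v, D u v -> W u v = frame_comb zero zero k l u v) -> D u v ->
  Rperp z X Y W u v = frame_comb zero zero
    (fun u v => (a u v * d u v - b u v * c u v) * (2 * p u v * q u v) * l u v)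
    (fun u v => - ((a u v * d u v - b u v * c u v) * (2 * p u v * q u v) * k u v)) u v.
Proof.
  intros Ha Hb Hc Hd Hk Hl HX HY HW Huv. unfold Rperp, fsub.
  rewrite (nc_frame X (nc z Y W) a b _ _ u v) with (5 := Huv)
    (4 := fun u v H => nc_frame Y W c d k l u v Hk Hl (HY u v H) HW H); [| smooth | smooth | auto].
  rewrite (nc_frame Y (nc z X W) c d _ _ u v) with (5 := Huv)
    (4 := fun u v H => nc_frame X W a b k l u v Hk Hl (HX u v H) HW H); [| smooth | smooth | auto].
  rewrite (nc_frame (brk z X Y) W _ _ k l u v Hk Hl (brk_frame X Y a b c d u v Ha Hb Hc Hd HX HY Huv) HW Huv).
  assert (Eu : forall a b g h A B, smooth_on D a -> smooth_on D b -> smooth_on D g -> smooth_on D h ->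
    smooth_on D A -> smooth_on D B ->
    pu (fun u v => a u v * (pu g u v + h u v * A u v) + b u v * (pv g u v + h u v * B u v)) u v =
    pu a u v * (pu g u v + h u v * A u v) + pu b u v * (pv g u v + h u v * B u v) +
    a u v * (pu (pu g) u v + pu h u v * A u v + h u v * pu A u v) +
    b u v * (pu (pv g) u v + pu h u v * B u v + h u v * pu B u v)).
  { clear - HD Huv. intros. pu_eq D. ring. }
  (* The mixed derivative is put in the order [pu (pv g)] here as well, so that it cancels against
     the one from [Eu]. *)
  assert (Ev : forall a b g h A B, smooth_on D a -> smooth_on D b -> smooth_on D g -> smooth_on D h ->
    smooth_on D A -> smooth_on D B ->
    pv (fun u v => a u v * (pu g u v + h u v * A u v) + b u v * (pv g u v + h u v * B u v)) u v =
    pv a u v * (pu g u v + h u v * A u v) + pv b u v * (pv g u v + h u v * B u v) +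
    a u v * (pu (pv g) u v + pv h u v * A u v + h u v * pv A u v) +
    b u v * (pv (pv g) u v + pv h u v * B u v + h u v * pv B u v)).
  { clear - HD Huv. intros a b g h A B ? ? Hg ? ? ?.
    rewrite (smooth_mixed D g u v HD Hg Huv). pv_eq D. ring. }
  assert (Eu' : forall a b g h A B, smooth_on D a -> smooth_on D b -> smooth_on D g -> smooth_on D h ->
    smooth_on D A -> smooth_on D B ->
    pu (fun u v => a u v * (pu g u v - h u v * A u v) + b u v * (pv g u v - h u v * B u v)) u v =
    pu a u v * (pu g u v - h u v * A u v) + pu b u v * (pv g u v - h u v * B u v) +
    a u v * (pu (pu g) u v - pu h u v * A u v - h u v * pu A u v) +
    b u v * (pu (pv g) u v - pu h u v * B u v - h u v * pu B u v)).
  { clear - HD Huv. intros. pu_eq D. ring. }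
  assert (Ev' : forall a b g h A B, smooth_on D a -> smooth_on D b -> smooth_on D g -> smooth_on D h ->
    smooth_on D A -> smooth_on D B ->
    pv (fun u v => a u v * (pu g u v - h u v * A u v) + b u v * (pv g u v - h u v * B u v)) u v =
    pv a u v * (pu g u v - h u v * A u v) + pv b u v * (pv g u v - h u v * B u v) +
    a u v * (pu (pv g) u v - pv h u v * A u v - h u v * pv A u v) +
    b u v * (pv (pv g) u v - pv h u v * B u v - h u v * pv B u v)).
  { clear - HD Huv. intros a b g h A B ? ? Hg ? ? ?.
    rewrite (smooth_mixed D g u v HD Hg Huv). pv_eq D. ring. }
  assert (Hpq : 2 * p u v * q u v = pv A u v - pu B u v) by (pose proof (Hricci u v Huv); lra).
  rewrite !frame_comb_sub. apply frame_comb_ext; rewrite ?Hpq, ?Eu, ?Ev, ?Eu', ?Ev' by trivial; unfold zero; ring.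
Qed.

Lemma smooth_inv_s : smooth_on D (fun u v => / s u v).
Proof.
  apply smooth_inv; trivial. intros u v Huv. specialize (Hspos u v Huv). lra.
Qed.

(** [is_tangent] supplies coefficients only pointwise; as inner products with x and y they are seen
    to be smooth. *)
Lemma tangent_coords X : vsmooth_on D X -> (forall u v, D u v -> is_tangent z X u v) ->
  exists a b, smooth_on D a /\ smooth_on D b /\ forall u v, D u v ->
    X u v = frame_comb (fun u v => s u v * a u v) (fun u v => s u v * b u v) zero zero u v.
Proof.
  intros HX Ht. pose proof smooth_inv_s as Hi.
  exists (fun u v => vdot (X u v) (x u v) * / s u v), (fun u v => vdot (X u v) (y u v) * / s u v).
  split; [apply (smooth_mult D (fun u v => vdot (X u v) (x u v))); auto using smooth_vdot |].
  split; [apply (smooth_mult D (fun u v => vdot (X u v) (y u v))); auto using smooth_vdot |].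
  intros u v Huv. pose proof (Hspos u v Huv). destruct (Ht u v Huv) as [a [b E]].
  assert (Ex : x u v = frame_comb (fun _ _ => 1) zero zero zero u v) by (unfold_frame; vec).
  assert (Ey : y u v = frame_comb zero (fun _ _ => 1) zero zero u v) by (unfold_frame; vec).
  rewrite E, tvec_frame by trivial. apply frame_comb_ext; trivial.
  - rewrite E, tvec_frame, Ex, vdot_frame by trivial. unfold zero. field. lra.
  - rewrite E, tvec_frame, Ey, vdot_frame by trivial. unfold zero. field. lra.
Qed.

Lemma normal_coords W : vsmooth_on D W ->
  (forall u v, D u v -> vdot (W u v) (x u v) = 0 /\ vdot (W u v) (y u v) = 0) ->
  exists k l, smooth_on D k /\ smooth_on D l /\ forall u v, D u v -> W u v = frame_comb zero zero k l u v.
Proof.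
  intros HW Hn.
  exists (fun u v => vdot (W u v) (n1 u v)), (fun u v => vdot (W u v) (n2 u v)).
  split; [now apply smooth_vdot |]. split; [now apply smooth_vdot |].
  intros u v Huv. destruct (Hn u v Huv) as [E1 E2].
  rewrite (orthonormal_expand _ _ _ _ (W u v) (Hon u v Huv)) at 1. unfold frame_comb, zero.
  now rewrite E1, E2.
Qed.

Hypotheses (Hnu0 : forall u v, D u v -> nu u v <> 0) (Hmu0 : forall u v, D u v -> mu u v > 0)
  (Hne : forall u v, D u v -> mu u v ^ 2 <> nu u v ^ 2).

(** K = -(nu^2 + mu^2) and the square of [varkappa] is 4 nu^2 mu^2, so that K^2 - varkappa^2 = (mu^2
    - nu^2)^2. Working with the square of [varkappa] allows it to be expressed by Gram determinants
    of the given frame. *)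
Lemma general_type_frame : general_type z D.
Proof.
  intros X Y N1 N2 HX HY HN1 HN2 Had.
  destruct (tangent_coords X HX) as (a & b & Ha & Hb & EX); [intros; now apply Had |].
  destruct (tangent_coords Y HY) as (c & d & Hc & Hd & EY); [intros; now apply Had |].
  (* The last clause is Lagrange's identity: the squared determinant equals the Gram determinant of
     X and Y. *)
  assert (Hdelta : forall u v, D u v ->
    s u v ^ 2 * (a u v ^ 2 + b u v ^ 2) = 1 /\ s u v ^ 2 * (c u v ^ 2 + d u v ^ 2) = 1 /\
    s u v ^ 2 * (a u v * c u v + b u v * d u v) = 0 /\
    (s u v ^ 2 * (a u v * d u v - b u v * c u v)) ^ 2 = 1).
  { intros u v Huv. destruct (Had u v Huv) as (XX & YY & _ & _ & XY & _).
    rewrite EX, vdot_frame in XX by trivial. rewrite EY, vdot_frame in YY by trivial.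
    rewrite EX, EY, vdot_frame in XY by trivial. unfold zero in *.
    assert (H1 : s u v ^ 2 * (a u v ^ 2 + b u v ^ 2) = 1) by (rewrite <- XX; ring).
    assert (H2 : s u v ^ 2 * (c u v ^ 2 + d u v ^ 2) = 1) by (rewrite <- YY; ring).
    assert (H3 : s u v ^ 2 * (a u v * c u v + b u v * d u v) = 0) by (rewrite <- XY; ring).
    repeat split; trivial.
    transitivity (s u v ^ 2 * (a u v ^ 2 + b u v ^ 2) * (s u v ^ 2 * (c u v ^ 2 + d u v ^ 2)) -
      (s u v ^ 2 * (a u v * c u v + b u v * d u v)) ^ 2); [ring |].
    rewrite H1, H2, H3. ring. }
  (* A field orthogonal to X and Y is orthogonal to x and y by Cramer's rule. *)
  assert (Hnorm : forall W, vsmooth_on D W -> (forall u v, D u v -> vdot (X u v) (W u v) = 0 /\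
      vdot (Y u v) (W u v) = 0) ->
    forall u v, D u v -> vdot (W u v) (x u v) = 0 /\ vdot (W u v) (y u v) = 0).
  { intros W HW Hxy u v Huv. destruct (Hxy u v Huv) as [E1 E2].
    rewrite EX in E1 by trivial. rewrite EY in E2 by trivial.
    destruct (Hdelta u v Huv) as (_ & _ & _ & Hdt).
    assert (Hlin : forall k l, vdot (frame_comb k l zero zero u v) (W u v) =
      k u v * vdot (W u v) (x u v) + l u v * vdot (W u v) (y u v)).
    { intros. unfold frame_comb, comb, zero, vdot, vadd, vscale; simpl. ring. }
    rewrite Hlin in E1, E2. 
    assert (Hnz : s u v * (a u v * d u v - b u v * c u v) <> 0).
    { intro Hz0. assert (H0 : s u v ^ 2 * (a u v * d u v - b u v * c u v) = 0).
      { replace (s u v ^ 2 * (a u v * d u v - b u v * c u v)) with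
          (s u v * (s u v * (a u v * d u v - b u v * c u v))) by ring. rewrite Hz0. ring. }
      rewrite H0 in Hdt. lra. }
    split; apply (Rmult_eq_reg_l _ _ _) with (2 := Hnz); rewrite Rmult_0_r.
    - transitivity (d u v * (s u v * a u v * vdot (W u v) (x u v) + s u v * b u v * vdot (W u v) (y u v))
        - b u v * (s u v * c u v * vdot (W u v) (x u v) + s u v * d u v * vdot (W u v) (y u v)));
        [ring |]. rewrite E1, E2. ring.
    - transitivity (a u v * (s u v * c u v * vdot (W u v) (x u v) + s u v * d u v * vdot (W u v) (y u v))
        - c u v * (s u v * a u v * vdot (W u v) (x u v) + s u v * b u v * vdot (W u v) (y u v)));
        [ring |]. rewrite E1, E2. ring. }
  destruct (normal_coords N1 HN1) as (k1 & l1 & Hk1 & Hl1 & EN1).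
  { apply Hnorm; trivial. intros u v Huv. split; apply (Had u v Huv). }
  destruct (normal_coords N2 HN2) as (k2 & l2 & Hk2 & Hl2 & EN2).
  { apply Hnorm; trivial. intros u v Huv. split; apply (Had u v Huv). }
  intros u v Huv. rewrite gaussK_frame by trivial.
  destruct (Hdelta u v Huv) as (_ & _ & _ & Hdt).
  destruct (Had u v Huv) as (_ & _ & M11 & M22 & _ & _ & _ & _ & _ & M12 & _).
  rewrite EN1, vdot_frame in M11 by trivial. rewrite EN2, vdot_frame in M22 by trivial.
  rewrite EN1, EN2, vdot_frame in M12 by trivial. unfold zero in *.
  assert (Hkappa : varkappa z X Y N1 N2 u v ^ 2 = 4 * (nu u v ^ 2 * mu u v ^ 2)).
  { unfold varkappa.
    rewrite (Rperp_frame X Y N2 a b c d k2 l2 u v), EN1, vdot_frame, Hpnu, Hqmu by trivial. unfold zero.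
    transitivity (4 * (nu u v ^ 2 * mu u v ^ 2) *
      (s u v ^ 2 * (a u v * d u v - b u v * c u v)) ^ 2 *
      ((0 * 0 + 0 * 0 + k1 u v * k1 u v + l1 u v * l1 u v) *
       (0 * 0 + 0 * 0 + k2 u v * k2 u v + l2 u v * l2 u v) -
       (0 * 0 + 0 * 0 + k1 u v * k2 u v + l1 u v * l2 u v) ^ 2)); [ring |].
    rewrite Hdt, M11, M22, M12. ring. }
  pose proof (Hnu0 u v Huv). pose proof (Hmu0 u v Huv). pose proof (Hne u v Huv). split.
  - rewrite Hkappa.
    replace ((- (nu u v ^ 2 + mu u v ^ 2)) ^ 2 - 4 * (nu u v ^ 2 * mu u v ^ 2)) with
      ((mu u v ^ 2 - nu u v ^ 2) ^ 2) by ring.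
    apply pow2_gt_0. lra.
  - intro Hk0. rewrite Hk0 in Hkappa.
    assert (0 < nu u v ^ 2 * mu u v ^ 2); [| nra].
    apply Rmult_lt_0_compat; apply pow2_gt_0; lra.
Qed.

Hypotheses (Hz : vsmooth_on D z)
  (Hdet : forall u v, D u v -> det4 (x u v) (y u v) (n1 u v) (n2 u v) > 0)
  (Hsreg : forall u v, D u v -> wu u v * wv u v <> 0)
  (Hcan : forall u v, D u v -> s u v ^ 2 * sqrt (Rabs (mu u v ^ 2 - nu u v ^ 2)) = 1).

Lemma canonical_SRMGT_frame : canonical_SRMGT z D nu mu.
Proof.
  split; [| split; [apply minimal_frame | split; [apply general_type_frame |]]].
  { split; [trivial |]. intros u v Huv. rewrite detg_frame by trivial.
    apply Rlt_gt, pow_lt. auto. }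
  assert (Dx : forall W u v, D u v -> dirD z x W u v = vscale (/ s u v) (Pu W u v)).
  { intros W u v Huv. pose proof (Hspos u v Huv).
    rewrite (dirD_frame x W (fun u v => / s u v) zero u v Huv).
    - unfold zero, vadd, vscale. vec.
    - unfold_frame. apply V4_ext; simpl; field; lra. }
  assert (Dy : forall W u v, D u v -> dirD z y W u v = vscale (/ s u v) (Pv W u v)).
  { intros W u v Huv. pose proof (Hspos u v Huv).
    rewrite (dirD_frame y W zero (fun u v => / s u v) u v Huv).
    - unfold zero, vadd, vscale. vec.
    - unfold_frame. apply V4_ext; simpl; field; lra. }
  assert (Tx : forall u v, D u v -> x u v = tvec z u v (/ s u v) 0).
  { intros u v Huv. pose proof (Hspos u v Huv). rewrite tvec_frame by trivial.
    unfold_frame. apply V4_ext; simpl; field; lra. }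
  assert (Ty : forall u v, D u v -> y u v = tvec z u v 0 (/ s u v)).
  { intros u v Huv. pose proof (Hspos u v Huv). rewrite tvec_frame by trivial.
    unfold_frame. apply V4_ext; simpl; field; lra. }
  (* These are gamma_1 = -y(ln sqrt E) and gamma_2 = -x(ln sqrt G) for sqrt E = sqrt G = s. *)
  exists x, y, n1, n2, (fun u v => - (wv u v / s u v)), (fun u v => - (wu u v / s u v)),
    (fun u v => A u v / s u v), (fun u v => B u v / s u v).
  split.
  - split; [trivial |]. split; [trivial |]. split; [trivial |]. split; [trivial |].
    intros u v Huv. pose proof (Hspos u v Huv) as Hs0.
    destruct (Hfr u v Huv) as (_&_&E1&E2&E3&E4&E5&E6&E7&E8).
    split.
    { destruct (Hon u v Huv) as (?&?&?&?&?&?&?&?&?&?).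
      unfold adapted_frame_at. do 10 (split; [assumption |]). split; [auto |].
      split; eexists; eexists; [now apply Tx | now apply Ty]. }
    split; [exists (/ s u v), 0; split; [now apply Tx | apply canonical_dir_frame; trivial; field; lra] |].
    split; [exists 0, (/ s u v); split; [now apply Ty | apply canonical_dir_frame; trivial; field; lra] |].
    split; [auto |]. split; [auto |]. split; [auto |].
    rewrite !Dx, !Dy, E1, E2, E3, E4, E5, E6, E7, E8, Hpnu, Hqmu by trivial.
    unfold vadd, vscale. repeat split; apply V4_ext; simpl; field; lra.
  - intros u v Huv. pose proof (Hspos u v Huv) as Hs0. rewrite F_frame, E_frame, G_frame by trivial.
    rewrite sqrt_pow2 by lra. rewrite zu_frame, zv_frame by trivial.
    repeat split; auto.
    + unfold_frame. apply V4_ext; simpl; field; lra.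
    + unfold_frame. apply V4_ext; simpl; field; lra.
    + replace (- (wv u v / s u v) * - (wu u v / s u v)) with (wu u v * wv u v * / s u v ^ 2)
        by (field; lra).
      apply Rmult_integral_contrapositive. split; [auto |].
      apply Rinv_neq_0_compat, pow_nonzero. lra.
Qed.
End MovingFrame.

(** * The invariants determine the coefficients of the frame equations *)

Section Coefficients.
Variables (D : R -> R -> Prop) (nu mu : R -> R -> R).

Definition lnf (u v : R) : R := ln (Rabs (mu u v ^ 2 - nu u v ^ 2)).
Definition lnh (u v : R) : R := ln (Rabs ((mu u v + nu u v) / (mu u v - nu u v))).
(* [cs = sqrt E], [cwu] and [cwv] are the derivatives of [ln (sqrt E)], and
   [cA = sqrt E * beta_1], [cB = sqrt E * beta_2]. *)
Definition cs (u v : R) : R := exp (- / 4 * lnf u v).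
Definition cp (u v : R) : R := cs u v * nu u v.
Definition cq (u v : R) : R := cs u v * mu u v.
Definition cwu (u v : R) : R := - / 4 * pu lnf u v.
Definition cwv (u v : R) : R := - / 4 * pv lnf u v.
Definition cA (u v : R) : R := - / 2 * pv lnh u v.
Definition cB (u v : R) : R := / 2 * pu lnh u v.

Hypotheses (HD : open2 D) (Hnu : smooth_on D nu) (Hmu : smooth_on D mu)
  (Hne : forall u v, D u v -> mu u v ^ 2 <> nu u v ^ 2).

Lemma factors_neq_0 u v : D u v ->
  mu u v ^ 2 - nu u v ^ 2 <> 0 /\ mu u v + nu u v <> 0 /\ mu u v - nu u v <> 0.
Proof.
  intros Huv. pose proof (Hne u v Huv) as H. repeat split; intro H0; apply H; nra.
Qed.

Lemma lnh_minus u v : D u v ->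
  ln (Rabs (mu u v + nu u v)) - ln (Rabs (mu u v - nu u v)) = lnh u v.
Proof.
  intros Huv. destruct (factors_neq_0 u v Huv) as (_ & H1 & H2). unfold lnh.
  rewrite Rabs_div by trivial. rewrite ln_div by now apply Rabs_pos_lt. reflexivity.
Qed.

Lemma smooth_lnf : smooth_on D lnf.
Proof.
  apply (smooth_ln_Rabs D (fun u v => mu u v ^ 2 - nu u v ^ 2)); trivial.
  - intros u v Huv. now apply factors_neq_0.
  - smooth.
Qed.

Lemma smooth_lnh : smooth_on D lnh.
Proof.
  apply (smooth_ext D (fun u v => ln (Rabs (mu u v + nu u v)) - ln (Rabs (mu u v - nu u v))));
    trivial; [apply lnh_minus |].
  apply (smooth_minus D (fun u v => ln (Rabs (mu u v + nu u v)))
    (fun u v => ln (Rabs (mu u v - nu u v)))); trivial.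
  - apply (smooth_ln_Rabs D (fun u v => mu u v + nu u v)); trivial; [| smooth].
    intros u v Huv. now apply factors_neq_0.
  - apply (smooth_ln_Rabs D (fun u v => mu u v - nu u v)); trivial; [| smooth].
    intros u v Huv. now apply factors_neq_0.
Qed.

Lemma smooth_cs : smooth_on D cs.
Proof.
  pose proof smooth_lnf. apply (smooth_exp D (fun u v => - / 4 * lnf u v)); trivial. smooth.
Qed.
Lemma smooth_cp : smooth_on D cp.
Proof. pose proof smooth_cs. unfold cp. smooth. Qed.
Lemma smooth_cq : smooth_on D cq.
Proof. pose proof smooth_cs. unfold cq. smooth. Qed.
Lemma smooth_cwu : smooth_on D cwu.
Proof. pose proof smooth_lnf. unfold cwu. smooth. Qed.
Lemma smooth_cwv : smooth_on D cwv.
Proof. pose proof smooth_lnf. unfold cwv. smooth. Qed.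
Lemma smooth_cA : smooth_on D cA.
Proof. pose proof smooth_lnh. unfold cA. smooth. Qed.
Lemma smooth_cB : smooth_on D cB.
Proof. pose proof smooth_lnh. unfold cB. smooth. Qed.

Lemma cs_pos u v : 0 < cs u v.
Proof. apply exp_pos. Qed.

Lemma pu_cs u v : D u v -> pu cs u v = cs u v * cwu u v.
Proof.
  intros Huv. pose proof smooth_lnf. apply pu_val.
  apply (derivable_pt_lim_comp (fun t => - / 4 * lnf t v) exp); [| apply derivable_pt_lim_exp].
  unfold cwu. pose proof (derivable_pt_lim_scal (fun t => lnf t v) (- / 4) u _ (smooth_du D lnf u v H Huv)).
  assumption.
Qed.
Lemma pv_cs u v : D u v -> pv cs u v = cs u v * cwv u v.
Proof.
  intros Huv. pose proof smooth_lnf. apply pv_val.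
  apply (derivable_pt_lim_comp (fun t => - / 4 * lnf u t) exp); [| apply derivable_pt_lim_exp].
  unfold cwv. pose proof (derivable_pt_lim_scal (fun t => lnf u t) (- / 4) v _ (smooth_dv D lnf u v H Huv)).
  assumption.
Qed.

Lemma cs_canonical u v : D u v -> cs u v ^ 2 * sqrt (Rabs (mu u v ^ 2 - nu u v ^ 2)) = 1.
Proof.
  intros Huv. destruct (factors_neq_0 u v Huv) as (H1 & _).
  replace (sqrt (Rabs (mu u v ^ 2 - nu u v ^ 2))) with (exp (/ 2 * lnf u v)).
  - unfold cs. rewrite <- (Rmult_1_r (exp _)) at 1. simpl pow.
    rewrite !Rmult_1_r, <- !exp_plus, <- exp_0. f_equal. field.
  - symmetry. apply sqrt_lem_1; [apply Rabs_pos | left; apply exp_pos |].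
    rewrite <- exp_plus. replace (/ 2 * lnf u v + / 2 * lnf u v) with (lnf u v) by field.
    apply exp_ln. now apply Rabs_pos_lt.
Qed.

(** Connects the nonvanishing hypothesis of the theorem, which concerns |mu^2 - nu^2|, with [cwu],
    which is built from its logarithm. *)
Lemma pu_Rabs_lnf u v : D u v ->
  pu (fun a b => Rabs (mu a b ^ 2 - nu a b ^ 2)) u v =
  Rabs (mu u v ^ 2 - nu u v ^ 2) * pu lnf u v.
Proof.
  intros Huv. pose proof smooth_lnf as HL. apply pu_val.
  assert (He : forall a b, D a b -> exp (lnf a b) = Rabs (mu a b ^ 2 - nu a b ^ 2)).
  { intros a b Hab. apply exp_ln, Rabs_pos_lt. now apply factors_neq_0. }
  apply (deriv_u_ext D (fun a b => exp (lnf a b)) _ u v _ HD He Huv).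
  rewrite <- He by trivial.
  apply (derivable_pt_lim_comp (fun t => lnf t v) exp); [now apply (smooth_du D) |].
  apply derivable_pt_lim_exp.
Qed.
Lemma pv_Rabs_lnf u v : D u v ->
  pv (fun a b => Rabs (mu a b ^ 2 - nu a b ^ 2)) u v =
  Rabs (mu u v ^ 2 - nu u v ^ 2) * pv lnf u v.
Proof.
  intros Huv. pose proof smooth_lnf as HL. apply pv_val.
  assert (He : forall a b, D a b -> exp (lnf a b) = Rabs (mu a b ^ 2 - nu a b ^ 2)).
  { intros a b Hab. apply exp_ln, Rabs_pos_lt. now apply factors_neq_0. }
  apply (deriv_v_ext D (fun a b => exp (lnf a b)) _ u v _ HD He Huv).
  rewrite <- He by trivial.
  apply (derivable_pt_lim_comp (fun t => lnf u t) exp); [now apply (smooth_dv D) |].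
  apply derivable_pt_lim_exp.
Qed.

(** Free of division, because [codazzi_equations] multiplies through by mu^2 - nu^2. *)
Lemma pu_lnf u v : D u v ->
  (mu u v ^ 2 - nu u v ^ 2) * pu lnf u v = 2 * (mu u v * pu mu u v - nu u v * pu nu u v).
Proof.
  intros Huv. destruct (factors_neq_0 u v Huv) as (H1 & _).
  (* Squares are written as products, the form that [deriv_u] differentiates. *)
  assert (Hd : derivable_pt_lim (fun t => mu t v * mu t v - nu t v * nu t v) u
    (2 * (mu u v * pu mu u v - nu u v * pu nu u v))).
  { replace (2 * (mu u v * pu mu u v - nu u v * pu nu u v)) with
      (pu mu u v * mu u v + mu u v * pu mu u v - (pu nu u v * nu u v + nu u v * pu nu u v)) by ring.
    deriv_u D. }
  rewrite (pu_val lnf u v (/ (mu u v ^ 2 - nu u v ^ 2) * (2 * (mu u v * pu mu u v - nu u v * pu nu u v)))).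
  - field. trivial.
  - apply (derivable_pt_lim_comp (fun t => mu t v ^ 2 - nu t v ^ 2) (fun t => ln (Rabs t))).
    + apply (derivable_pt_lim_local (fun t => mu t v * mu t v - nu t v * nu t v) _ _ _ 1 Rlt_0_1);
        trivial. intros; ring.
    + now apply derivable_pt_lim_ln_Rabs.
Qed.
Lemma pv_lnf u v : D u v ->
  (mu u v ^ 2 - nu u v ^ 2) * pv lnf u v = 2 * (mu u v * pv mu u v - nu u v * pv nu u v).
Proof.
  intros Huv. destruct (factors_neq_0 u v Huv) as (H1 & _).
  assert (Hd : derivable_pt_lim (fun t => mu u t * mu u t - nu u t * nu u t) v
    (2 * (mu u v * pv mu u v - nu u v * pv nu u v))).
  { replace (2 * (mu u v * pv mu u v - nu u v * pv nu u v)) with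
      (pv mu u v * mu u v + mu u v * pv mu u v - (pv nu u v * nu u v + nu u v * pv nu u v)) by ring.
    deriv_v D. }
  rewrite (pv_val lnf u v (/ (mu u v ^ 2 - nu u v ^ 2) * (2 * (mu u v * pv mu u v - nu u v * pv nu u v)))).
  - field. trivial.
  - apply (derivable_pt_lim_comp (fun t => mu u t ^ 2 - nu u t ^ 2) (fun t => ln (Rabs t))).
    + apply (derivable_pt_lim_local (fun t => mu u t * mu u t - nu u t * nu u t) _ _ _ 1 Rlt_0_1);
        trivial. intros; ring.
    + now apply derivable_pt_lim_ln_Rabs.
Qed.

Lemma pu_lnh u v : D u v ->
  (mu u v ^ 2 - nu u v ^ 2) * pu lnh u v = 2 * (mu u v * pu nu u v - nu u v * pu mu u v).
Proof.
  intros Huv. destruct (factors_neq_0 u v Huv) as (_ & H1 & H2).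
  rewrite (pu_val lnh u v (/ (mu u v + nu u v) * (pu mu u v + pu nu u v) -
                           / (mu u v - nu u v) * (pu mu u v - pu nu u v))).
  - field. now split.
  - apply (deriv_u_ext D _ _ u v _ HD lnh_minus Huv).
    apply (derivable_pt_lim_minus (fun t => ln (Rabs (mu t v + nu t v)))).
    + apply (derivable_pt_lim_comp (fun t => mu t v + nu t v) (fun t => ln (Rabs t)));
        [deriv_u D | now apply derivable_pt_lim_ln_Rabs].
    + apply (derivable_pt_lim_comp (fun t => mu t v - nu t v) (fun t => ln (Rabs t)));
        [deriv_u D | now apply derivable_pt_lim_ln_Rabs].
Qed.
Lemma pv_lnh u v : D u v ->
  (mu u v ^ 2 - nu u v ^ 2) * pv lnh u v = 2 * (mu u v * pv nu u v - nu u v * pv mu u v).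
Proof.
  intros Huv. destruct (factors_neq_0 u v Huv) as (_ & H1 & H2).
  rewrite (pv_val lnh u v (/ (mu u v + nu u v) * (pv mu u v + pv nu u v) -
                           / (mu u v - nu u v) * (pv mu u v - pv nu u v))).
  - field. now split.
  - apply (deriv_v_ext D _ _ u v _ HD lnh_minus Huv).
    apply (derivable_pt_lim_minus (fun t => ln (Rabs (mu u t + nu u t)))).
    + apply (derivable_pt_lim_comp (fun t => mu u t + nu u t) (fun t => ln (Rabs t)));
        [deriv_v D | now apply derivable_pt_lim_ln_Rabs].
    + apply (derivable_pt_lim_comp (fun t => mu u t - nu u t) (fun t => ln (Rabs t)));
        [deriv_v D | now apply derivable_pt_lim_ln_Rabs].
Qed.

(** The logarithms of |mu + nu| and |mu - nu| are half the sum and half the difference of [lnf] and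
    [lnh]. After multiplication by mu^2 - nu^2 both sides are polynomial in nu, mu, [cs] and the
    first derivatives of nu and mu. *)
Lemma codazzi_equations u v : D u v ->
  cwv u v * cp u v + pv cp u v = - (cq u v * cA u v) /\
  cwu u v * cq u v + pu cq u v = cp u v * cB u v /\
  cwu u v * cp u v + pu cp u v = cq u v * cB u v /\
  cwv u v * cq u v + pv cq u v = - (cp u v * cA u v).
Proof.
  intros Huv. destruct (factors_neq_0 u v Huv) as (Hf & _).
  pose proof smooth_cs as Hs.
  assert (E1 : pv cp u v = cs u v * cwv u v * nu u v + cs u v * pv nu u v).
  { unfold cp. pv_eq D. now rewrite pv_cs. }
  assert (E2 : pu cq u v = cs u v * cwu u v * mu u v + cs u v * pu mu u v).
  { unfold cq. pu_eq D. now rewrite pu_cs. }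
  assert (E3 : pu cp u v = cs u v * cwu u v * nu u v + cs u v * pu nu u v).
  { unfold cp. pu_eq D. now rewrite pu_cs. }
  assert (E4 : pv cq u v = cs u v * cwv u v * mu u v + cs u v * pv mu u v).
  { unfold cq. pv_eq D. now rewrite pv_cs. }
  rewrite E1, E2, E3, E4. unfold cp, cq, cA, cB, cwu, cwv.
  pose proof (pu_lnf u v Huv) as Lu. pose proof (pv_lnf u v Huv) as Lv.
  pose proof (pu_lnh u v Huv) as Lhu. pose proof (pv_lnh u v Huv) as Lhv.
  set (f := mu u v ^ 2 - nu u v ^ 2) in *.
  repeat split; apply (Rmult_eq_reg_l f); trivial.
  - transitivity (- / 2 * cs u v * nu u v * (f * pv lnf u v) + f * cs u v * pv nu u v); [field |].
    transitivity (/ 2 * cs u v * mu u v * (f * pv lnh u v)); [| field].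
    rewrite Lv, Lhv. unfold f. field.
  - transitivity (- / 2 * cs u v * mu u v * (f * pu lnf u v) + f * cs u v * pu mu u v); [field |].
    transitivity (/ 2 * cs u v * nu u v * (f * pu lnh u v)); [| field].
    rewrite Lu, Lhu. unfold f. field.
  - transitivity (- / 2 * cs u v * nu u v * (f * pu lnf u v) + f * cs u v * pu nu u v); [field |].
    transitivity (/ 2 * cs u v * mu u v * (f * pu lnh u v)); [| field].
    rewrite Lu, Lhu. unfold f. field.
  - transitivity (- / 2 * cs u v * mu u v * (f * pv lnf u v) + f * cs u v * pv mu u v); [field |].
    transitivity (/ 2 * cs u v * nu u v * (f * pv lnh u v)); [| field].
    rewrite Lv, Lhv. unfold f. field.
Qed.

(** Multiplying the given equation by s^2 removes the square root, by [cs_canonical];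
    [ricci_equation] works in the same way. *)
Lemma gauss_equation u v : D u v ->
  / 4 * sqrt (Rabs (mu u v ^ 2 - nu u v ^ 2)) * lap lnf u v + nu u v ^ 2 + mu u v ^ 2 = 0 ->
  pu cwu u v + pv cwv u v = cp u v ^ 2 + cq u v ^ 2.
Proof.
  intros Huv H. pose proof (cs_canonical u v Huv) as Hc. pose proof smooth_lnf as HL.
  assert (E1 : pu cwu u v = - / 4 * pu (pu lnf) u v) by (unfold cwu; pu_eq D; ring).
  assert (E2 : pv cwv u v = - / 4 * pv (pv lnf) u v) by (unfold cwv; pv_eq D; ring).
  rewrite E1, E2. unfold cp, cq. unfold lap in H.
  transitivity (- / 4 * (cs u v ^ 2 * sqrt (Rabs (mu u v ^ 2 - nu u v ^ 2))) *
    (pu (pu lnf) u v + pv (pv lnf) u v)); [rewrite Hc; ring |].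
  transitivity (cs u v ^ 2 * (nu u v ^ 2 + mu u v ^ 2)); [| ring].
  replace (nu u v ^ 2 + mu u v ^ 2) with
    (- (/ 4 * sqrt (Rabs (mu u v ^ 2 - nu u v ^ 2)) * (pu (pu lnf) u v + pv (pv lnf) u v))) by lra.
  ring.
Qed.

Lemma ricci_equation u v : D u v ->
  / 2 * sqrt (Rabs (mu u v ^ 2 - nu u v ^ 2)) * lap lnh u v + 2 * nu u v * mu u v = 0 ->
  pu cB u v - pv cA u v = - (2 * cp u v * cq u v).
Proof.
  intros Huv H. pose proof (cs_canonical u v Huv) as Hc. pose proof smooth_lnh as HL.
  assert (E1 : pu cB u v = / 2 * pu (pu lnh) u v) by (unfold cB; pu_eq D; ring).
  assert (E2 : pv cA u v = - / 2 * pv (pv lnh) u v) by (unfold cA; pv_eq D; ring).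
  rewrite E1, E2. unfold cp, cq. unfold lap in H.
  transitivity (/ 2 * (cs u v ^ 2 * sqrt (Rabs (mu u v ^ 2 - nu u v ^ 2))) *
    (pu (pu lnh) u v + pv (pv lnh) u v)); [rewrite Hc; ring |].
  transitivity (- (cs u v ^ 2 * (2 * nu u v * mu u v))); [| ring].
  replace (2 * nu u v * mu u v) with
    (- (/ 2 * sqrt (Rabs (mu u v ^ 2 - nu u v ^ 2)) * (pu (pu lnh) u v + pv (pv lnh) u v))) by lra.
  ring.
Qed.
End Coefficients.

(** * Squares and path-connected domains *)

Lemma open2_square u0 v0 r : open2 (square u0 v0 r).
Proof.
  intros u v [Hu Hv].
  exists (Rmin (r - Rabs (u - u0)) (r - Rabs (v - v0))). split; [apply Rmin_pos; lra |].
  intros a b Ha Hb.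
  pose proof (Rmin_l (r - Rabs (u - u0)) (r - Rabs (v - v0))).
  pose proof (Rmin_r (r - Rabs (u - u0)) (r - Rabs (v - v0))). split.
  - replace (a - u0) with ((a - u) + (u - u0)) by ring.
    eapply Rle_lt_trans; [apply Rabs_triang | lra].
  - replace (b - v0) with ((b - v) + (v - v0)) by ring.
    eapply Rle_lt_trans; [apply Rabs_triang | lra].
Qed.

Lemma domain2_square u0 v0 r : 0 < r -> domain2 (square u0 v0 r).
Proof.
  intros Hr. split; [apply open2_square |]. split.
  - exists u0, v0. split; now rewrite Rminus_diag, Rabs_R0.
  - intros u1 v1 u2 v2 [H1 H2] [H3 H4].
    exists (fun t => u1 + t * (u2 - u1)), (fun t => v1 + t * (v2 - v1)).
    split; [intro t; apply derivable_continuous_pt; exists (u2 - u1);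
            apply is_derive_Reals; auto_derive; trivial; ring |].
    split; [intro t; apply derivable_continuous_pt; exists (v2 - v1);
            apply is_derive_Reals; auto_derive; trivial; ring |].
    repeat (split; [ring |]). intros t Ht.
    assert (Hseg : forall a b, Rmin a b <= a + t * (b - a) <= Rmax a b).
    { intros a b. unfold Rmin, Rmax. destruct (Rle_dec a b); nra. }
    split; [apply (segment_ball u0 r u1 u2) | apply (segment_ball v0 r v1 v2)]; auto.
Qed.

Lemma path_constant D f : open2 D -> path_connected2 D ->
  (forall u v, D u v -> derivable_pt_lim (fun s => f s v) u 0) ->
  (forall u v, D u v -> derivable_pt_lim (fun s => f u s) v 0) ->
  forall u1 v1 u2 v2, D u1 v1 -> D u2 v2 -> f u1 v1 = f u2 v2.
Proof.
  intros HD HP Hu Hv u1 v1 u2 v2 H1 H2.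
  assert (Hloc : forall u v, D u v -> exists r, 0 < r /\ forall a b,
    Rabs (a - u) < r -> Rabs (b - v) < r -> f a b = f u v).
  { intros u v Huv. destruct (HD u v Huv) as [r [Hr Hin]]. exists r. split; [trivial |].
    intros a b Ha Hb.
    assert (H0 : forall c, Rabs (c - c) < r) by (intro; rewrite Rminus_diag, Rabs_R0; lra).
    assert (E1 : Rabs (f a b - f u b) <= 0 * Rabs (a - u)).
    { apply (mean_bound (fun t => f t b) (fun _ => 0)). intros t Ht. rewrite Rabs_R0.
      split; [| lra]. apply Hu, Hin; trivial. now apply (segment_ball u r u a). }
    assert (E2 : Rabs (f u b - f u v) <= 0 * Rabs (b - v)).
    { apply (mean_bound (fun t => f u t) (fun _ => 0)). intros t Ht. rewrite Rabs_R0.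
      split; [| lra]. apply Hv, Hin; trivial. now apply (segment_ball v r v b). }
    rewrite Rmult_0_l in E1, E2.
    pose proof (Rle_abs (f a b - f u b)). pose proof (Rle_abs (- (f a b - f u b))).
    pose proof (Rle_abs (f u b - f u v)). pose proof (Rle_abs (- (f u b - f u v))).
    rewrite Rabs_Ropp in *. lra. }
  destruct (HP u1 v1 u2 v2 H1 H2) as (g & h & Hg & Hh & G0 & H0 & G1 & H1' & Hin).
  (* Clamping the parameter to [0,1] makes the composite locally constant on the whole line. *)
  set (k := fun t => Rmax 0 (Rmin 1 t)).
  assert (Hk : forall t, 0 <= k t <= 1).
  { intro t. unfold k, Rmax, Rmin. destruct (Rle_dec 1 t); destruct (Rle_dec 0 _); lra. }
  assert (Hkl : forall t t', Rabs (k t' - k t) <= Rabs (t' - t)).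
  { intros t t'. unfold k, Rmax, Rmin, Rabs.
    destruct (Rle_dec 1 t), (Rle_dec 1 t'); repeat destruct (Rle_dec 0 _);
    repeat destruct (Rcase_abs _); lra. }
  set (F := fun t => f (g (k t)) (h (k t))).
  assert (HF : forall t, derivable_pt_lim F t 0).
  { intro t. destruct (Hloc _ _ (Hin _ (Hk t))) as [r [Hr Hc]].
    destruct (Hg (k t) r Hr) as [d1 [Hd1 Hg1]]. destruct (Hh (k t) r Hr) as [d2 [Hd2 Hh1]].
    apply (derivable_pt_lim_local (fun _ => F t) F t 0 (Rmin d1 d2)).
    - now apply Rmin_pos.
    - intros t' Ht'. symmetry.
      assert (Hd : forall (w : R -> R) d, (forall x, D_x no_cond (k t) x /\ Rabs (x - k t) < d ->
          Rabs (w x - w (k t)) < r) -> Rmin d1 d2 <= d -> Rabs (w (k t') - w (k t)) < r).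
      { intros w d Hw Hle. destruct (Req_dec (k t') (k t)) as [-> | Hne].
        - rewrite Rminus_diag, Rabs_R0. lra.
        - apply Hw. split; [split; [exact I | auto] |]. specialize (Hkl t t'). lra. }
      apply Hc; [apply (Hd g d1 Hg1), Rmin_l | apply (Hd h d2 Hh1), Rmin_r].
    - apply derivable_pt_lim_const. }
  assert (E : Rabs (F 1 - F 0) <= 0 * Rabs (1 - 0)).
  { apply (mean_bound F (fun _ => 0)). intros t _. rewrite Rabs_R0. split; [apply HF | lra]. }
  assert (K0 : k 0 = 0) by (unfold k, Rmax, Rmin; destruct (Rle_dec 1 0); destruct (Rle_dec 0 _); lra).
  assert (K1 : k 1 = 1) by (unfold k, Rmax, Rmin; destruct (Rle_dec 1 1); destruct (Rle_dec 0 _); lra).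
  unfold F in E. rewrite K0, K1, G0, H0, G1, H1' in E. rewrite Rmult_0_l in E.
  pose proof (Rle_abs (f u2 v2 - f u1 v1)). pose proof (Rle_abs (- (f u2 v2 - f u1 v1))).
  rewrite Rabs_Ropp in *. lra.
Qed.

(** * Existence *)

Lemma Ck_sum D n N (f : nat -> R -> R -> R) : open2 D ->
  (forall j, (j <= N)%nat -> Ck D n (f j)) -> Ck D n (fun u v => sum_f_R0 (fun j => f j u v) N).
Proof.
  intros HD. induction N as [| N IH]; intros H; simpl; [now apply H |].
  apply (Ck_plus D n (fun u v => sum_f_R0 (fun j => f j u v) N) (f (S N))); auto.
Qed.

(** Bootstrapping: the derivatives are smooth combinations of the functions themselves, so order n
    for all components gives order n + 1. *)
Lemma linear_system_smooth D N (a b : nat -> nat -> R -> R -> R) (M : nat -> R -> R -> R) :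
  open2 D -> (forall i j, smooth_on D (a i j)) -> (forall i j, smooth_on D (b i j)) ->
  (forall i, (i <= N)%nat -> cont_on D (M i) /\ forall u v, D u v ->
     derivable_pt_lim (fun s => M i s v) u (sum_f_R0 (fun j => a i j u v * M j u v) N) /\
     derivable_pt_lim (fun s => M i u s) v (sum_f_R0 (fun j => b i j u v * M j u v) N)) ->
  forall i, (i <= N)%nat -> smooth_on D (M i).
Proof.
  intros HD Ha Hb HM i Hi. apply Ck_smooth. intro n. revert i Hi.
  induction n as [| n IH]; intros i Hi.
  - split; [now apply HM | exact I].
  - apply (Ck_intro D n (M i) (fun u v => sum_f_R0 (fun j => a i j u v * M j u v) N)
      (fun u v => sum_f_R0 (fun j => b i j u v * M j u v) N)); trivial.
    + now apply HM.
    + intros. now apply HM.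
    + intros. now apply HM.
    + apply (Ck_sum D n N (fun j u v => a i j u v * M j u v)); trivial.
      intros j Hj. apply Ck_mult; auto using smooth_Ck.
    + apply (Ck_sum D n N (fun j u v => b i j u v * M j u v)); trivial.
      intros j Hj. apply Ck_mult; auto using smooth_Ck.
Qed.

Section Existence.
Variables (D : R -> R -> Prop) (s p q wu wv A B : R -> R -> R).

(* The rows are indexed by x, y, n1, n2 and the position vector z. *)
Definition mat_u (i j : nat) : R -> R -> R :=
  match i, j with
  | 0%nat, 1%nat => fun u v => - wv u v | 0%nat, 2%nat => p
  | 1%nat, 0%nat => wv | 1%nat, 3%nat => q
  | 2%nat, 0%nat => fun u v => - p u v | 2%nat, 3%nat => A
  | 3%nat, 1%nat => fun u v => - q u v | 3%nat, 2%nat => fun u v => - A u v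
  | 4%nat, 0%nat => s
  | _, _ => fun _ _ => 0
  end.
Definition mat_v (i j : nat) : R -> R -> R :=
  match i, j with
  | 0%nat, 1%nat => wu | 0%nat, 3%nat => q
  | 1%nat, 0%nat => fun u v => - wu u v | 1%nat, 2%nat => fun u v => - p u v
  | 2%nat, 1%nat => p | 2%nat, 3%nat => B
  | 3%nat, 0%nat => fun u v => - q u v | 3%nat, 2%nat => fun u v => - B u v
  | 4%nat, 1%nat => s
  | _, _ => fun _ _ => 0
  end.

Hypotheses (HD : open2 D) (Hs : smooth_on D s) (Hp : smooth_on D p) (Hq : smooth_on D q)
  (Hwu : smooth_on D wu) (Hwv : smooth_on D wv) (HA : smooth_on D A) (HB : smooth_on D B).

Lemma smooth_mat_u i j : smooth_on D (mat_u i j).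
Proof.
  destruct i as [| [| [| [| [| i]]]]], j as [| [| [| [| j]]]]; simpl; smooth.
Qed.
Lemma smooth_mat_v i j : smooth_on D (mat_v i j).
Proof.
  destruct i as [| [| [| [| [| i]]]]], j as [| [| [| [| j]]]]; simpl; smooth.
Qed.

Hypotheses
  (Hsu : forall u v, D u v -> pu s u v = s u v * wu u v)
  (Hsv : forall u v, D u v -> pv s u v = s u v * wv u v)
  (Hgauss : forall u v, D u v -> pu wu u v + pv wv u v = p u v ^ 2 + q u v ^ 2)
  (Hricci : forall u v, D u v -> pu B u v - pv A u v = - (2 * p u v * q u v))
  (Hcod : forall u v, D u v ->
     wv u v * p u v + pv p u v = - (q u v * A u v) /\
     wu u v * q u v + pu q u v = p u v * B u v /\
     wu u v * p u v + pu p u v = q u v * B u v /\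
     wv u v * q u v + pv q u v = - (p u v * A u v)).

Lemma pu_opp f u v : smooth_on D f -> D u v -> pu (fun a b => - f a b) u v = - pu f u v.
Proof. intros Hf Huv. now pu_eq D. Qed.
Lemma pv_opp f u v : smooth_on D f -> D u v -> pv (fun a b => - f a b) u v = - pv f u v.
Proof. intros Hf Huv. now pv_eq D. Qed.

(** Rows 0 to 3 amount to the Gauss, Codazzi and Ricci equations, and row 4 to the symmetry of the
    second derivatives of z. *)
Lemma system_flat u v : D u v -> forall (m : nat -> R) i, (i <= 4)%nat ->
  sum_f_R0 (fun j => pv (mat_u i j) u v * m j) 4 +
  sum_f_R0 (fun j => mat_u i j u v * sum_f_R0 (fun k => mat_v j k u v * m k) 4) 4 =
  sum_f_R0 (fun j => pu (mat_v i j) u v * m j) 4 +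
  sum_f_R0 (fun j => mat_v i j u v * sum_f_R0 (fun k => mat_u j k u v * m k) 4) 4.
Proof.
  intros Huv m i Hi.
  pose proof (Hsu u v Huv) as Esu. pose proof (Hsv u v Huv) as Esv.
  pose proof (Hgauss u v Huv). pose proof (Hricci u v Huv).
  destruct (Hcod u v Huv) as (?&?&?&?).
  assert (E0u : pu (fun _ _ => 0) u v = 0) by apply pu_val, derivable_pt_lim_const.
  assert (E0v : pv (fun _ _ => 0) u v = 0) by apply pv_val, derivable_pt_lim_const.
  (* The equations are solved for one derivative each, so that rewriting eliminates it and a
     polynomial identity is left. *)
  assert (Ewv : pv wv u v = p u v ^ 2 + q u v ^ 2 - pu wu u v) by lra.
  assert (EA : pv A u v = pu B u v + 2 * p u v * q u v) by lra.
  assert (Epv : pv p u v = - (q u v * A u v) - wv u v * p u v) by lra.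
  assert (Equ : pu q u v = p u v * B u v - wu u v * q u v) by lra.
  assert (Epu : pu p u v = q u v * B u v - wu u v * p u v) by lra.
  assert (Eqv : pv q u v = - (p u v * A u v) - wv u v * q u v) by lra.
  destruct i as [| [| [| [| [| i]]]]]; [| | | | | lia]; simpl;
    rewrite ?pu_opp, ?pv_opp by trivial;
    rewrite ?E0u, ?E0v, ?Esu, ?Esv, ?Ewv, ?EA, ?Epv, ?Equ, ?Epu, ?Eqv; ring.
Qed.

Lemma moving_frame_exists u0 v0 : D u0 v0 -> exists r z x y n1 n2, 0 < r /\
  (forall u v, square u0 v0 r u v -> D u v) /\
  vsmooth_on (square u0 v0 r) z /\ vsmooth_on (square u0 v0 r) x /\
  vsmooth_on (square u0 v0 r) y /\ vsmooth_on (square u0 v0 r) n1 /\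
  vsmooth_on (square u0 v0 r) n2 /\
  frame_eqs (square u0 v0 r) z x y n1 n2 s p q wu wv A B /\
  (forall u v, square u0 v0 r u v -> orthonormal (x u v) (y u v) (n1 u v) (n2 u v) /\
     det4 (x u v) (y u v) (n1 u v) (n2 u v) = 1).
Proof.
  intros H0.
  destruct (frobenius D 4 mat_u mat_v u0 v0 HD H0 smooth_mat_u smooth_mat_v system_flat)
    as (r & Hr & Hsub & Hex).
  set (Q := square u0 v0 r) in *.
  assert (HQ : domain2 Q) by now apply domain2_square.
  destruct HQ as (HQo & _ & HQp).
  assert (HQ0 : Q u0 v0) by (split; now rewrite Rminus_diag, Rabs_R0).
  (* The vector system splits into four scalar systems, one per coordinate k. With these initial
     values the frame starts at the standard basis and z (index 4) at the origin. *)
  set (c := fun k i : nat => if Nat.eqb i k then 1 else 0).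
  destruct (Hex (c 0%nat)) as [M0 [I0 S0]]. destruct (Hex (c 1%nat)) as [M1 [I1 S1]].
  destruct (Hex (c 2%nat)) as [M2 [I2 S2]]. destruct (Hex (c 3%nat)) as [M3 [I3 S3]].
  assert (Hma : forall i j, smooth_on Q (mat_u i j)).
  { intros. apply (smooth_sub D); auto using smooth_mat_u. }
  assert (Hmb : forall i j, smooth_on Q (mat_v i j)).
  { intros. apply (smooth_sub D); auto using smooth_mat_v. }
  pose proof (linear_system_smooth Q 4 mat_u mat_v M0 HQo Hma Hmb S0) as C0.
  pose proof (linear_system_smooth Q 4 mat_u mat_v M1 HQo Hma Hmb S1) as C1.
  pose proof (linear_system_smooth Q 4 mat_u mat_v M2 HQo Hma Hmb S2) as C2.
  pose proof (linear_system_smooth Q 4 mat_u mat_v M3 HQo Hma Hmb S3) as C3.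
  set (F := fun i u v => mkV4 (M0 i u v) (M1 i u v) (M2 i u v) (M3 i u v)).
  assert (HF : forall i, (i <= 4)%nat -> vsmooth_on Q (F i)).
  { intros i Hi. refine (conj _ (conj _ (conj _ _))); simpl; auto. }
  assert (L : frame_eqs Q (F 4%nat) (F 0%nat) (F 1%nat) (F 2%nat) (F 3%nat) s p q wu wv A B).
  { intros u v Huv. unfold Pu, Pv, F, vadd, vscale; simpl.
    assert (DM : forall (M : nat -> R -> R -> R), (forall i : nat, (i <= 4)%nat ->
        cont_on Q (M i) /\ (forall u v : R, Q u v ->
         derivable_pt_lim (fun s => M i s v) u (sum_f_R0 (fun j => mat_u i j u v * M j u v) 4) /\
         derivable_pt_lim (fun s => M i u s) v (sum_f_R0 (fun j => mat_v i j u v * M j u v) 4))) ->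
      forall i, (i <= 4)%nat ->
        pu (fun a b => M i a b) u v = sum_f_R0 (fun j => mat_u i j u v * M j u v) 4 /\
        pv (fun a b => M i a b) u v = sum_f_R0 (fun j => mat_v i j u v * M j u v) 4).
    { intros M HM i Hi. destruct (HM i Hi) as [_ HMd]. destruct (HMd u v Huv).
      split; [now apply pu_val | now apply pv_val]. }
    assert (T0 : (0 <= 4)%nat) by lia. assert (T1 : (1 <= 4)%nat) by lia.
    assert (T2 : (2 <= 4)%nat) by lia. assert (T3 : (3 <= 4)%nat) by lia.
    assert (T4 : (4 <= 4)%nat) by lia.
    repeat split; apply V4_ext; simpl;
    match goal with |- _ (fun a b => ?M ?i a b) _ _ = _ =>
      first [ rewrite (proj1 (DM M ltac:(assumption) i ltac:(assumption))) |
              rewrite (proj2 (DM M ltac:(assumption) i ltac:(assumption))) ] end;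
    simpl; ring. }
  assert (Hon : forall u v, Q u v -> orthonormal (F 0%nat u v) (F 1%nat u v) (F 2%nat u v) (F 3%nat u v)).
  (* A scalar solution is a column of the frame matrix. By skew-symmetry the product of two columns
     is constant ([K]), hence the columns stay orthonormal, and therefore the rows. *)
  { intros u v Huv. apply orthonormal_transpose.
    assert (K : forall M M' : nat -> R -> R -> R,
      (forall i : nat, (i <= 4)%nat -> cont_on Q (M i) /\ (forall u v : R, Q u v ->
         derivable_pt_lim (fun s => M i s v) u (sum_f_R0 (fun j => mat_u i j u v * M j u v) 4) /\
         derivable_pt_lim (fun s => M i u s) v (sum_f_R0 (fun j => mat_v i j u v * M j u v) 4))) ->
      (forall i : nat, (i <= 4)%nat -> cont_on Q (M' i) /\ (forall u v : R, Q u v ->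
         derivable_pt_lim (fun s => M' i s v) u (sum_f_R0 (fun j => mat_u i j u v * M' j u v) 4) /\
         derivable_pt_lim (fun s => M' i u s) v (sum_f_R0 (fun j => mat_v i j u v * M' j u v) 4))) ->
      M 0%nat u v * M' 0%nat u v + M 1%nat u v * M' 1%nat u v + M 2%nat u v * M' 2%nat u v +
      M 3%nat u v * M' 3%nat u v =
      M 0%nat u0 v0 * M' 0%nat u0 v0 + M 1%nat u0 v0 * M' 1%nat u0 v0 +
      M 2%nat u0 v0 * M' 2%nat u0 v0 + M 3%nat u0 v0 * M' 3%nat u0 v0).
    { intros M M' HM HM'.
      apply (path_constant Q (fun u v => M 0%nat u v * M' 0%nat u v + M 1%nat u v * M' 1%nat u v +
        M 2%nat u v * M' 2%nat u v + M 3%nat u v * M' 3%nat u v)); trivial.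
      - intros a b Hab. evar (l : R). replace 0 with l; unfold l.
        + repeat apply derivable_pt_lim_plus; apply derivable_pt_lim_mult;
            (apply HM || apply HM'); auto with arith.
        + simpl. ring.
      - intros a b Hab. evar (l : R). replace 0 with l; unfold l.
        + repeat apply derivable_pt_lim_plus; apply derivable_pt_lim_mult;
            (apply HM || apply HM'); auto with arith.
        + simpl. ring. }
    unfold orthonormal, transpose, F, vdot; simpl.
    rewrite !K by assumption. rewrite !I0, !I1, !I2, !I3. unfold c; simpl. repeat split; ring. }
  exists r, (F 4%nat), (F 0%nat), (F 1%nat), (F 2%nat), (F 3%nat).
  split; [trivial |]. split; [trivial |].
  do 5 (split; [apply HF; lia |]). split; [trivial |].
  intros u v Huv. split; [now apply Hon |].
  (* The frame part of the coefficient matrices has trace zero, so the determinant keeps its initial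
     value 1. *)
  transitivity (det4 (F 0%nat u0 v0) (F 1%nat u0 v0) (F 2%nat u0 v0) (F 3%nat u0 v0)).
  2: { unfold F. rewrite !I0, !I1, !I2, !I3. unfold c, det4, det3; simpl. ring. }
  apply (path_constant Q (fun u v => det4 (F 0%nat u v) (F 1%nat u v) (F 2%nat u v) (F 3%nat u v)));
    trivial; intros a b Hab; unfold det4, det3, F; simpl; evar (l : R); replace 0 with l; unfold l.
  - repeat first [apply derivable_pt_lim_minus | apply derivable_pt_lim_plus | apply derivable_pt_lim_mult];
      (apply S0 || apply S1 || apply S2 || apply S3); auto with arith.
  - simpl. ring.
  - repeat first [apply derivable_pt_lim_minus | apply derivable_pt_lim_plus | apply derivable_pt_lim_mult];
      (apply S0 || apply S1 || apply S2 || apply S3); auto with arith.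
  - simpl. ring.
Qed.
End Existence.

(** * Uniqueness *)

Lemma Pu_Pv_swap D X u v : open2 D -> vsmooth_on D X -> D u v -> Pu (Pv X) u v = Pv (Pu X) u v.
Proof.
  intros HD (?&?&?&?) Huv. apply V4_ext; simpl; now apply (smooth_mixed D).
Qed.

Lemma Pu_scale D k X W u v : open2 D -> smooth_on D k -> vsmooth_on D X ->
  (forall u v, D u v -> W u v = vscale (k u v) (X u v)) -> D u v ->
  Pu W u v = vadd (vscale (pu k u v) (X u v)) (vscale (k u v) (Pu X u v)).
Proof.
  intros HD Hk HX HW Huv.
  rewrite (Pu_ext D (fun u v => vscale (k u v) (X u v)) W); trivial; [| now intros; rewrite HW |].
  - destruct HX as (?&?&?&?). unfold Pu, vadd, vscale. apply V4_ext; simpl; pu_eq D; ring.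
  - destruct HX as (?&?&?&?). refine (conj _ (conj _ (conj _ _))); simpl; smooth.
Qed.
Lemma Pv_scale D k X W u v : open2 D -> smooth_on D k -> vsmooth_on D X ->
  (forall u v, D u v -> W u v = vscale (k u v) (X u v)) -> D u v ->
  Pv W u v = vadd (vscale (pv k u v) (X u v)) (vscale (k u v) (Pv X u v)).
Proof.
  intros HD Hk HX HW Huv.
  rewrite (Pv_ext D (fun u v => vscale (k u v) (X u v)) W); trivial; [| now intros; rewrite HW |].
  - destruct HX as (?&?&?&?). unfold Pv, vadd, vscale. apply V4_ext; simpl; pv_eq D; ring.
  - destruct HX as (?&?&?&?). refine (conj _ (conj _ (conj _ _))); simpl; smooth.
Qed.

(* The coefficients of the frame equations are forced: the symmetry of the second derivatives of
   [z] yields the tangential ones, that of [x] and [y], tested against [n1], the normal ones. *)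
Lemma canonical_frame D z nu mu : open2 D -> smooth_on D nu -> smooth_on D mu ->
  canonical_SRMGT z D nu mu ->
  exists x y n1 n2, vsmooth_on D z /\ vsmooth_on D x /\ vsmooth_on D y /\ vsmooth_on D n1 /\
    vsmooth_on D n2 /\
    (forall u v, D u v -> orthonormal (x u v) (y u v) (n1 u v) (n2 u v) /\
       det4 (x u v) (y u v) (n1 u v) (n2 u v) > 0) /\
    frame_eqs D z x y n1 n2 (cs nu mu) (cp nu mu) (cq nu mu) (cwu nu mu) (cwv nu mu)
      (cA nu mu) (cB nu mu).
Proof.
  intros HD Hnu Hmu ((Hz & _) & _ & _ & x & y & n1 & n2 & g1 & g2 & b1 & b2 & Hgf & Hcan).
  destruct Hgf as (Hx & Hy & Hn1 & Hn2 & Hgf).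
  exists x, y, n1, n2. do 5 (split; [trivial |]).
  assert (Hne : forall u v, D u v -> mu u v ^ 2 <> nu u v ^ 2) by (intros; now apply Hgf).
  assert (Hon : forall u v, D u v -> orthonormal (x u v) (y u v) (n1 u v) (n2 u v) /\
       det4 (x u v) (y u v) (n1 u v) (n2 u v) > 0).
  { intros u v Huv. destruct (Hgf u v Huv) as ((?&?&?&?&?&?&?&?&?&?&?&_) & _).
    unfold orthonormal. tauto. }
  split; [exact Hon |].
  pose proof (smooth_cs D nu mu HD Hnu Hmu Hne) as Ss.
  pose proof (smooth_cp D nu mu HD Hnu Hmu Hne) as Sp.
  pose proof (fun u v => pu_cs D nu mu HD Hnu Hmu Hne u v) as Hsu.
  pose proof (fun u v => pv_cs D nu mu HD Hnu Hmu Hne u v) as Hsv.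
  pose proof (fun u v => codazzi_equations D nu mu HD Hnu Hmu Hne u v) as Hcod.
  pose proof (cs_canonical D nu mu Hne) as Hcs.
  pose proof (cs_pos nu mu) as Hs0.
  assert (Hqs : forall u v, D u v -> 0 < cq nu mu u v).
  { intros u v Huv. apply Rmult_lt_0_compat; trivial. now apply Hgf. }
  assert (HE : forall u v, D u v -> E_ z u v = cs nu mu u v ^ 2 /\ G_ z u v = cs nu mu u v ^ 2).
  { intros u v Huv. destruct (Hcan u v Huv) as (_ & _ & _ & _ & H1 & H2).
    specialize (Hcs u v Huv).
    assert (Hr : sqrt (Rabs (mu u v ^ 2 - nu u v ^ 2)) <> 0) by (intro H0; rewrite H0 in Hcs; lra).
    split; apply (Rmult_eq_reg_r _ _ _) with (2 := Hr); lra. }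
  assert (Hzu : forall u v, D u v -> Pu z u v = vscale (cs nu mu u v) (x u v)).
  { intros u v Huv. destruct (Hcan u v Huv) as (_ & H1 & _). destruct (HE u v Huv) as [E1 _].
    rewrite E1, sqrt_pow2 in H1 by (left; apply Hs0). rewrite H1. unfold zu, vscale.
    pose proof (Hs0 u v). apply V4_ext; simpl; field; lra. }
  assert (Hzv : forall u v, D u v -> Pv z u v = vscale (cs nu mu u v) (y u v)).
  { intros u v Huv. destruct (Hcan u v Huv) as (_ & _ & H1 & _). destruct (HE u v Huv) as [_ E1].
    rewrite E1, sqrt_pow2 in H1 by (left; apply Hs0). rewrite H1. unfold zv, vscale.
    pose proof (Hs0 u v). apply V4_ext; simpl; field; lra. }
  assert (Hvs : forall a b k, vdot a (vscale k b) = k * vdot a b).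
  { intros. unfold vdot, vscale; simpl. ring. }
  assert (Hvc : forall a b, vdot a b = vdot b a).
  { intros. unfold vdot. ring. }
  assert (Dx : forall W u v, D u v -> dirD z x W u v = vscale (/ cs nu mu u v) (Pu W u v) /\
     dirD z y W u v = vscale (/ cs nu mu u v) (Pv W u v)).
  { intros W u v Huv. pose proof (Hs0 u v) as Hsp. destruct (HE u v Huv) as [E1 E2].
    destruct (Hcan u v Huv) as (EF & _). destruct (Hon u v Huv) as ((Exx&Eyy&_&_&Exy&_)&_).
    unfold dirD, tca, tcb, detg. unfold zu, zv. rewrite E1, E2, EF, Hzu, Hzv, !Hvs by trivial.
    rewrite (Hvc (y u v) (x u v)), Exx, Eyy, Exy.
    split; unfold vadd, vscale; apply V4_ext; simpl; field; lra. }
  (* Smoothness of [g1], [g2], [b1], [b2] is not given, so these coefficients are only compared with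
     others and never differentiated. *)
  set (al := fun u v => cs nu mu u v * g1 u v). set (be := fun u v => cs nu mu u v * g2 u v).
  set (A := fun u v => cs nu mu u v * b1 u v). set (B := fun u v => cs nu mu u v * b2 u v).
  assert (Hfr : forall u v, D u v ->
    Pu x u v = vadd (vscale (al u v) (y u v)) (vscale (cp nu mu u v) (n1 u v)) /\
    Pu y u v = vadd (vscale (- al u v) (x u v)) (vscale (cq nu mu u v) (n2 u v)) /\
    Pu n1 u v = vadd (vscale (- cp nu mu u v) (x u v)) (vscale (A u v) (n2 u v)) /\
    Pu n2 u v = vadd (vscale (- cq nu mu u v) (y u v)) (vscale (- A u v) (n1 u v)) /\
    Pv x u v = vadd (vscale (- be u v) (y u v)) (vscale (cq nu mu u v) (n2 u v)) /\
    Pv y u v = vadd (vscale (be u v) (x u v)) (vscale (- cp nu mu u v) (n1 u v)) /\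
    Pv n1 u v = vadd (vscale (cp nu mu u v) (y u v)) (vscale (B u v) (n2 u v)) /\
    Pv n2 u v = vadd (vscale (- cq nu mu u v) (x u v)) (vscale (- B u v) (n1 u v))).
  { intros u v Huv. pose proof (Hs0 u v) as Hsp.
    destruct (Hgf u v Huv) as (_&_&_&_&_&_&E1&E2&E3&E4&E5&E6&E7&E8).
    assert (Hinv : forall a b k, k <> 0 -> vscale (/ k) a = b -> a = vscale k b).
    { intros a b k Hk <-. unfold vscale. apply V4_ext; simpl; field; trivial. }
    rewrite (proj1 (Dx x u v Huv)) in E1. rewrite (proj1 (Dx y u v Huv)) in E2.
    rewrite (proj2 (Dx x u v Huv)) in E3. rewrite (proj2 (Dx y u v Huv)) in E4.
    rewrite (proj1 (Dx n1 u v Huv)) in E5. rewrite (proj2 (Dx n1 u v Huv)) in E6.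
    rewrite (proj1 (Dx n2 u v Huv)) in E7. rewrite (proj2 (Dx n2 u v Huv)) in E8.
    apply Hinv in E1, E2, E3, E4, E5, E6, E7, E8; try lra.
    rewrite E1, E2, E3, E4, E5, E6, E7, E8. unfold al, be, A, B, cp, cq.
    unfold vadd, vscale. repeat split; apply V4_ext; simpl; ring. }
  clearbody al be A B. clear Hgf Hcan Dx HE.
  assert (Hal : forall u v, D u v -> al u v = - cwv nu mu u v /\ be u v = - cwu nu mu u v).
  { intros u v Huv. pose proof (Hs0 u v) as Hsp.
    pose proof (Pu_Pv_swap D z u v HD Hz Huv) as Hsw.
    rewrite (Pu_scale D (cs nu mu) y (Pv z) u v HD Ss Hy Hzv Huv) in Hsw.
    rewrite (Pv_scale D (cs nu mu) x (Pu z) u v HD Ss Hx Hzu Huv) in Hsw.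
    destruct (Hfr u v Huv) as (_&E2&_&_&E3&_). rewrite E2, E3, Hsu, Hsv in Hsw by trivial.
    destruct (Hon u v Huv) as [Ho _]. 
    set (s := cs nu mu u v) in *.
    assert (Hsw' : comb (x u v) (y u v) (n1 u v) (n2 u v) (- (s * al u v)) (s * cwu nu mu u v) 0 (s * cq nu mu u v) =
                   comb (x u v) (y u v) (n1 u v) (n2 u v) (s * cwv nu mu u v) (- (s * be u v)) 0 (s * cq nu mu u v)).
    { transitivity (vadd (vscale (s * cwu nu mu u v) (y u v))
        (vscale s (vadd (vscale (- al u v) (x u v)) (vscale (cq nu mu u v) (n2 u v))))).
      - unfold comb, vadd, vscale. apply V4_ext; simpl; ring.
      - rewrite Hsw. unfold comb, vadd, vscale. apply V4_ext; simpl; ring. }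
    (* Taking inner products with x and y, written as combinations so that [vdot_comb] applies,
       isolates the two tangential components. *)
    pose proof (f_equal (fun w => vdot w (comb (x u v) (y u v) (n1 u v) (n2 u v) 1 0 0 0)) Hsw') as F1.
    pose proof (f_equal (fun w => vdot w (comb (x u v) (y u v) (n1 u v) (n2 u v) 0 1 0 0)) Hsw') as F2.
    cbv beta in F1, F2. rewrite !vdot_comb in F1, F2 by trivial.
    split; apply (Rmult_eq_reg_l s); lra. }
  assert (HAB : forall u v, D u v -> A u v = cA nu mu u v /\ B u v = cB nu mu u v).
  { intros u v Huv. pose proof (Hqs u v Huv) as Hq0. destruct (Hal u v Huv) as [Ea Eb].
    destruct (Hcod u v Huv) as (Co1 & _ & Co2 & _).
    (* These products have the known smooth values cp, 0, 0, -cp. Differentiating them by the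
       Leibniz rule brings in A and B undifferentiated with the factor [cq], which [Hqs] allows to
       be cancelled. *)
    assert (Hd : forall a b, D a b -> vdot (Pu x a b) (n1 a b) = cp nu mu a b /\
      vdot (Pv x a b) (n1 a b) = 0 /\ vdot (Pu y a b) (n1 a b) = 0 /\
      vdot (Pv y a b) (n1 a b) = - cp nu mu a b).
    { intros a b Hab. destruct (Hfr a b Hab) as (E1&E2&_&_&E3&E4&_).
      destruct (Hon a b Hab) as [Ho _].
      rewrite E1, E2, E3, E4.
      assert (En : n1 a b = comb (x a b) (y a b) (n1 a b) (n2 a b) 0 0 1 0)
        by (unfold comb, vadd, vscale; apply V4_ext; simpl; ring).
      assert (Hc : forall k1 k2 k3 k4, vdot (comb (x a b) (y a b) (n1 a b) (n2 a b) k1 k2 k3 k4) (n1 a b) = k3).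
      { intros. rewrite En at 2. rewrite vdot_comb by trivial. ring. }
      repeat split.
      - transitivity (vdot (comb (x a b) (y a b) (n1 a b) (n2 a b) 0 (al a b) (cp nu mu a b) 0) (n1 a b));
          [f_equal; unfold comb, vadd, vscale; apply V4_ext; simpl; ring | apply Hc].
      - transitivity (vdot (comb (x a b) (y a b) (n1 a b) (n2 a b) 0 (- be a b) 0 (cq nu mu a b)) (n1 a b));
          [f_equal; unfold comb, vadd, vscale; apply V4_ext; simpl; ring | apply Hc].
      - transitivity (vdot (comb (x a b) (y a b) (n1 a b) (n2 a b) (- al a b) 0 0 (cq nu mu a b)) (n1 a b));
          [f_equal; unfold comb, vadd, vscale; apply V4_ext; simpl; ring | apply Hc].
      - transitivity (vdot (comb (x a b) (y a b) (n1 a b) (n2 a b) (be a b) 0 (- cp nu mu a b) 0) (n1 a b));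
          [f_equal; unfold comb, vadd, vscale; apply V4_ext; simpl; ring | apply Hc]. }
    assert (H0s : forall k, smooth_on D (fun _ _ => k)) by (intro; now apply smooth_const).
    pose proof (pv_vdot D (Pu x) n1 u v HD (vsmooth_pu _ _ Hx) Hn1 Huv) as X1.
    rewrite (pv_ext D (cp nu mu) _ u v HD (fun a b H => eq_sym (proj1 (Hd a b H))) Sp Huv) in X1.
    pose proof (pu_vdot D (Pv x) n1 u v HD (vsmooth_pv _ _ Hx) Hn1 Huv) as X2.
    rewrite (pu_ext D (fun _ _ => 0) _ u v HD (fun a b H => eq_sym (proj1 (proj2 (Hd a b H)))) (H0s 0) Huv) in X2.
    pose proof (pv_vdot D (Pu y) n1 u v HD (vsmooth_pu _ _ Hy) Hn1 Huv) as Y1.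
    rewrite (pv_ext D (fun _ _ => 0) _ u v HD (fun a b H => eq_sym (proj1 (proj2 (proj2 (Hd a b H))))) (H0s 0) Huv) in Y1.
    pose proof (pu_vdot D (Pv y) n1 u v HD (vsmooth_pv _ _ Hy) Hn1 Huv) as Y2.
    rewrite (pu_ext D (fun a b => - cp nu mu a b) _ u v HD (fun a b H => eq_sym (proj2 (proj2 (proj2 (Hd a b H))))) ltac:(smooth) Huv) in Y2.
    rewrite (pu_val (fun _ _ => 0) u v 0) in X2 by apply derivable_pt_lim_const.
    rewrite (pv_val (fun _ _ => 0) u v 0) in Y1 by apply derivable_pt_lim_const.
    assert (En : pu (fun a b => - cp nu mu a b) u v = - pu (cp nu mu) u v) by now pu_eq D.
    rewrite En in Y2.
    rewrite (Pu_Pv_swap D x u v HD Hx Huv) in X2. rewrite (Pu_Pv_swap D y u v HD Hy Huv) in Y2.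
    destruct (Hon u v Huv) as [Ho _].
    assert (Hdd : forall k1 k2 k3 k4 l1 l2 l3 l4 w w',
      w = comb (x u v) (y u v) (n1 u v) (n2 u v) k1 k2 k3 k4 ->
      w' = comb (x u v) (y u v) (n1 u v) (n2 u v) l1 l2 l3 l4 ->
      vdot w w' = k1 * l1 + k2 * l2 + k3 * l3 + k4 * l4).
    { intros. subst. now apply vdot_comb. }
    destruct (Hfr u v Huv) as (E1&E2&E5&_&E3&E4&E6&_).
    assert (W1 : vdot (Pu x u v) (Pv n1 u v) = al u v * cp nu mu u v).
    { rewrite (Hdd 0 (al u v) (cp nu mu u v) 0 0 (cp nu mu u v) 0 (B u v)); [ring | |];
        [rewrite E1 | rewrite E6]; unfold comb, vadd, vscale; apply V4_ext; simpl; ring. }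
    assert (W2 : vdot (Pv x u v) (Pu n1 u v) = cq nu mu u v * A u v).
    { rewrite (Hdd 0 (- be u v) 0 (cq nu mu u v) (- cp nu mu u v) 0 0 (A u v)); [ring | |];
        [rewrite E3 | rewrite E5]; unfold comb, vadd, vscale; apply V4_ext; simpl; ring. }
    assert (W3 : vdot (Pu y u v) (Pv n1 u v) = cq nu mu u v * B u v).
    { rewrite (Hdd (- al u v) 0 0 (cq nu mu u v) 0 (cp nu mu u v) 0 (B u v)); [ring | |];
        [rewrite E2 | rewrite E6]; unfold comb, vadd, vscale; apply V4_ext; simpl; ring. }
    assert (W4 : vdot (Pv y u v) (Pu n1 u v) = - (be u v * cp nu mu u v)).
    { rewrite (Hdd (be u v) 0 (- cp nu mu u v) 0 (- cp nu mu u v) 0 0 (A u v)); [ring | |];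
        [rewrite E4 | rewrite E5]; unfold comb, vadd, vscale; apply V4_ext; simpl; ring. }
    rewrite W1 in X1. rewrite W2 in X2. rewrite W3 in Y1. rewrite W4 in Y2.
    rewrite Ea in X1. rewrite Eb in Y2.
    split; apply (Rmult_eq_reg_l (cq nu mu u v)); lra. }
  intros u v Huv. destruct (Hfr u v Huv) as (E1&E2&E3&E4&E5&E6&E7&E8).
  destruct (Hal u v Huv) as [Ea Eb]. destruct (HAB u v Huv) as [EA EB].
  rewrite Hzu, Hzv, E1, E2, E3, E4, E5, E6, E7, E8, Ea, Eb, EA, EB, !Ropp_involutive by trivial.
  repeat split.
Qed.

Lemma det4_transpose e1 e2 e3 e4 :
  det4 (transpose c0 e1 e2 e3 e4) (transpose c1 e1 e2 e3 e4) (transpose c2 e1 e2 e3 e4)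
    (transpose c3 e1 e2 e3 e4) = det4 e1 e2 e3 e4.
Proof. unfold det4, det3, transpose; simpl. ring. Qed.

(** The square is the determinant of the product of the matrix with its transpose, which is the Gram
    matrix and hence the identity. *)
Lemma orthonormal_det4_sq e1 e2 e3 e4 : orthonormal e1 e2 e3 e4 -> det4 e1 e2 e3 e4 ^ 2 = 1.
Proof.
  intros Ho.
  transitivity (det4 e1 e2 e3 e4 * det4 (transpose c0 e1 e2 e3 e4) (transpose c1 e1 e2 e3 e4)
    (transpose c2 e1 e2 e3 e4) (transpose c3 e1 e2 e3 e4)); [rewrite det4_transpose; ring |].
  rewrite <- det4_comb. destruct Ho as (E11&E22&E33&E44&E12&E13&E14&E23&E24&E34).
  assert (Hc : forall w, comb (transpose c0 e1 e2 e3 e4) (transpose c1 e1 e2 e3 e4)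
    (transpose c2 e1 e2 e3 e4) (transpose c3 e1 e2 e3 e4) (c0 w) (c1 w) (c2 w) (c3 w) =
    mkV4 (vdot e1 w) (vdot e2 w) (vdot e3 w) (vdot e4 w)).
  { intro w. unfold comb, transpose, vdot, vadd, vscale. apply V4_ext; simpl; ring. }
  assert (Hvc : forall a b, vdot a b = vdot b a) by (intros; unfold vdot; ring).
  rewrite !Hc, (Hvc e2 e1), (Hvc e3 e1), (Hvc e4 e1), (Hvc e3 e2), (Hvc e4 e2), (Hvc e4 e3),
    E11, E22, E33, E44, E12, E13, E14, E23, E24, E34.
  unfold det4, det3; simpl. ring.
Qed.

(** Lets one argument serve all four coordinates, with linearity and differentiation proved once. *)
Definition coordinate (k : V4 -> R) : Prop := k = c0 \/ k = c1 \/ k = c2 \/ k = c3.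

Lemma coordinate_lin k a b v w : coordinate k ->
  k (vadd (vscale a v) (vscale b w)) = a * k v + b * k w.
Proof. intros [-> | [-> | [-> | ->]]]; reflexivity. Qed.

Lemma coordinate_comb k e1 e2 e3 e4 a1 a2 a3 a4 : coordinate k ->
  k (comb e1 e2 e3 e4 a1 a2 a3 a4) = a1 * k e1 + a2 * k e2 + a3 * k e3 + a4 * k e4.
Proof. intros [-> | [-> | [-> | ->]]]; unfold comb; simpl; ring. Qed.

Lemma coordinate_du D k X u v : coordinate k -> vsmooth_on D X -> D u v ->
  derivable_pt_lim (fun t => k (X t v)) u (k (Pu X u v)).
Proof.
  intros Hk (H0&H1&H2&H3) Huv. destruct Hk as [-> | [-> | [-> | ->]]]; simpl.
  - exact (smooth_du D _ u v H0 Huv).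
  - exact (smooth_du D _ u v H1 Huv).
  - exact (smooth_du D _ u v H2 Huv).
  - exact (smooth_du D _ u v H3 Huv).
Qed.
Lemma coordinate_dv D k X u v : coordinate k -> vsmooth_on D X -> D u v ->
  derivable_pt_lim (fun t => k (X u t)) v (k (Pv X u v)).
Proof.
  intros Hk (H0&H1&H2&H3) Huv. destruct Hk as [-> | [-> | [-> | ->]]]; simpl.
  - exact (smooth_dv D _ u v H0 Huv).
  - exact (smooth_dv D _ u v H1 Huv).
  - exact (smooth_dv D _ u v H2 Huv).
  - exact (smooth_dv D _ u v H3 Huv).
Qed.

Lemma frame_unique D z x y n1 n2 z' x' y' n1' n2' s p q wu wv A B :
  domain2 D -> vsmooth_on D z -> vsmooth_on D x -> vsmooth_on D y -> vsmooth_on D n1 ->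
  vsmooth_on D n2 -> vsmooth_on D z' -> vsmooth_on D x' -> vsmooth_on D y' -> vsmooth_on D n1' ->
  vsmooth_on D n2' ->
  (forall u v, D u v -> orthonormal (x u v) (y u v) (n1 u v) (n2 u v) /\
       det4 (x u v) (y u v) (n1 u v) (n2 u v) > 0) ->
  (forall u v, D u v -> orthonormal (x' u v) (y' u v) (n1' u v) (n2' u v) /\
       det4 (x' u v) (y' u v) (n1' u v) (n2' u v) > 0) ->
  frame_eqs D z x y n1 n2 s p q wu wv A B -> frame_eqs D z' x' y' n1' n2' s p q wu wv A B ->
  exists m, is_rigid_motion m /\ forall u v, D u v -> z' u v = apply_motion m (z u v).
Proof.
  intros (HD & (u0 & v0 & H0) & HP) Hz Hx Hy Hn1 Hn2 Hz' Hx' Hy' Hn1' Hn2' Hon Hon' Hf Hf'.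
  (* [r k] is the image of the [k]-th basis vector under the rotation carrying one frame to the
     other *)
  set (r := fun (k : V4 -> R) u v => comb (x' u v) (y' u v) (n1' u v) (n2' u v)
              (k (x u v)) (k (y u v)) (k (n1 u v)) (k (n2 u v))).
  assert (Hcst : forall k, coordinate k -> forall u v, D u v -> r k u v = r k u0 v0).
  { intros k Hk u v Huv.
    assert (Hl : forall l, coordinate l -> l (r k u v) = l (r k u0 v0)).
    { intros l Hl. unfold r. rewrite !coordinate_comb by trivial.
      apply (path_constant D (fun u v => k (x u v) * l (x' u v) + k (y u v) * l (y' u v) +
        k (n1 u v) * l (n1' u v) + k (n2 u v) * l (n2' u v)) HD HP); trivial.
      - intros a b Hab.
        destruct (Hf a b Hab) as (_&_&E1&E2&E3&E4&_). destruct (Hf' a b Hab) as (_&_&F1&F2&F3&F4&_).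
        evar (d : R). replace 0 with d; unfold d; clear d.
        + repeat apply derivable_pt_lim_plus; apply derivable_pt_lim_mult;
            apply (coordinate_du D); trivial.
        + rewrite E1, E2, E3, E4, F1, F2, F3, F4, !coordinate_lin by trivial. ring.
      - intros a b Hab.
        destruct (Hf a b Hab) as (_&_&_&_&_&_&E1&E2&E3&E4).
        destruct (Hf' a b Hab) as (_&_&_&_&_&_&F1&F2&F3&F4).
        evar (d : R). replace 0 with d; unfold d; clear d.
        + repeat apply derivable_pt_lim_plus; apply derivable_pt_lim_mult;
            apply (coordinate_dv D); trivial.
        + rewrite E1, E2, E3, E4, F1, F2, F3, F4, !coordinate_lin by trivial. ring. }
    apply V4_ext; apply Hl; unfold coordinate; tauto. }
  assert (K0 : coordinate c0) by (unfold coordinate; tauto).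
  assert (K1 : coordinate c1) by (unfold coordinate; tauto).
  assert (K2 : coordinate c2) by (unfold coordinate; tauto).
  assert (K3 : coordinate c3) by (unfold coordinate; tauto).
  set (rot := fun w : V4 => comb (r c0 u0 v0) (r c1 u0 v0) (r c2 u0 v0) (r c3 u0 v0)
                              (c0 w) (c1 w) (c2 w) (c3 w)).
  (* By [Hcst] the rotation defined at the base point can be computed from the frames at any other
     point. *)
  assert (Hrot : forall u v w, D u v -> rot w = comb (x' u v) (y' u v) (n1' u v) (n2' u v)
    (vdot w (x u v)) (vdot w (y u v)) (vdot w (n1 u v)) (vdot w (n2 u v))).
  { intros u v w Huv. unfold rot. rewrite <- !(fun k H => Hcst k H u v Huv) by trivial.
    unfold r, comb, vdot, vadd, vscale. apply V4_ext; simpl; ring. }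
  assert (Hrx : forall u v, D u v -> rot (x u v) = x' u v /\ rot (y u v) = y' u v).
  { intros u v Huv. destruct (Hon u v Huv) as [(Exx&Eyy&_&_&Exy&Ex1&Ex2&Ey1&Ey2&_) _].
    assert (Eyx : vdot (y u v) (x u v) = 0) by (rewrite <- Exy; unfold vdot; ring).
    rewrite !(Hrot u v) by trivial.
    rewrite Exx, Eyy, Exy, Ex1, Ex2, Ey1, Ey2, Eyx. unfold comb, vadd, vscale.
    split; apply V4_ext; simpl; ring. }
  (* The translation matches the two surfaces at the base point. *)
  set (t := vsub (z' u0 v0) (rot (z u0 v0))).
  exists (mkMotion (r c0 u0 v0) (r c1 u0 v0) (r c2 u0 v0) (r c3 u0 v0) t).
  destruct (Hon u0 v0 H0) as [Ho Hdet]. destruct (Hon' u0 v0 H0) as [Ho' Hdet'].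
  assert (Hr : orthonormal (r c0 u0 v0) (r c1 u0 v0) (r c2 u0 v0) (r c3 u0 v0)).
  { assert (Ht : orthonormal (transpose c0 (x u0 v0) (y u0 v0) (n1 u0 v0) (n2 u0 v0))
      (transpose c1 (x u0 v0) (y u0 v0) (n1 u0 v0) (n2 u0 v0))
      (transpose c2 (x u0 v0) (y u0 v0) (n1 u0 v0) (n2 u0 v0))
      (transpose c3 (x u0 v0) (y u0 v0) (n1 u0 v0) (n2 u0 v0))).
    { apply orthonormal_transpose. unfold transpose; simpl.
      destruct (x u0 v0), (y u0 v0), (n1 u0 v0), (n2 u0 v0); exact Ho. }
    unfold orthonormal, r. rewrite !vdot_comb by trivial. exact Ht. }
  (* Orthonormality leaves 1 or -1; the product formula with the two positively oriented frames
     excludes -1. *)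
  assert (Hd1 : det4 (r c0 u0 v0) (r c1 u0 v0) (r c2 u0 v0) (r c3 u0 v0) = 1).
  { assert (Hpos : 0 < det4 (r c0 u0 v0) (r c1 u0 v0) (r c2 u0 v0) (r c3 u0 v0)).
    { pose proof (det4_comb (transpose c0 (x u0 v0) (y u0 v0) (n1 u0 v0) (n2 u0 v0))
        (transpose c1 (x u0 v0) (y u0 v0) (n1 u0 v0) (n2 u0 v0))
        (transpose c2 (x u0 v0) (y u0 v0) (n1 u0 v0) (n2 u0 v0))
        (transpose c3 (x u0 v0) (y u0 v0) (n1 u0 v0) (n2 u0 v0))
        (x' u0 v0) (y' u0 v0) (n1' u0 v0) (n2' u0 v0)) as Hm.
      rewrite det4_transpose in Hm. cbv zeta beta in Hm. unfold r.
      change (det4 (r c0 u0 v0) (r c1 u0 v0) (r c2 u0 v0) (r c3 u0 v0) =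
        det4 (x u0 v0) (y u0 v0) (n1 u0 v0) (n2 u0 v0) *
        det4 (x' u0 v0) (y' u0 v0) (n1' u0 v0) (n2' u0 v0)) in Hm.
      fold (r c0 u0 v0) (r c1 u0 v0) (r c2 u0 v0) (r c3 u0 v0). rewrite Hm.
      now apply Rmult_lt_0_compat. }
    pose proof (orthonormal_det4_sq _ _ _ _ Hr). nra. }
  split.
  - destruct Hr as (?&?&?&?&?&?&?&?&?&?). unfold is_rigid_motion; simpl. tauto.
  - intros u v Huv.
    assert (Hap : forall w, apply_motion
      (mkMotion (r c0 u0 v0) (r c1 u0 v0) (r c2 u0 v0) (r c3 u0 v0) t) w = vadd (rot w) t)
      by reflexivity.
    rewrite Hap.
    (* z' - rot z has zero derivatives, because [rot] takes z_u = s x to s x' and z_v = s y to s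
       y'. *)
    assert (Hl : forall l, coordinate l -> l (z' u v) - l (rot (z u v)) = l (z' u0 v0) - l (rot (z u0 v0))).
    { intros l Hl.
      apply (path_constant D (fun u v => l (z' u v) - l (rot (z u v))) HD HP); trivial; intros a b Hab.
      - destruct (Hf a b Hab) as (E1&_). destruct (Hf' a b Hab) as (F1&_).
        replace 0 with (l (Pu z' a b) - l (rot (Pu z a b))).
        + apply derivable_pt_lim_minus; [now apply (coordinate_du D) |].
          unfold rot. rewrite coordinate_comb by trivial.
          apply (derivable_pt_lim_ext (fun t => c0 (z t b) * l (r c0 u0 v0) + c1 (z t b) * l (r c1 u0 v0) +
            c2 (z t b) * l (r c2 u0 v0) + c3 (z t b) * l (r c3 u0 v0)));
            [intro; now rewrite coordinate_comb |].
          repeat apply derivable_pt_lim_plus; apply derivable_pt_lim_scal_right;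
            now apply (coordinate_du D).
        + rewrite E1, F1. destruct (Hrx a b Hab) as [Ex _].
          assert (Es : forall k w, rot (vscale k w) = vscale k (rot w))
            by (intros; unfold rot, comb, vadd, vscale; apply V4_ext; simpl; ring).
          rewrite Es, Ex. ring.
      - destruct (Hf a b Hab) as (_&E1&_). destruct (Hf' a b Hab) as (_&F1&_).
        replace 0 with (l (Pv z' a b) - l (rot (Pv z a b))).
        + apply derivable_pt_lim_minus; [now apply (coordinate_dv D) |].
          unfold rot. rewrite coordinate_comb by trivial.
          apply (derivable_pt_lim_ext (fun t => c0 (z a t) * l (r c0 u0 v0) + c1 (z a t) * l (r c1 u0 v0) +
            c2 (z a t) * l (r c2 u0 v0) + c3 (z a t) * l (r c3 u0 v0)));
            [intro; now rewrite coordinate_comb |].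
          repeat apply derivable_pt_lim_plus; apply derivable_pt_lim_scal_right;
            now apply (coordinate_dv D).
        + rewrite E1, F1. destruct (Hrx a b Hab) as [_ Ey].
          assert (Es : forall k w, rot (vscale k w) = vscale k (rot w))
            by (intros; unfold rot, comb, vadd, vscale; apply V4_ext; simpl; ring).
          rewrite Es, Ey. ring. }
    unfold t, vsub. apply V4_ext; simpl.
    + specialize (Hl c0 K0). simpl in Hl. lra.
    + specialize (Hl c1 K1). simpl in Hl. lra.
    + specialize (Hl c2 K2). simpl in Hl. lra.
    + specialize (Hl c3 K3). simpl in Hl. lra.
Qed.

(** * Existence on a small square and uniqueness on every subdomain *)

Theorem theorem6p4 (D : R -> R -> Prop) (nu mu : R -> R -> R) :
  domain2 D -> smooth_on D nu -> smooth_on D mu ->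
  (forall u v, D u v ->
     mu u v > 0 /\ nu u v <> 0 /\ mu u v ^ 2 <> nu u v ^ 2 /\
     pv (fun a b => Rabs (mu a b ^ 2 - nu a b ^ 2)) u v *
     pu (fun a b => Rabs (mu a b ^ 2 - nu a b ^ 2)) u v <> 0 /\
     / 4 * sqrt (Rabs (mu u v ^ 2 - nu u v ^ 2)) *
       lap (fun a b => ln (Rabs (mu a b ^ 2 - nu a b ^ 2))) u v
       + nu u v ^ 2 + mu u v ^ 2 = 0 /\
     / 2 * sqrt (Rabs (mu u v ^ 2 - nu u v ^ 2)) *
       lap (fun a b => ln (Rabs ((mu a b + nu a b) / (mu a b - nu a b)))) u v
       + 2 * nu u v * mu u v = 0) ->
  (exists (D0 : R -> R -> Prop) (z : VF),
     subdomain D0 D /\ canonical_SRMGT z D0 nu mu) /\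
  (forall (D0 : R -> R -> Prop) (z1 z2 : VF),
     subdomain D0 D -> canonical_SRMGT z1 D0 nu mu -> canonical_SRMGT z2 D0 nu mu ->
     exists m : motion, is_rigid_motion m /\
       forall u v, D0 u v -> z2 u v = apply_motion m (z1 u v)).
Proof.
  intros (HD & (u0 & v0 & H0) & _) Hnu Hmu H. split.
  - assert (Hne : forall u v, D u v -> mu u v ^ 2 <> nu u v ^ 2) by (intros; now apply H).
    pose proof (smooth_cs D nu mu HD Hnu Hmu Hne) as Ss.
    pose proof (smooth_cp D nu mu HD Hnu Hmu Hne) as Sp.
    pose proof (smooth_cq D nu mu HD Hnu Hmu Hne) as Sq.
    pose proof (smooth_cwu D nu mu HD Hnu Hmu Hne) as Swu.
    pose proof (smooth_cwv D nu mu HD Hnu Hmu Hne) as Swv.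
    pose proof (smooth_cA D nu mu HD Hnu Hmu Hne) as SA.
    pose proof (smooth_cB D nu mu HD Hnu Hmu Hne) as SB.
    pose proof (pu_cs D nu mu HD Hnu Hmu Hne) as Esu.
    pose proof (pv_cs D nu mu HD Hnu Hmu Hne) as Esv.
    assert (Eg : forall u v, D u v ->
      pu (cwu nu mu) u v + pv (cwv nu mu) u v = cp nu mu u v ^ 2 + cq nu mu u v ^ 2).
    { intros u v Huv. apply (gauss_equation D); trivial. now apply H. }
    assert (Er : forall u v, D u v ->
      pu (cB nu mu) u v - pv (cA nu mu) u v = - (2 * cp nu mu u v * cq nu mu u v)).
    { intros u v Huv. apply (ricci_equation D); trivial. now apply H. }
    destruct (moving_frame_exists D (cs nu mu) (cp nu mu) (cq nu mu) (cwu nu mu) (cwv nu mu)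
      (cA nu mu) (cB nu mu) HD Ss Sp Sq Swu Swv SA SB Esu Esv Eg Er
      (codazzi_equations D nu mu HD Hnu Hmu Hne) u0 v0 H0)
      as (r & z & x & y & n1 & n2 & Hr & Hsub & Hz & Hx & Hy & Hn1 & Hn2 & Hfr & Hon).
    exists (square u0 v0 r), z. split.
    { split; [now apply domain2_square | trivial]. }
    pose proof (open2_square u0 v0 r) as HQ.
    apply (canonical_SRMGT_frame (square u0 v0 r) z x y n1 n2 (cs nu mu) (cp nu mu) (cq nu mu)
      (cwu nu mu) (cwv nu mu) (cA nu mu) (cB nu mu)); try assumption;
      try (eapply smooth_sub; eassumption); try reflexivity; try (intros; now apply H, Hsub);
      try (intros; now auto).
    + intros. now apply Hon.
    + intros. apply cs_pos.
    + intros u v Huv. destruct (Hon u v Huv) as [_ ->]. lra.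
    (* Strong regularity: both partial derivatives of |mu^2 - nu^2| are nonzero, and they are
       multiples of wu and wv. *)
    + intros u v Huv. destruct (H u v (Hsub u v Huv)) as (_ & _ & _ & Hn & _).
      rewrite (pu_Rabs_lnf D), (pv_Rabs_lnf D) in Hn by auto.
      unfold cwu, cwv. intro E. apply Hn.
      assert (E' : pu (lnf nu mu) u v * pv (lnf nu mu) u v = 0) by lra.
      replace (Rabs (mu u v ^ 2 - nu u v ^ 2) * pv (lnf nu mu) u v *
        (Rabs (mu u v ^ 2 - nu u v ^ 2) * pu (lnf nu mu) u v)) with
        (Rabs (mu u v ^ 2 - nu u v ^ 2) ^ 2 * (pu (lnf nu mu) u v * pv (lnf nu mu) u v)) by ring.
      rewrite E'. ring.
    + intros u v Huv. apply (cs_canonical D); auto.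
  - intros D0 z1 z2 [HD0 Hsub] Hz1 Hz2.
    assert (Hnu0 : smooth_on D0 nu) by now apply (smooth_sub D).
    assert (Hmu0 : smooth_on D0 mu) by now apply (smooth_sub D).
    destruct (canonical_frame D0 z1 nu mu (proj1 HD0) Hnu0 Hmu0 Hz1)
      as (x1 & y1 & n1 & m1 & Z1 & X1 & Y1 & N1 & M1 & On1 & F1).
    destruct (canonical_frame D0 z2 nu mu (proj1 HD0) Hnu0 Hmu0 Hz2)
      as (x2 & y2 & n2 & m2 & Z2 & X2 & Y2 & N2 & M2 & On2 & F2).
    exact (frame_unique D0 z1 x1 y1 n1 m1 z2 x2 y2 n2 m2 _ _ _ _ _ _ _ HD0 Z1 X1 Y1 N1 M1
      Z2 X2 Y2 N2 M2 On1 On2 F1 F2).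
Qed.
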